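(* Let $k\ge 1$, let $\Theta\leq\mathrm{Sym}(\{0,\dots,k-1\})$ be robust, let $U$ be a countably infinite set, let $\lambda:U\curvearrowleft\Theta$ be a seed action, and let $(G,(T_\Omega)_{\Omega\in\mathcal{D}(\Theta)})$ be a completion of $\Theta$. Then the space $\mathsf{T}_\lambda(U,G)$ is a non-empty perfect Polish space (hence has cardinality $2^{\aleph_0}$), and the subspace $\mathsf{STT}_{\Theta,\lambda}(U,G)$ is a dense $G_\delta$ subset of $\mathsf{T}_\lambda(U,G)$.
   Context: All actions are right actions. Write $\mathbf{k}=\{0,\dots,k-1\}$ and let $\pi:\mathbf{k}\curvearrowleft\Theta$ be the permutation action. For an action $\mu$ of a group on a set and a subgroup $\Omega$, $\mathrm{NFr}_\mu(\Omega)$ is the union of the non-free orbits of $\mu|_\Omega$ (an orbit is free if its points have trivial stabiliser). $\Theta$ is robust if for each $\Omega\leq\Theta$ and each non-empty $\Omega$-invariant $X\subseteq\mathrm{NFr}_\pi(\Omega)$, $|\Omega|$ does not divide $|X|$. A subgroup $\Omega\leq\Theta$ is docile if $\pi|_\Omega$ has at least one free orbit. Fix a set $\mathcal{D}(\Theta)$ of representatives of the $\Theta$-conjugacy classes of docile subgroups of $\Theta$. Completion: for each $\Omega\in\mathcal{D}(\Theta)$ let $T_\Omega$ be a finite set with at least two elements, and let $F$ be the free group on the disjoint union of the sets $T_\Omega$. The completion $G$ of $\Theta$ is the quotient of $\Theta\ast F$ by the normal closure of $\{[\omega,t]:\Omega\in\mathcal{D}(\Theta),\ \omega\in\Omega,\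 t\in T_\Omega\}$; $\Theta$ is regarded as a subgroup of $G$. Seed action: an action $\lambda:U\curvearrowleft\Theta$ with infinitely many orbits such that there is a $\Theta$-invariant set $V\subseteq U$ with $\lambda|_V$ isomorphic as a $\Theta$-action to $\pi:\mathbf{k}\curvearrowleft\Theta$ and with the action on $U\setminus V$ free. Spaces of actions: the set of actions of $G$ on $U$ is topologised as a subspace of $\mathrm{Sym}(U)^G$, where $\mathrm{Sym}(U)$ has the pointwise convergence topology ($U$ discrete). $\mathsf{T}_\lambda(U,G)$ is the subspace of all actions $\mu:U\curvearrowleft G$ with $\mu|_\Theta=\lambda$ that are taut, i.e.: (1) $\mu$ is $k$-sharp: no non-identity element of $G$ fixes $k$ distinct points; (2) for $\Omega\in\mathcal{D}(\Theta)$ and $t\in T_\Omega$, every point of $\mathrm{NFr}_\lambda(\Omega)$ is fixed by $t$; (3) for $\Omega\in\mathcal{D}(\Theta)$ and finite $A\subseteq U$, if $A$ is invariant under every $t\in T_\Omega$ then $A\subseteq\mathrm{NFr}_\lambda(\Omega)$. $\mathsf{STT}_{\Theta,\lambda}(U,G)$ is the set of $\mu\in\mathsf{T}_\lambda(U,G)$ that are sharply $\Theta$-transitive, i.e. transitive on $k$-element subsets of $U$ and such that for each $k$-element $A\subseteq U$ the action of the setwise stabiliser $G_{\{A\}}$ on $A$ is isomorphic to $\pi:\mathbf{k}\curvearrowleft\Theta$ (via a bijection $A\to\mathbf{k}$ equivariant with respect to some group isomorphism $G_{\{A\}}\to\Theta$). *)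

(* Defs.v *)
From HB Require Import structures.
From mathcomp Require Import all_boot all_order all_algebra all_fingroup.
From mathcomp Require Import all_classical all_reals all_analysis.

Set Implicit Arguments.
Unset Strict Implicit.
Unset Printing Implicit Defensive.

Import Order.TTheory GRing.Theory Num.Theory.

Local Open Scope classical_set_scope.
Local Open Scope card_scope.
Local Open Scope quotient_scope.
Local Open Scope group_scope.

(* [fingroup.repr] shadows the representative of a quotient class. *)
Local Notation repr := generic_quotient.repr.

Section Presentation.
Variables (X : choiceType) (inv : X -> X) (R : seq X -> seq X -> Prop).

(* The least congruence on words that contains [R] and makes the letter
   [inv x] a two-sided inverse of the letter [x]. *)
Inductive word_cong : seq X -> seq X -> Prop :=
| cong_rel u v : R u v -> word_cong u v
| cong_mulV x : word_cong [:: x; inv x] [::]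
| cong_Vmul x : word_cong [:: inv x; x] [::]
| cong_refl u : word_cong u u
| cong_sym u v : word_cong u v -> word_cong v u
| cong_trans v u w : word_cong u v -> word_cong v w -> word_cong u w
| cong_cat u u' v v' :
    word_cong u u' -> word_cong v v' -> word_cong (u ++ v) (u' ++ v').

Definition word_congb : rel (seq X) := fun u v => `[< word_cong u v >].

Lemma word_congb_refl : reflexive word_congb.
Proof. by move=> u; apply/asboolP/cong_refl. Qed.

Lemma word_congb_sym : symmetric word_congb.
Proof. by move=> u v; apply/asboolP/asboolP; apply: cong_sym. Qed.

Lemma word_congb_trans : transitive word_congb.
Proof.
by move=> v u w /asboolP uv /asboolP vw; apply/asboolP/(cong_trans uv vw).
Qed.

Canonical word_cong_equiv :=
  EquivRel word_congb word_congb_refl word_congb_sym word_congb_trans.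

Definition presented : Type := {eq_quot word_cong_equiv}.

HB.instance Definition _ := Quotient.on presented.
HB.instance Definition _ := Choice.on presented.

Definition word_class (u : seq X) : presented := \pi_presented u.

Lemma word_classP u v : word_class u = word_class v <-> word_cong u v.
Proof.
by rewrite /word_class; split=> [/eqmodP/asboolP|uv]; last exact/eqmodP/asboolP.
Qed.

Definition presented_mul (a b : presented) := word_class (repr a ++ repr b).
Definition presented_inv (a : presented) := word_class (rev (map inv (repr a))).

Lemma repr_word u : word_cong (repr (word_class u)) u.
Proof. by apply/word_classP; rewrite /word_class reprK. Qed.

Lemma word_classM u v :
  presented_mul (word_class u) (word_class v) = word_class (u ++ v).
Proof. by apply/word_classP/cong_cat; exact: repr_word. Qed.

Lemma word_class_surj (a : presented) : exists u, a = word_class u.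
Proof. by exists (repr a); rewrite /word_class reprK. Qed.

Lemma presented_mulA : associative presented_mul.
Proof.
move=> a b c; have [[u ->] [v ->]] := (word_class_surj a, word_class_surj b).
by have [w ->] := word_class_surj c; rewrite !word_classM catA.
Qed.

Lemma presented_mul1 : left_id (word_class [::]) presented_mul.
Proof. by move=> a; have [u ->] := word_class_surj a; rewrite word_classM. Qed.

Lemma presented_1mul : right_id (word_class [::]) presented_mul.
Proof.
by move=> a; have [u ->] := word_class_surj a; rewrite word_classM cats0.
Qed.

Lemma presented_mulV : left_inverse (word_class [::]) presented_inv presented_mul.
Proof.
move=> a; rewrite /presented_mul; apply/word_classP.
apply: cong_trans (cong_cat (repr_word _) (cong_refl _)) _.
elim: (repr a) => [|x w IHw]; first exact: cong_refl.
rewrite map_cons rev_cons cat_rcons -[inv x :: _]/([:: inv x; x] ++ w).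
apply: cong_trans IHw; apply: cong_cat (cong_refl _) _.
exact: (cong_cat (cong_Vmul x) (cong_refl _)).
Qed.

Lemma presented_Vmul : right_inverse (word_class [::]) presented_inv presented_mul.
Proof.
move=> a; rewrite /presented_mul; apply/word_classP.
apply: cong_trans (cong_cat (cong_refl _) (repr_word _)) _.
elim: (repr a) => [|x w IHw]; first exact: cong_refl.
rewrite map_cons rev_cons -cats1 catA -cat1s -[(_ ++ w) ++ _]catA.
apply: cong_trans (cong_cat (cong_cat (cong_refl _) IHw) (cong_refl _)) _.
by rewrite cats0; apply: cong_mulV.
Qed.

HB.instance Definition _ := isGroup.Build presented
  presented_mulA presented_mul1 presented_1mul presented_mulV presented_Vmul.

End Presentation.

(* The letter [(s, true)] is the generator [s] and [(s, false)] its inverse. *)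
Definition free_group (S : choiceType) : Type :=
  presented (fun x : S * bool => (x.1, ~~ x.2)) (fun _ _ => False).

HB.instance Definition _ (S : choiceType) := Group.on (free_group S).

Definition free_gen (S : choiceType) (s : S) : free_group S :=
  word_class _ _ [:: (s, true)].

Section FreeProduct.
Variables A B : groupType.

Definition free_prod_inv (x : A + B) : A + B :=
  match x with inl a => inl a^-1 | inr b => inr b^-1 end.

Inductive free_prod_rel : seq (A + B) -> seq (A + B) -> Prop :=
| free_prod_1l : free_prod_rel [:: inl 1] [::]
| free_prod_1r : free_prod_rel [:: inr 1] [::]
| free_prod_Ml a a' : free_prod_rel [:: inl a; inl a'] [:: inl (a * a')]
| free_prod_Mr b b' : free_prod_rel [:: inr b; inr b'] [:: inr (b * b')].

Definition free_prod : Type := presented free_prod_inv free_prod_rel.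

HB.instance Definition _ := Group.on free_prod.

Definition free_prod_inl (a : A) : free_prod := word_class _ _ [:: inl a].
Definition free_prod_inr (b : B) : free_prod := word_class _ _ [:: inr b].

End FreeProduct.

Section NormalQuotient.
Variables (H : groupType) (S : set H).

Definition normal_subgroup (N : set H) :=
  [/\ N 1, forall x y, N x -> N y -> N (x * y), forall x, N x -> N x^-1
    & forall x y, N x -> N (x ^ y)].

Definition normal_closure : set H := smallest normal_subgroup S.

Lemma normal_closure_normal : normal_subgroup normal_closure.
Proof.
split=> [N [[]]//|x y Nx Ny N nSN|x Nx N nSN|x y Nx N nSN];
  have [[_ NM NV NJ] _] := nSN.
- by apply: NM; [apply: Nx|apply: Ny].
- by apply: NV; apply: Nx.
- by apply: NJ; apply: Nx.
Qed.

Definition coset_eq : rel H := fun x y => `[< normal_closure (x * y^-1) >].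

Lemma coset_eq_refl : reflexive coset_eq.
Proof.
by move=> x; apply/asboolP; rewrite mulgV; case: normal_closure_normal.
Qed.

Lemma coset_eq_sym : symmetric coset_eq.
Proof.
suff s x y : coset_eq x y -> coset_eq y x by move=> x y; apply/idP/idP; apply: s.
have [_ _ NV _] := normal_closure_normal.
by move=> /asboolP/NV Nyx; apply/asboolP; rewrite invgM invgK in Nyx.
Qed.

Lemma coset_eq_trans : transitive coset_eq.
Proof.
move=> y x z /asboolP xy /asboolP yz; apply/asboolP.
have [_ NM _ _] := normal_closure_normal.
by have := NM _ _ xy yz; rewrite mulgA mulgKV.
Qed.

Canonical coset_equiv :=
  EquivRel coset_eq coset_eq_refl coset_eq_sym coset_eq_trans.

Definition nquot : Type := {eq_quot coset_equiv}.

HB.instance Definition _ := Quotient.on nquot.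
HB.instance Definition _ := Choice.on nquot.

Definition nproj (x : H) : nquot := \pi_nquot x.

Lemma nprojP x y : nproj x = nproj y <-> normal_closure (x * y^-1).
Proof.
by rewrite /nproj; split=> [/eqmodP/asboolP|xy]; last exact/eqmodP/asboolP.
Qed.

Definition nquot_mul (a b : nquot) := nproj (repr a * repr b).
Definition nquot_inv (a : nquot) := nproj (repr a)^-1.

Lemma nproj_surj (a : nquot) : exists x, a = nproj x.
Proof. by exists (repr a); rewrite /nproj reprK. Qed.

Lemma nproj_mul x y : nquot_mul (nproj x) (nproj y) = nproj (x * y).
Proof.
have [_ NM _ NJ] := normal_closure_normal.
have nr z : normal_closure (repr (nproj z) * z^-1).
  by apply/nprojP; rewrite /nproj reprK.
apply/nprojP; have := NM _ _ (nr x) (NJ _ x^-1 (nr y)).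
by rewrite /conjg invgK invgM !mulgA mulgKV.
Qed.

Lemma nquot_mulA : associative nquot_mul.
Proof.
move=> a b c; have [[x ->] [y ->]] := (nproj_surj a, nproj_surj b).
by have [z ->] := nproj_surj c; rewrite !nproj_mul mulgA.
Qed.

Lemma nquot_1mul : left_id (nproj 1) nquot_mul.
Proof. by move=> a; have [x ->] := nproj_surj a; rewrite nproj_mul mul1g. Qed.

Lemma nquot_mul1 : right_id (nproj 1) nquot_mul.
Proof. by move=> a; have [x ->] := nproj_surj a; rewrite nproj_mul mulg1. Qed.

Lemma nquot_mulV : left_inverse (nproj 1) nquot_inv nquot_mul.
Proof.
move=> a; rewrite /nquot_inv -[a in X in nquot_mul _ X](reprK a).
by rewrite [\pi _]/(nproj _) nproj_mul mulVg.
Qed.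

Lemma nquot_Vmul : right_inverse (nproj 1) nquot_inv nquot_mul.
Proof.
move=> a; rewrite /nquot_inv -[a in X in nquot_mul X _](reprK a).
by rewrite [\pi _]/(nproj _) nproj_mul mulgV.
Qed.

HB.instance Definition _ := isGroup.Build nquot
  nquot_mulA nquot_1mul nquot_mul1 nquot_mulV nquot_Vmul.

End NormalQuotient.

Section FiniteActions.
Variables (gT : finGroupType) (X : Type) (to : {action gT &-> X}).

(* [action.orbit] and ['C_A[x | to]] need [X] to be finite. *)
Definition orbit_at (W : {set gT}) (x : X) : set X :=
  [set to x w | w in [set` W]].

Definition is_orbit (W : {set gT}) (O : set X) : Prop :=
  exists x, O = orbit_at W x.

Definition free_on (W : {set gT}) (Y : set X) : Prop :=
  forall y w, Y y -> w \in W -> to y w = y -> w = 1.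

Definition NFr (W : {set gT}) : set X :=
  \bigcup_(O in [set O | is_orbit W O /\ ~ free_on W O]) O.

Definition docile (W : {set gT}) : Prop :=
  exists O, is_orbit W O /\ free_on W O.

End FiniteActions.

Section Permutations.
Variables (k : nat) (Theta : {group 'S_k}).

(* [Theta] is used through its subtype [subg Theta], a group type of its own;
   subgroups of [Theta] are thus of type {group [subg Theta]}, and conjugacy
   between them is conjugacy in [Theta].  Products in 'S_k compose from left to
   right, so evaluation is a right action. *)
Definition natural_act (i : 'I_k) (w : [subg Theta]) : 'I_k := sgval w i.

Lemma natural_act1 : natural_act^~ 1 =1 id.
Proof. by move=> i; rewrite /natural_act perm1. Qed.

Lemma natural_actM i : act_morph natural_act i.
Proof. by move=> v w; rewrite /natural_act /= permM. Qed.

Definition natural_action : {action [subg Theta] &-> 'I_k} :=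
  TotalAction natural_act1 natural_actM.

Definition robust : Prop :=
  forall (W : {group [subg Theta]}) (Y : {set 'I_k}),
    Y != finset.set0 ->
    (forall i w, i \in Y -> w \in W -> natural_action i w \in Y) ->
    [set` Y] `<=` NFr natural_action W ->
    ~~ (#|W| %| #|Y|).

Definition docile_representatives (D : {set {group [subg Theta]}}) : Prop :=
  (forall W, W \in D -> docile natural_action W) /\
  (forall W : {group [subg Theta]}, docile natural_action W ->
    exists! W' : {group [subg Theta]},
      W' \in D /\ exists h : [subg Theta], W' = (W :^ h)%G).

Definition seed_action (U : Type) (lambda : {action [subg Theta] &-> U}) :=
  infinite_set (is_orbit lambda [set: [subg Theta]]) /\
  exists V : set U,
    [/\ forall x w, V x -> V (lambda x w),
        exists2 f : U -> 'I_k, set_bij V [set: 'I_k] f &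
          forall x w, V x -> f (lambda x w) = natural_action (f x) w
      & free_on lambda [set: [subg Theta]] (~` V)].

End Permutations.

Section Completion.
Variables (k : nat) (Theta : {group 'S_k}) (D : {set {group [subg Theta]}}).

Definition rep_index : finType := {W : {group [subg Theta]} | W \in D}.

Variable T : rep_index -> finType.

Definition letters : choiceType := {W : rep_index & T W}.

Definition letter (W : rep_index) (t : T W) : letters := Tagged (fun V => T V) t.

Let ThetaF := free_prod (subg_of Theta) (free_group letters).

Definition completion_relators : set ThetaF :=
  [set r | exists (W : rep_index) (w : [subg Theta]) (t : T W),
     w \in val W /\
     r = [~ free_prod_inl (free_group letters) w,
            free_prod_inr (subg_of Theta) (free_gen (letter t))]].

Definition completion : groupType := nquot completion_relators.

Definition completion_base (w : [subg Theta]) : completion :=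
  nproj _ (free_prod_inl _ w).

Definition completion_gen (W : rep_index) (t : T W) : completion :=
  nproj _ (free_prod_inr _ (free_gen (letter t))).

(* [Theta] is a subgroup of its completion. *)
Lemma completion_base_inj : injective completion_base.
Proof.
pose f (x : subg_of Theta + free_group letters) : subg_of Theta :=
  if x is inl a then a else 1.
pose ev u := \big[*%g/1]_(x <- u) f x.
have ev_cong u v : word_cong (@free_prod_inv _ _) (@free_prod_rel _ _) u v ->
    ev u = ev v.
  elim=> {u v} [_ _ [||a a'|b b']|[a|b]|[a|b]|u|u v _ ->|v u w _ -> _ ->
    |u u' v v' _ uu' _ vv'] //; rewrite /ev ?big_cons ?big_nil /= ?mulg1 //.
  - by rewrite mulgV.
  - by rewrite mulVg.
  - by rewrite !big_cat /= -/(ev u) uu' -/(ev v) vv'.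
pose h (a : ThetaF) := ev (repr a).
have hE u : h (word_class _ _ u) = ev u by apply: ev_cong; apply: repr_word.
have hM a b : h (a * b) = h a * h b by rewrite [LHS]hE /ev big_cat.
have h1 : h 1 = 1 by rewrite [LHS]hE /ev big_nil.
have hV a : h a^-1 = (h a)^-1.
  by apply: (mulgI (h a)); rewrite -hM !mulgV h1.
have hl w : h (free_prod_inl _ w) = w by rewrite hE /ev big_seq1.
have hr b : h (free_prod_inr _ b) = 1 by rewrite hE /ev big_seq1.
move=> w w' /nprojP ww'; apply/eqP; rewrite -divg_eq1; apply/eqP.
have /= := ww' [set a | h a = 1]; rewrite hM hV !hl; apply; split.
  by split=> //= [a b ha hb|a ha|a b ha];
    rewrite ?hM ?hV ?hM ha ?hb ?mul1g ?mulg1 ?invg1 ?mulVg.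
move=> _ [W [v [t [_ ->]]]] /=.
by rewrite /commg /conjg !(hM, hV) hr hl invg1 mul1g mulg1 mulVg.
Qed.

End Completion.

Definition Sym (U : choiceType) : topologicalType :=
  [set f : {ptws U -> discrete_topology U} | bijective f].

Section ActionSpace.
Variables (G : groupType) (U : choiceType).

(* Sym(U)^G; actions of [G] on [U] are its elements satisfying [right_action].
   The unit law follows because each [mu g] is a bijection. *)
Definition sym_families : topologicalType := prod_topology (fun _ : G => Sym U).

Definition act_by (mu : sym_families) (x : U) (g : G) : U := val (mu g) x.

Definition right_action (mu : sym_families) : Prop :=
  forall x g h, act_by mu x (g * h) = act_by mu (act_by mu x g) h.

Definition translate (mu : sym_families) (A : set U) (g : G) : set U :=
  [set act_by mu x g | x in A].

Definition set_stabiliser (mu : sym_families) (A : set U) : set G :=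
  [set g | translate mu A g = A].

Definition sharp (k : nat) (mu : sym_families) : Prop :=
  forall g, g <> 1 ->
    ~ exists x : 'I_k -> U, injective x /\ forall i, act_by mu (x i) g = x i.

Definition sharply_transitive (k : nat) (Theta : {group 'S_k})
    (mu : sym_families) : Prop :=
  (forall A B : set U, A #= `I_k -> B #= `I_k ->
     exists g, translate mu A g = B) /\
  (forall A : set U, A #= `I_k ->
     exists (f : U -> 'I_k) (phi : G -> [subg Theta]),
       [/\ set_bij A [set: 'I_k] f,
           set_bij (set_stabiliser mu A) [set: [subg Theta]] phi,
           forall g h, set_stabiliser mu A g -> set_stabiliser mu A h ->
             phi (g * h) = phi g * phi h
         & forall x g, A x -> set_stabiliser mu A g ->
             f (act_by mu x g) = natural_action Theta (f x) (phi g)]).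

End ActionSpace.

Section TautActions.
Variables (k : nat) (Theta : {group 'S_k}) (D : {set {group [subg Theta]}}).
Variables (T : rep_index D -> finType) (U : choiceType).
Variable lambda : {action [subg Theta] &-> U}.

Definition taut (mu : sym_families (completion T) U) : Prop :=
  [/\ sharp k mu,
      forall (W : rep_index D) (t : T W) x,
        NFr lambda (val W) x -> act_by mu x (completion_gen t) = x
    & forall (W : rep_index D) (A : set U), finite_set A ->
        (forall t : T W, translate mu A (completion_gen t) = A) ->
        A `<=` NFr lambda (val W)].

Definition taut_actions : set (sym_families (completion T) U) :=
  [set mu | [/\ right_action mu,
     forall x w, act_by mu x (completion_base T w) = lambda x w & taut mu]].

Definition taut_space : topologicalType := taut_actions.

Definition STT : set taut_space :=
  [set mu | sharply_transitive Theta (val mu)].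

End TautActions.

Arguments STT {k Theta D} T {U} lambda _ : rename.

Definition separable (X : topologicalType) : Prop :=
  exists2 A : set X, countable A & dense A.

Definition completely_metrizable (R : realType) (X : topologicalType) : Prop :=
  exists (M : metricType R) (f : X -> M) (g : M -> X),
    [/\ cancel f g, cancel g f, continuous f, continuous g
      & forall F : set_system M, ProperFilter F -> cauchy F ->
          exists l : M, F --> l].

Definition polish (R : realType) (X : topologicalType) : Prop :=
  separable X /\ completely_metrizable R X.

(* Main.v *)
(* A taut action is the union of an increasing chain of finite approximations,
   in which every letter of [T_W] is a finite partial [W]-equivariant bijection
   of [U] that is the identity on [NFr W].  An approximation is good if it
   admits no infinite reduced walk through k-subsets of [U] and every finite set
   invariant under all of [T_W] lies in [NFr W].  Sending a point outside the
   domain of a letter to a fresh orbit preserves goodness, so all letters can be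
   made total, and doing so in two ways at each stage gives a binary tree of
   taut actions.

   For transitivity one connects a given k-set to [V].  If no good extension
   does so, choose among the k-sets connected to it in some good extension one,
   [A], whose stabiliser [W] has maximal order.  As [Theta] is robust, [W] is
   docile and [A] contains [NFr W]; up to conjugation [W] is in [D].  Now join
   [A] to [V] by a fresh path spelling a word in [T_W] that has no proper border
   and that no point outside [NFr W] can read in the approximation.  An infinite
   reduced walk in the result would contain a nonempty reduced walk from [A] to
   a translate of [A] in the old approximation; by maximality of [W] such a walk
   can be shortened to a cyclically reduced one, which repeats forever.  The
   same argument at [V], whose stabiliser is all of [Theta], shows that the
   setwise stabiliser of [V] in a taut action is [Theta].

   Conversely, restricting the letters of a taut action to a finite set gives a
   good approximation: an infinite reduced walk visits a k-set twice in the same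
   way, so that a cyclically reduced word fixes k points; by sharpness it is
   trivial in [G], whereas it acts nontrivially in the action built from the
   trivial approximation.  Hence every basic open set contains an element of
   [STT] and at least two taut actions.  Since tautness is a closed condition
   on the values at the countably many pairs (g, x), agreement on initial
   segments of them gives a complete ultrametric. *)

Require Import Defs.
From HB Require Import structures.
From mathcomp Require Import all_boot all_order all_algebra all_fingroup.
From mathcomp Require Import finmap.
From mathcomp Require Import all_classical all_reals all_analysis.
From mathcomp Require Import borel_hierarchy.
From mathcomp Require Import zify.

Set Implicit Arguments.
Unset Strict Implicit.
Unset Printing Implicit Defensive.

Local Open Scope fset_scope.
Local Open Scope nat_scope.
Local Open Scope group_scope.

(** * Actions on finite sets *)

Section FiniteSets.
Variables (gT : finGroupType) (U : choiceType) (act : U -> gT -> U).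
Hypothesis act1 : forall x, act x 1 = x.
Hypothesis actM : forall x v w, act x (v * w) = act (act x v) w.
Implicit Types (A B : {fset U}) (W : {group gT}).

Lemma actVK x w : act (act x w) w^-1 = x.
Proof. by rewrite -actM mulgV act1. Qed.

Lemma actKV x w : act (act x w^-1) w = x.
Proof. by rewrite -actM mulVg act1. Qed.

Lemma act_inj w : injective (act^~ w).
Proof. by move=> x y /= e; rewrite -(actVK x w) e actVK. Qed.

Definition actF A w : {fset U} := [fset act x w | x in A].

Lemma mem_actF A w x : (act x w \in actF A w) = (x \in A).
Proof. by rewrite (mem_imfset _ _ (@act_inj w)). Qed.

Lemma actFP A w x : (x \in actF A w) = (act x w^-1 \in A).
Proof. by rewrite -(mem_actF A w) actKV. Qed.

Lemma card_actF A w : #|` actF A w| = #|` A|.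
Proof. by rewrite card_imfset //; exact: act_inj. Qed.

Lemma actF1 A : actF A 1 = A.
Proof. by apply/fsetP => x; rewrite actFP invg1 act1. Qed.

Lemma actFM A v w : actF A (v * w) = actF (actF A v) w.
Proof. by apply/fsetP => x; rewrite !actFP invMg actM. Qed.

Lemma actFK A w : actF (actF A w) w^-1 = A.
Proof. by rewrite -actFM mulgV actF1. Qed.

Definition stabF A : {set gT} := [set w | actF A w == A].

Lemma stabF_group_set A : group_set (stabF A).
Proof.
apply/group_setP; split=> [|v w]; first by rewrite inE actF1.
by rewrite !inE => /eqP Av /eqP Aw; rewrite actFM Av Aw.
Qed.
Canonical stabF_group A := Group (stabF_group_set A).

Lemma stabFP A w : reflect (actF A w = A) (w \in stabF A).
Proof. by rewrite inE; apply: eqP. Qed.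

Lemma stabF_act A w x : w \in stabF A -> (act x w \in A) = (x \in A).
Proof. by move=> /stabFP Aw; rewrite -{1}Aw mem_actF. Qed.

Lemma stabF_actF A v w : (w \in stabF (actF A v)) = ((v * w * v^-1) \in stabF A).
Proof.
apply/stabFP/stabFP; rewrite -?actFM => e; first by rewrite actFM e actFK.
by rewrite -[in RHS]e -actFM mulgKV.
Qed.

Lemma card_stabF_actF A v : #|stabF (actF A v)| = #|stabF A|.
Proof.
rewrite -(card_imset _ (@conjg_inj _ v^-1)); apply: eq_card => w.
apply/idP/idP => [/imsetP[z + ->]|wA].
  by rewrite stabF_actF conjgE invgK mulgA.
by apply/imsetP; exists (w ^ v); rewrite ?conjgK // stabF_actF conjgE !mulgA mulgV mul1g mulgK.
Qed.

Lemma invariant_stabF A W : (forall x w, x \in A -> w \in W -> act x w \in A) ->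
  W \subset stabF A.
Proof.
move=> AW; apply/fintype.subsetP => w wW; apply/stabFP/fsetP => x; rewrite actFP.
apply/idP/idP => xA; last by apply: AW => //; rewrite groupV.
by rewrite -(actKV x w) AW.
Qed.

(* [orbit_rep W x] depends only on the [W]-orbit of [x]. *)
Definition orbit_rep W x := choose (fun y => [exists w in W, act x w == y]) x.

Lemma orbit_self W x : [exists w in W, act x w == x].
Proof. by apply/fintype.existsP; exists 1; rewrite group1 act1 eqxx. Qed.

Lemma orbit_rep_mem W x : exists2 w, w \in W & act (orbit_rep W x) w = x.
Proof.
have [|w /andP[wW /eqP e]] := fintype.existsP (_ : [exists w in W, act x w == orbit_rep W x]).
  exact: (@chooseP _ (fun y => [exists w in W, act x w == y]) x (orbit_self W x)).
by exists w^-1; rewrite ?groupV // -e actVK.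
Qed.

Lemma orbit_rep_act W x w : w \in W -> orbit_rep W (act x w) = orbit_rep W x.
Proof.
move=> wW; rewrite /orbit_rep.
have e : (fun y => [exists v in W, act (act x w) v == y]) =1
         (fun y => [exists v in W, act x v == y]).
  move=> y; apply/fintype.existsP/fintype.existsP => -[v /andP[vW /eqP <-]].
    by exists (w * v); rewrite groupM // actM /=.
  by exists (w^-1 * v); rewrite groupM ?groupV // actM actVK /=.
rewrite (eq_choose e); apply: choose_id; last exact: orbit_self.
by apply/fintype.existsP; exists w; rewrite wW eqxx.
Qed.

(** On a free orbit the coordinate is the unique element of [W] taking the representative to [x],
    which identifies the orbit with [W]. The default [1] is never reached, by [orbit_rep_mem]. *)
Definition orbit_coord W x : gT := odflt 1 [pick w in W | act (orbit_rep W x) w == x].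

Lemma orbit_coordP W x :
  orbit_coord W x \in W /\ act (orbit_rep W x) (orbit_coord W x) = x.
Proof.
rewrite /orbit_coord; case: pickP => [w /andP[wW /eqP]|] //= none.
by have [w wW e] := orbit_rep_mem W x; have := none w; rewrite wW e eqxx.
Qed.

Definition free_inv W A :=
  (forall x w, x \in A -> w \in W -> act x w \in A) /\
  (forall x w, x \in A -> w \in W -> act x w = x -> w = 1).

Lemma orbit_rep_in W A x : free_inv W A -> x \in A -> orbit_rep W x \in A.
Proof.
move=> fA xA; have [w wW e] := orbit_rep_mem W x.
by rewrite -(actVK (orbit_rep W x) w) e; apply: fA.1; rewrite ?groupV.
Qed.

Lemma orbit_rep_idem W x : orbit_rep W (orbit_rep W x) = orbit_rep W x.
Proof. by have [w wW e] := orbit_rep_mem W x; rewrite -[in RHS]e orbit_rep_act. Qed.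

Lemma orbit_coord_act W A x w : free_inv W A -> x \in A -> w \in W ->
  orbit_coord W (act x w) = (orbit_coord W x * w).
Proof.
move=> fA xA wW; have [cW e] := orbit_coordP W x.
have [c'W e'] := orbit_coordP W (act x w).
rewrite orbit_rep_act // in e'; have rA := orbit_rep_in fA xA.
apply/eqP; rewrite eq_mulgV1; apply/eqP; apply: (fA.2 (orbit_rep W x)) => //.
  by rewrite groupM // groupV groupM.
by rewrite actM e' invMg actM actVK -[X in act X _]e actVK.
Qed.

Definition orbit_reps W A : {fset U} := [fset orbit_rep W x | x in A].

(** On a free invariant set every point is [act r w] for exactly one representative [r] and one [w]
    in [W], so these products list [A] without repetition. *)
Lemma card_free_inv W A : free_inv W A -> #|` A| = (#|` orbit_reps W A| * #|W|)%N.
Proof.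
move=> fA; pose s := [seq act r w | r <- orbit_reps W A, w <- enum W].
have repA r : r \in orbit_reps W A -> r \in A /\ orbit_rep W r = r.
  by move=> /imfsetP[x /= xA ->]; rewrite orbit_rep_in // orbit_rep_idem.
rewrite [#|W|]cardE -(size_allpairs act); apply: perm_size; apply: uniq_perm.
- exact: fset_uniq.
- apply: allpairs_uniq; [exact: fset_uniq|exact: enum_uniq|].
  move=> [r w] [r' w'] /allpairsP[[r1 w1] /= [rR wW [-> ->]]].
  move=> /allpairsP[[r2 w2] /= [rR' wW' [-> ->]]] e.
  rewrite !mem_enum in wW wW'; have [[rA er] [rA' er']] := (repA _ rR, repA _ rR').
  have er12 : r1 = r2 by rewrite -er -er' -(orbit_rep_act r1 wW) e orbit_rep_act.
  rewrite er12 in e *; congr pair; apply/eqP; rewrite eq_mulgV1; apply/eqP.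
  by apply: (fA.2 r2) => //; rewrite ?groupM ?groupV // actM e actVK.
- move=> x; apply/idP/allpairsP => [xA|[[r w] /= [rR wW ->]]].
    have [cW e] := orbit_coordP W x.
    exists (orbit_rep W x, orbit_coord W x); rewrite mem_enum; split=> //=.
    by apply/imfsetP; exists x.
  by rewrite mem_enum in wW; apply: fA.1 => //; apply: (repA _ rR).1.
Qed.

(** By [card_free_inv] both sets have equally many orbits. Representatives are matched by their
    position in the two lists, and coordinates extend the matching equivariantly. *)
Lemma equivariant_bijection W A B : free_inv W A -> free_inv W B ->
  #|` A| = #|` B| -> exists f : U -> U,
    [/\ forall x, x \in A -> f x \in B,
        forall x w, x \in A -> w \in W -> f (act x w) = act (f x) w,
        {in A &, injective f} & forall y, y \in B -> exists2 x, x \in A & f x = y].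
Proof.
move=> fA fB eAB; pose RA := orbit_reps W A; pose RB := orbit_reps W B.
have eR : #|` RA| = #|` RB|.
  by move: eAB; rewrite (card_free_inv fA) (card_free_inv fB) => /eqP; rewrite eqn_pmul2r ?cardG_gt0 // => /eqP.
pose h x := nth x RB (index x RA).
have repB r : r \in RB -> r \in B /\ orbit_rep W r = r.
  by move=> /imfsetP[x /= xA ->]; rewrite orbit_rep_in // orbit_rep_idem.
have repA r : r \in RA -> r \in A /\ orbit_rep W r = r.
  by move=> /imfsetP[x /= xA ->]; rewrite orbit_rep_in // orbit_rep_idem.
have inRA x : x \in A -> orbit_rep W x \in RA by move=> xA; apply/imfsetP; exists x.
have hR x : x \in RA -> h x \in RB.
  by move=> xR; rewrite mem_nth // -eR index_mem.
have h_inj : {in RA &, injective h}.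
  move=> x y xR yR e; rewrite -(nth_index x xR) -(nth_index x yR); congr nth.
  apply/eqP; rewrite -(nth_uniq x _ _ (fset_uniq RB)) -?eR ?index_mem //; apply/eqP.
  by move: e; rewrite /h (set_nth_default x y) // -eR index_mem.
have h_surj y : y \in RB -> exists2 x, x \in RA & h x = y.
  move=> yR; exists (nth y RA (index y RB)).
    by rewrite mem_nth // eR index_mem.
  rewrite /h index_uniq ?fset_uniq ?eR ?index_mem //.
  by rewrite (set_nth_default y) ?index_mem // nth_index.
pose f x := act (h (orbit_rep W x)) (orbit_coord W x).
have fin x : x \in A -> f x \in B.
  move=> xA; have [cW e] := orbit_coordP W x.
  by apply: fB.1 => //; apply: (repB _ (hR _ (inRA _ xA))).1.
exists f; split=> //.
- by move=> x w xA wW; rewrite /f orbit_rep_act // (orbit_coord_act fA) // actM.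
- move=> x y xA yA e; have [cW ex] := orbit_coordP W x; have [dW ey] := orbit_coordP W y.
  have [hxB rx] := repB _ (hR _ (inRA _ xA)); have [hyB ry] := repB _ (hR _ (inRA _ yA)).
  have er : orbit_rep W x = orbit_rep W y.
    apply: h_inj; rewrite ?inRA // -rx -ry -(orbit_rep_act _ cW) -/(f x) e.
    by rewrite /f orbit_rep_act.
  rewrite -ex -ey er; congr act; apply/eqP; rewrite eq_mulgV1; apply/eqP.
  apply: (fB.2 (h (orbit_rep W y))) => //; rewrite ?groupM ?groupV // actM.
  by move: e; rewrite /f er => ->; rewrite actVK.
- move=> y yB; have [cW ey] := orbit_coordP W y.
  have [r rA er] : exists2 r, r \in RA & h r = orbit_rep W y.
    by apply: h_surj; apply/imfsetP; exists y.
  have [rA' rr] := repA _ rA.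
  exists (act r (orbit_coord W y)); first exact: fA.1.
  rewrite /f orbit_rep_act // rr er (orbit_coord_act fA) //.
  have [dW dr] := orbit_coordP W r; rewrite rr in dr.
  by rewrite (fA.2 r (orbit_coord W r)) // mul1g.
Qed.

(** The union of the orbits that meet [A] is again finite; it turns finite supports into invariant
    ones. *)
Definition satF A : {fset U} := [fset act x w | x in A, w in enum gT].

Lemma satFP A x : reflect (exists2 a, a \in A & exists w, x = act a w) (x \in satF A).
Proof.
apply: (iffP idP) => [/imfset2P[a /= aA [w /= _ ->]]|[a aA [w ->]]].
  by exists a => //; exists w.
by apply/imfset2P; exists a => //; exists w => //=; rewrite mem_enum.
Qed.

Lemma satF_sub A x : x \in A -> x \in satF A.
Proof. by move=> xA; apply/satFP; exists x => //; exists 1. Qed.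

Lemma satF_act A x w : (act x w \in satF A) = (x \in satF A).
Proof.
apply/satFP/satFP => -[a aA [v e]]; last by exists a => //; exists (v * w); rewrite actM e.
by exists a => //; exists (v * w^-1); rewrite actM -e actVK.
Qed.

End FiniteSets.
(** A choice of related points is an injection from [A] into [B], hence onto by counting. This is
    what allows steps between sets of equal size to be read backwards. *)
Lemma injective_rel_surj (U : choiceType) (r : U -> U -> Prop) (A B : {fset U}) :
  (forall x x' y, r x y -> r x' y -> x = x') -> #|` A| = #|` B| ->
  (forall x, x \in A -> exists2 y, y \in B & r x y) ->
  forall y, y \in B -> exists2 x, x \in A & r x y.
Proof.
move=> rI eAB AB.
have [g gP] : {g : U -> U & forall x, x \in A -> g x \in B /\ r x (g x)}.
  apply: (@choice _ _ (fun x y => x \in A -> y \in B /\ r x y)) => x.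
  by have [/AB[y yB rxy]|_] := boolP (x \in A); [exists y|exists x].
have g_inj : {in A &, injective g}.
  by move=> x y /gP[_ rx] /gP[_ ry] e; apply: (rI x y (g x)); rewrite ?e // -e.
have eB : [fset g x | x in A] = B.
  apply/eqP; rewrite eqEfcard; apply/andP; split.
    by apply/fsubsetP => _ /imfsetP[x /= /gP[gB _] ->].
  by rewrite card_in_imfset // eAB.
by move=> y; rewrite -{1}eB => /imfsetP[x /= xA ->]; exists x => //; case: (gP x xA).
Qed.

Lemma fset_eq_card (U : choiceType) (A B : {fset U}) :
  #|` A| = #|` B| -> {subset A <= B} -> A = B.
Proof.
by move=> e AB; apply/eqP; rewrite eqEfcard e leqnn andbT; apply/fsubsetP.
Qed.

(** * Finite approximations *)

Section Systems.
Variables (gT : finGroupType) (U : choiceType) (act : U -> gT -> U).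
Hypothesis act1 : forall x, act x 1 = x.
Hypothesis actM : forall x v w, act x (v * w) = act (act x v) w.
(** Abstract form of a seed action: [V] is the copy of the natural action, and the action is free
    elsewhere. [I], [Om] and [T] stand for the docile representatives and their sets of letters. *)
Variables (V : {fset U}) (k : nat).
Hypothesis V_card : #|` V| = k.
Hypothesis V_inv : forall x w, x \in V -> act x w \in V.
Hypothesis V_free : forall x w, x \notin V -> act x w = x -> w = 1.
Variables (I : finType) (Om : I -> {group gT}) (T : I -> finType).

Local Notation L := {i : I & T i}.
Local Notation actF := (actF act).
Local Notation stabF := (stabF act).
Local Notation ltr t := (Tagged (fun i => T i : Type) t : {i : I & T i}).

(** A point lies in a non-free orbit exactly when it has a nontrivial stabiliser, and by [V_free]
    all such points lie in [V]; so cutting down to [V] loses nothing and gives a finite set. *)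
Definition NF (W : {set gT}) : {fset U} :=
  [fset x in V | [exists w in W, (w != 1) && (act x w == x)]].

Lemma NFP (W : {set gT}) x :
  reflect (exists w, [/\ w \in W, w <> 1 & act x w = x]) (x \in NF W).
Proof.
rewrite !inE /=; apply: (iffP andP) => [[_ /fintype.existsP[w]]|[w [wW w1 e]]].
  by move=> /and3P[wW /eqP w1 /eqP e]; exists w.
split; first by apply: contra_notT w1 => xV; apply: V_free e.
by apply/fintype.existsP; exists w; rewrite wW e eqxx andbT; apply/eqP.
Qed.

Lemma NF_V W x : x \in NF W -> x \in V.
Proof. by rewrite !inE => /andP[]. Qed.

Lemma NF_act (W : {group gT}) x w : w \in W -> (act x w \in NF W) = (x \in NF W).
Proof.
suff h y v : v \in W -> y \in NF W -> act y v \in NF W.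
  move=> wW; apply/idP/idP => [xw|]; last exact: h.
  by rewrite -(actVK act1 actM x w) h ?groupV.
move=> vW /NFP[u [uW u1 e]]; apply/NFP; exists (u ^ v); split.
- by rewrite groupJ.
- by move=> /eqP; rewrite conjg_eq1 => /eqP.
- by rewrite conjgE -actM mulKVg actM e.
Qed.

Lemma free_inv_NF (W : {group gT}) A :
  (forall x w, x \in A -> w \in W -> act x w \in A) -> free_inv act W (A `\` NF W).
Proof.
move=> AW; split=> x w; rewrite !in_fsetD => /andP[xN xA] wW.
  by rewrite NF_act // xN AW.
by move=> e; apply/eqP; apply: contraNT xN => /eqP w1; apply/NFP; exists w.
Qed.

(* [p l x y] says that the partial map of the letter [l] sends [x] to [y]; the
   pair [(l, b)] is the letter [l] if [b] and its inverse otherwise. *)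
Definition system := L -> U -> U -> Prop.
Implicit Types (p q : system) (s : L * bool) (A B C : {fset U}).

Definition sg p s x y := if s.2 then p s.1 x y else p s.1 y x.
Definition sinv s := (s.1, ~~ s.2).
Definition OmL (l : L) : {group gT} := Om (tag l).

Lemma sinvK : involutive sinv.
Proof. by case=> l b; rewrite /sinv negbK. Qed.

Lemma sinv_neq s : s <> sinv s.
Proof. by case: s => l [] []. Qed.

Lemma sg_sinv p s x y : sg p (sinv s) x y <-> sg p s y x.
Proof. by case: s => l []. Qed.

Record presystem p : Prop := Presystem {
  ps_fun : forall l x y z, p l x y -> p l x z -> y = z;
  ps_inj : forall l x y z, p l x z -> p l y z -> x = y;
  ps_eqv : forall l x y w, p l x y -> w \in OmL l -> p l (act x w) (act y w);
  ps_nf : forall l x, x \in NF (OmL l) -> p l x x;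
  ps_fin : exists F : {fset U}, forall l x y, p l x y -> x \in F /\ y \in F }.

Lemma sg_fun p s x y z : presystem p -> sg p s x y -> sg p s x z -> y = z.
Proof. by case: s => l [] pp; [apply: (ps_fun pp)|apply: (ps_inj pp)]. Qed.

Lemma sg_inj p s x y z : presystem p -> sg p s x z -> sg p s y z -> x = y.
Proof. by case: s => l [] pp; [apply: (ps_inj pp)|apply: (ps_fun pp)]. Qed.

Lemma sg_eqv p s x y w : presystem p -> w \in OmL s.1 -> sg p s x y ->
  sg p s (act x w) (act y w).
Proof. by case: s => l [] pp /= wl xy; apply: (ps_eqv pp). Qed.

Lemma sg_nf p s x : presystem p -> x \in NF (OmL s.1) -> sg p s x x.
Proof. by case: s => l [] pp /= xN; apply: (ps_nf pp). Qed.

Lemma sg_mono p q s x y : (forall l x y, p l x y -> q l x y) ->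
  sg p s x y -> sg q s x y.
Proof. by case: s => l [] pq; apply: pq. Qed.

(** The group element [a.1] acts first, then the signed letter [a.2]. Only an inclusion into [B] is
    asked for; when the cardinalities agree, [step_back] shows that all of [B] is hit. *)
Definition step p (a : gT * (L * bool)) A B :=
  forall x, x \in A -> exists2 y, y \in B & sg p a.2 (act x a.1) y.

Lemma step_back p a A B : presystem p -> #|` A| = #|` B| -> step p a A B ->
  forall y, y \in B -> exists2 x, x \in A & sg p a.2 (act x a.1) y.
Proof.
move=> pp eAB; apply: injective_rel_surj => // x x' y xy x'y.
exact: (act_inj act1 actM (sg_inj pp xy x'y)).
Qed.

Lemma step_mono p q a A B : (forall l x y, p l x y -> q l x y) ->
  step p a A B -> step q a A B.
Proof. by move=> pq st x /st[y yB e]; exists y => //; apply: sg_mono e. Qed.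

(* Consecutive letters [t theta t'] of a word do not cancel. *)
Definition reduced2 : rel (gT * (L * bool)) :=
  fun a b => ~~ ((b.2 == sinv a.2) && (b.1 \in OmL a.2.1)).

Definition no_infinite_walk p :=
  forall (f : nat -> gT * (L * bool)) (A : nat -> {fset U}),
    (forall n, #|` A n| = k) -> (forall n, step p (f n) (A n) (A n.+1)) ->
    (forall n, reduced2 (f n) (f n.+1)) -> False.

Definition no_finite_orbit p := forall i (A : {fset U}),
  (forall (t : T i) x, x \in A -> exists2 y, y \in A & p (ltr t) x y) ->
  {subset A <= NF (Om i)}.

Record good p : Prop := Good {
  good_pre :> presystem p;
  good_noinf : no_infinite_walk p;
  good_taut : no_finite_orbit p }.

(** A finite set mapped into itself by an injective map is mapped onto itself, so inverse letters
    may replace letters. *)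
Lemma no_finite_orbit_sg p b i (A : {fset U}) : presystem p -> no_finite_orbit p ->
  (forall (t : T i) x, x \in A -> exists2 y, y \in A & sg p (ltr t, b) x y) ->
  {subset A <= NF (Om i)}.
Proof.
case: b => pp pt hA; first exact: pt hA.
apply: pt => t; apply: (@injective_rel_surj _ (fun y x => p (ltr t) x y)) => //.
  by move=> x x' y; apply: (ps_fun pp).
exact: hA.
Qed.

(** * Walks, connectedness and closed reduced walks *)

Fixpoint run p (w : seq (gT * (L * bool))) A B : Prop :=
  if w is a :: w' then exists C, [/\ #|` C| = #|` A|, step p a A C & run p w' C B]
  else A = B.

Lemma run_rcons p w a A B : run p (rcons w a) A B ->
  exists C, [/\ run p w A C, #|` C| = #|` A|, #|` B| = #|` A| & step p a C B].
Proof.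
elim: w A => [A [C [eC st <-]]|b w IHw A [C [eC st /IHw[D [wD eD eB stD]]]]].
  by exists A.
by exists D; split; rewrite ?eD ?eB //; exists C.
Qed.

(** Unlike [run], this relation forgets the word and reducedness; it is an equivalence relation and
    grows with the system. *)
Inductive reach p : {fset U} -> {fset U} -> Prop :=
| reach_refl A : reach p A A
| reach_act A w : reach p A (actF A w)
| reach_step s A B : #|` B| = #|` A| -> step p (1, s) A B -> reach p A B
| reach_sym A B : reach p A B -> reach p B A
| reach_trans A B C : reach p A B -> reach p B C -> reach p A C.

Lemma reach_card p A B : reach p A B -> #|` A| = #|` B|.
Proof. by elim=> {A B} [//|A w|s A B ->//|A B _ ->//|A B C _ -> _ ->//]; rewrite card_actF. Qed.

Lemma reach_mono p q A B : (forall l x y, p l x y -> q l x y) ->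
  reach p A B -> reach q A B.
Proof.
move=> pq; elim=> {A B} [A|A w|s A B e st|A B _ IH|A B C _ IH1 _ IH2].
- exact: reach_refl.
- exact: reach_act.
- by apply: (reach_step e); apply: step_mono st.
- exact: reach_sym.
- exact: reach_trans IH1 IH2.
Qed.

Lemma step_reach p a A B : #|` B| = #|` A| -> step p a A B -> reach p A B.
Proof.
move=> e st; apply: reach_trans (reach_act p A a.1) _.
apply: (@reach_step _ a.2); first by rewrite card_actF.
move=> x; rewrite actFP // => /st[y yB]; rewrite actKV // => h.
by exists y => //=; rewrite act1.
Qed.

Lemma run_reach p w A B : run p w A B -> reach p A B.
Proof.
elim: w A => [A ->|a w IHw A [C [e st /IHw]]]; first exact: reach_refl.
by apply: reach_trans; apply: step_reach st.
Qed.

Lemma run_states p w A B a0 : run p w A B -> exists S : nat -> {fset U},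
  [/\ S 0%N = A, S (size w) = B, forall i, (i <= size w)%N -> #|` S i| = #|` A|
    & forall i, (i < size w)%N -> step p (nth a0 w i) (S i) (S i.+1)].
Proof.
elim: w A => [A <-|a w IHw A [C [e st /IHw[S [S0 Sw Sc Ss]]]]]; first by exists (fun=> A).
exists (fun n => if n is m.+1 then S m else A); split=> //.
  by case=> //= i /Sc ->.
by case=> [_|i]; rewrite /= ?S0 // ltnS; apply: Ss.
Qed.

Lemma cycle_nth (X : Type) (e : rel X) (w : seq X) a0 i : path.cycle e w -> (i < size w)%N ->
  e (nth a0 w i) (nth a0 w (i.+1 %% size w)).
Proof.
case: w => [//|x s] /(pathP a0) h; rewrite [size _]/= => lt_i.
have := h i; rewrite size_rcons => /(_ lt_i).
rewrite -rcons_cons !nth_rcons /= lt_i; move: lt_i; rewrite ltnS leq_eqVlt => /orP[/eqP->|lt_i].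
  by rewrite ltnn eqxx modnn.
by rewrite lt_i modn_small.
Qed.

(** Going round a closed walk with a cyclically reduced word again and again is an infinite reduced
    walk; indices are taken modulo the length. *)
Lemma no_closed_run p w A : no_infinite_walk p -> #|` A| = k -> w != [::] ->
  path.cycle reduced2 w -> ~ run p w A A.
Proof.
case: w => [//|a0 w0] np cA _; set w := a0 :: w0 => cw /(run_states a0)[S [S0 Sw Sc Ss]].
have w_gt0 : (0 < size w)%N by [].
apply: (np (fun n => nth a0 w (n %% size w)) (fun n => S (n %% size w))) => [n|n|n].
- by rewrite Sc // ltnW // ltn_pmod.
- have lt_n := ltn_pmod n w_gt0; have := Ss _ lt_n.
  rewrite modnS; case: ifP => // dv.
  suff -> : (n %% size w).+1 = size w by rewrite Sw S0.
  have := dv; rewrite -addn1 /dvdn -modnDml addn1; move: lt_n.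
  by rewrite leq_eqVlt => /orP[/eqP//|lt_n]; rewrite modn_small.
- have := cycle_nth a0 cw (ltn_pmod n w_gt0).
  by rewrite (_ : (n %% size w).+1 %% size w = n.+1 %% size w)%N // -addn1 modnDml addn1.
Qed.

Lemma reduced2_l a a' b : a.2 = a'.2 -> reduced2 a b = reduced2 a' b.
Proof. by rewrite /reduced2 => ->. Qed.

(** Letters commute with their edge group, so an element of it can be pushed through the step. *)
Lemma step_conj_stab p a A B : presystem p -> #|` B| = #|` A| -> step p a A B ->
  forall w, w \in OmL a.2.1 -> (a.1 * w * a.1^-1) \in stabF A -> w \in stabF B.
Proof.
move=> pp e st w wO wA; apply/stabFP; apply: fset_eq_card; first by rewrite card_actF.
move=> _ /imfsetP[y /= /(step_back pp (esym e) st)[x xA xy] ->].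
have := sg_eqv pp wO xy.
have -> : act (act x a.1) w = act (act x (a.1 * w * a.1^-1)) a.1.
  by rewrite -!actM mulgKV.
have /st[z zB xz] : act x (a.1 * w * a.1^-1) \in A by rewrite (stabF_act act1 actM _ wA).
by move=> /(sg_fun pp xz) <-.
Qed.

(* A closed reduced walk that is not cyclically reduced starts and ends with
   the same edge; maximality of the stabiliser makes the edge group the full
   stabiliser, so the inner part of the walk is again closed. *)
Lemma closed_run_nil p w B g : presystem p -> no_infinite_walk p ->
  sorted reduced2 w -> #|` B| = k ->
  (forall B', reach p B B' -> (#|stabF B'| <= #|stabF B|)%N) ->
  run p w B (actF B g) -> w = [::].
Proof.
move=> pp np; have [n] := ubnP (size w); elim: n w B g => // n IHn.
move=> [//|a w0] B g le_n sw cB maxB rw; exfalso.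
(* For every [al] stabilising [B], the walk can be restarted at [actF B g] by going back to [B] with
   [g^-1] and applying [al]. The resulting closed walk cannot be cyclically reduced, so its last and
   first letters cancel. *)
have junction al : al \in stabF B -> ~~ reduced2 (last a w0) (g^-1 * al * a.1, a.2).
  move=> alB; apply/negP => jw; pose a' := (g^-1 * al * a.1, a.2).
  have [C [eC st rC]] := rw.
  apply: (@no_closed_run p (a' :: w0) (actF B g) np) => //.
  - by rewrite card_actF.
  - rewrite /= rcons_path; apply/andP; split.
      move: sw; rewrite /sorted; clear; case: w0 => //= b s; rewrite (@reduced2_l a' a) //.
    by rewrite (@reduced2_l _ (last a w0)) //; case: (w0).
  - exists C; split; rewrite ?card_actF // => x; rewrite actFP // => xB.
    have : act (act x g^-1) al \in B by rewrite (stabF_act act1 actM _ alB).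
    by move=> /st[y yC]; rewrite -!actM !mulgA => h; exists y.
move: rw le_n sw junction; case/lastP: w0 => [|w1 z] rw le_n sw junction.
  have /andP[/eqP/sinv_neq//] : (a.2 == sinv a.2) && (g^-1 * 1 * a.1 \in OmL a.2.1).
  exact: (negbNE (junction 1 (group1 (stabF_group act1 actM B)))).
rewrite last_rcons in junction.
have /andP[/eqP eaz gO] : (a.2 == sinv z.2) && (g^-1 * 1 * a.1 \in OmL z.2.1).
  exact: (negbNE (junction 1 (group1 (stabF_group act1 actM B)))).
have eO : OmL z.2.1 = OmL a.2.1 by rewrite eaz.
rewrite mulg1 eO in gO.
have stabO al : al \in stabF B -> a.1^-1 * al * a.1 \in OmL a.2.1.
  move=> /junction; rewrite /reduced2 negbK => /andP[_]; rewrite eO => h.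
  have -> : a.1^-1 * al * a.1 = (g^-1 * a.1)^-1 * (g^-1 * al * a.1).
    by rewrite invMg invgK !mulgA mulgK.
  by rewrite groupM ?groupV.
have [C [eC st /run_rcons[C' [rC eC' eB stz]]]] := rw.
have cC : #|` C| = k by rewrite eC.
have rBC : reach p B C := step_reach eC st.
have subC : stabF B :^ a.1 \subset stabF C.
  apply/fintype.subsetP => _ /imsetP[al alB ->]; rewrite conjgE mulgA.
  apply: (step_conj_stab pp eC st); first exact: stabO.
  by rewrite !mulgA mulgV mul1g mulgK.
have cst : #|stabF C| = #|stabF B|.
  by apply/eqP; rewrite eqn_leq maxB //= -(cardJg _ a.1) subset_leq_card.
have eqC : stabF B :^ a.1 = stabF C.
  by apply/eqP; rewrite eqEcard subC cst cardJg leqnn.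
pose h := (g^-1 * a.1)^-1.
have hO : h \in OmL a.2.1 by rewrite groupV.
(* The last letter undoes the first one, so the inner walk leads from [C] to a translate of [C] and
   the induction hypothesis applies to it. *)
have C'E : C' = actF C (h * z.1^-1).
  apply: fset_eq_card; first by rewrite card_actF // eC'.
  move=> x xC'; have [y yB xy] := stz x xC'; rewrite actFP // invMg invgK.
  have : sg p a.2 y (act x z.1) by rewrite eaz; apply/sg_sinv.
  rewrite actFP // in yB; have [c cC2 bc] := st _ yB.
  move: bc; rewrite -actM => /(sg_eqv pp hO); rewrite -actM {1}/h mulgV act1.
  by move=> bc /(sg_fun pp bc) e; rewrite actM -e actVK.
have w1_nil : w1 = [::].
  apply: (IHn w1 C (h * z.1^-1)) => //.
  - by move: le_n; rewrite /= size_rcons ltnS; apply: leq_trans.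
  - by move: sw; rewrite /= rcons_path => /andP[/path_sorted].
  - by move=> B' CB'; rewrite cst maxB //; apply: reach_trans CB'.
  - by rewrite -C'E.
(* Only the two outer steps remain. The element between them stabilises [C], hence lies in the edge
   group by [eqC], and so the two steps cancel, against reducedness. *)
rewrite w1_nil /= in rC sw; rewrite andbT in sw.
have /stabFP : actF C (h * z.1^-1) = C by rewrite -C'E.
move=> hzC.
have : h * z.1^-1 \in OmL a.2.1.
  move: hzC; rewrite -eqC => /imsetP[al alB ->]; rewrite conjgE mulgA; exact: stabO.
rewrite groupMl // groupV => zO; case/negP: sw; rewrite zO andbT.
by rewrite eaz sinvK.
Qed.

(** * The trivial approximation *)

Definition trivial_system : system := fun l x y => x \in NF (OmL l) /\ y = x.

Hypothesis Om_docile : forall i, exists2 v, v \in V & v \notin NF (Om i).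

Hypothesis T_ge2 : forall i, (2 <= #|T i|)%N.

Lemma other_letter i (t : T i) : exists t' : T i, t' != t.
Proof.
have /card_gt0P[t'] : (0 < #|predC1 t|)%N by rewrite cardC1; case: #|T i| (T_ge2 i) => [|[]].
by rewrite inE => ne; exists t'.
Qed.

Lemma a_letter i : exists t : T i, true.
Proof. by have /card_gt0P[t _] := leq_trans (isT : 0 < 2)%N (T_ge2 i); exists t. Qed.

Lemma card_NF i : (#|` NF (Om i)| < k)%N.
Proof.
have [v vV vN] := Om_docile i; rewrite -V_card; apply: fproper_ltn_card.
rewrite fproperE; apply/andP; split; first by apply/fsubsetP => x /NF_V.
by apply: contra vN => /fsubsetP; apply.
Qed.

(** A step here would need a k-set inside some [NF (Om i)], which docility makes too small. *)
Lemma good_trivial : good trivial_system.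
Proof.
split.
- split.
  + by move=> l x y z [_ ->] [_ ->].
  + by move=> l x y z [_ ->] [_ <-].
  + by move=> l x y w [xN ->] wl; split=> //; rewrite NF_act.
  + by [].
  + by exists V => l x y [/NF_V xV ->].
- move=> f A cA st _; have := card_NF (tag (f 0%N).2.1); rewrite ltnNge => /negP; apply.
  rewrite -(cA 0%N) -(card_actF act1 actM (A 0%N) (f 0%N).1); apply: fsubset_leq_card.
  apply/fsubsetP => _ /imfsetP[x /= /st[y _] + ->].
  by rewrite /sg; case: ifP => _ [h e]; rewrite ?e // -e.
- by move=> i A hA x xA; have [t _] := a_letter i; have [y _ []] := hA t x xA.
Qed.

(** * Extending letters by fresh orbits *)

Hypothesis U_inf : forall F : {fset U}, exists x, x \notin F.

Lemma fresh_point (F : {fset U}) : exists2 y, y \notin V & forall w, act y w \notin F.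
Proof.
have [y] := U_inf (V `|` satF act F); rewrite inE negb_or => /andP[yV yF].
exists y => // w; apply: contra yF => /(satF_sub act1) h.
by rewrite (satF_act act1 actM) in h.
Qed.

(** To keep the letter equivariant, the whole orbit of the pair [(x, y)] under the edge group is
    added. *)
Definition attach p s x y : system := fun l a b => p l a b \/
  (l = s.1 /\ exists2 w, w \in OmL s.1 &
     if s.2 then a = act x w /\ b = act y w else a = act y w /\ b = act x w).

Lemma sg_attach p s x y s' a b : sg (attach p s x y) s' a b <->
  sg p s' a b \/ exists2 w, w \in OmL s.1 &
    (s' = s /\ a = act x w /\ b = act y w) \/
    (s' = sinv s /\ a = act y w /\ b = act x w).
Proof.
case: s s' => l1 b1 [l2 b2]; rewrite /sg /attach /sinv /=.
split=> [|[|[w wO [[[-> ->] [-> ->]]|[[-> ->] [-> ->]]]]]]; last 2 first.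
- by case: b1 => /=; right; split=> //; exists w.
- by case: b1 => /=; right; split=> //; exists w.
- case: b1 b2 => [] [] [h|[-> [w wO [-> ->]]]]; try (by left);
    by right; exists w => //; (left + right).
- by case: b2; left.
Qed.

Section Attach.
Variables (p : system) (s : L * bool) (x y : U).
Hypotheses (gp : good p) (x_free : forall z, ~ sg p s x z) (yV : y \notin V).
Hypothesis y_free : forall w s' z, ~ sg p s' (act y w) z.
Hypothesis xy_orbit : forall w, act y w <> x.

Let x_NF : x \notin NF (OmL s.1).
Proof. by apply/negP => /(sg_nf gp)/x_free. Qed.

Let x_stab v w : v \in OmL s.1 -> w \in OmL s.1 -> act x v = act x w -> v = w.
Proof.
move=> vO wO e; apply/eqP; rewrite eq_mulgV1; apply: contraNT x_NF => vw.
apply/NFP => //; exists (v * w^-1); rewrite groupM ?groupV //; split=> //; first exact/eqP.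
by rewrite actM e actVK.
Qed.

Let y_stab v w : act y v = act y w -> v = w.
Proof.
move=> e; apply/eqP; rewrite eq_mulgV1; apply/eqP; apply: (V_free yV).
by rewrite actM e actVK.
Qed.

Let xy_orbits v w : act y v <> act x w.
Proof. by move=> e; apply: (@xy_orbit (v * w^-1)); rewrite actM e actVK. Qed.

Let xv_free w z : w \in OmL s.1 -> ~ sg p s (act x w) z.
Proof.
move=> wO h; apply: (@x_free (act z w^-1)).
by rewrite -(actVK act1 actM x w); apply: (sg_eqv gp); rewrite ?groupV.
Qed.

Let q := attach p s x y.

Let q_fun s' a b c : sg q s' a b -> sg q s' a c -> b = c.
Proof.
move=> /sg_attach[h|[w wO [[-> [-> ->]]|[-> [-> ->]]]]] /sg_attach[h'|[w' wO' [[e [e1 ->]]|[e [e1 ->]]]]].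
- exact: (sg_fun gp) h h'.
- by rewrite e e1 in h; case: (xv_free wO' h).
- by rewrite e1 in h; case: (y_free h).
- by case: (xv_free wO h').
- by rewrite (x_stab wO wO' e1).
- by case: (sinv_neq e).
- by case: (y_free h').
- by case: (sinv_neq (esym e)).
- by rewrite (y_stab e1).
Qed.

Let pre_q : presystem q.
Proof.
split.
- by move=> l a b c; apply: (@q_fun (l, true)).
- by move=> l a b c; apply: (@q_fun (l, false)).
- move=> l a b w [h|[-> [v vO e]]] wl; first by left; apply: (ps_eqv gp).
  right; split=> //; exists (v * w); first by rewrite groupM.
  by rewrite !actM; case: (s.2) e => -[-> ->].
- by move=> l a aN; left; apply: (ps_nf gp).
- have [F hF] := ps_fin gp; exists (F `|` satF act [fset x; y]) => l a b.
  have hx w : act x w \in satF act [fset x; y].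
    by rewrite (satF_act act1 actM); apply: satF_sub => //; rewrite !inE eqxx.
  have hy w : act y w \in satF act [fset x; y].
    by rewrite (satF_act act1 actM); apply: satF_sub => //; rewrite !inE eqxx orbT.
  move=> [/hF[aF bF]|[_ [w _]]]; first by rewrite !inE aF bF.
  by case: ifP => _ [-> ->]; rewrite !inE hx hy !orbT.
Qed.

(* A reduced walk can only use a new edge in its first step. *)
Let noinf_q : no_infinite_walk q.
Proof.
move=> f A cA st red; apply: (good_noinf gp (f := fun n => f n.+1) (A := fun n => A n.+1)) => //.
move=> n a aA; have [b bA ab] := st n.+1 a aA; exists b => //.
(* After going from [x] to the orbit of [y] the walk can leave only by the edge it came on; before
   going from [y] to [x] it can only have arrived by that edge. In both cases consecutive letters
   cancel. *)
move/sg_attach: ab => [//|[w wO [[es [ea eb]]|[es [ea eb]]]]]; exfalso.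
  have [c _] := st n.+2 b bA; rewrite eb -actM => /sg_attach[/y_free//|[v vO]].
  move=> [[_ [/xy_orbits//]]|[es' [/y_stab ev _]]].
  have /negP := red n.+1; apply; rewrite es' es eqxx /=.
  by rewrite (_ : (f n.+2).1 = w^-1 * v) ?groupM ?groupV // -ev mulKg.
have [d dA] := step_back pre_q (etrans (cA _) (esym (cA _))) (st n) aA.
move=> /sg_attach h; move: ea.
have ya v : act y v <> act x 1 by apply: xy_orbits.
case: h => [/sg_sinv|[v vO [[es' [_ ->]]|[es' [_ ->]]]]].
- by move=> h e; apply: (@y_free (w * (f n.+1).1^-1) _ _ _); rewrite actM -e actVK //; exact: h.
- rewrite -actM => /y_stab ev; have /negP := red n; apply.
  rewrite es es' eqxx /= (_ : (f n.+1).1 = v^-1 * w) ?groupM ?groupV //.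
  by rewrite -ev mulKg.
- by rewrite -actM => /esym/xy_orbits.
Qed.

Let taut_q : no_finite_orbit q.
Proof.
move=> i A hA; apply: (good_taut gp) => t a aA.
have [b bA ab] := hA t a aA; exists b => //.
(* The signed letter [s] is undefined on the orbit of [y], while an invariant set is closed under
   it; so such a set misses this orbit and sees only old edges. *)
have hA' : forall (t : T i) x, x \in A -> exists2 y, y \in A & sg q (ltr t, s.2) x y.
  case: (s.2) => [|t' a' a'A]; first exact: hA.
  apply: (@injective_rel_surj _ (fun y x => q (ltr t') y x) A A) => //.
  + by move=> u u' v; apply: (@ps_inj q).
  + exact: hA.
suff no_y w : ltr t = s.1 -> act y w \notin A.
  move: ab; case=> // -[el [w wO e]]; exfalso; move: (no_y w el).
  by case: ifP e => _ [ea eb]; rewrite -?ea -?eb ?aA ?bA.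
move=> el; apply/negP => yA; have [c _] := hA' t _ yA; rewrite el -surjective_pairing.
by move=> /sg_attach[/y_free//|[v vO [[_ [/xy_orbits//]]|[/sinv_neq//]]]].
Qed.

Lemma attach_good : good (attach p s x y).
Proof. by split. Qed.

End Attach.

(** Control is one-sided: new edges read in direction [b] end outside [F]. Hence no new edge in the
    opposite direction starts in [F]. *)
Definition extends b (F : {fset U}) p q :=
  (forall l x y, p l x y -> q l x y) /\
  (forall l x y, sg q (l, b) x y -> sg p (l, b) x y \/ y \notin F).

Lemma extends_refl b F p : extends b F p p.
Proof. by split=> // l x y; left. Qed.

Lemma extends_trans b F p q r : extends b F p q -> extends b F q r -> extends b F p r.
Proof.
move=> [pq hq] [qr hr]; split=> [l x y /pq/qr//|l x y /hr[/hq//|]]; by right.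
Qed.

(** If [s] is undefined at [x], a fresh orbit is attached. The last clause records that every new
    edge in the direction of [s] ends at a dead end for that direction, which is what makes the
    opening of k-sets below terminate. *)
Lemma extend_point p s x F : good p -> exists q, [/\ good q, extends s.2 F p q,
  exists z, sg q s x z & forall l a c, sg q (l, s.2) a c -> sg p (l, s.2) a c \/
    [/\ l = s.1, exists2 w, w \in OmL s.1 & a = act x w, c \notin F
      & forall l' d, ~ sg q (l', s.2) c d]].
Proof.
move=> gp; have [[z xz]|xN] := pselect (exists z, sg p s x z).
  by exists p; split=> //; [exact: extends_refl|exists z|left].
have [P hP] := ps_fin gp.
have [y yV yF] := fresh_point (F `|` P `|` [fset x]).
have yP w s' z : ~ sg p s' (act y w) z.
  move=> h; have /negP := yF w; apply; rewrite !inE.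
  by case: s' h => l []; rewrite /sg /= => /hP[h1 h2]; rewrite ?h1 ?h2 !orbT.
have yx w : act y w <> x by move=> e; have := yF w; rewrite e !inE eqxx orbT.
have info l a c : sg (attach p s x y) (l, s.2) a c -> sg p (l, s.2) a c \/
    exists2 w, w \in OmL s.1 & [/\ l = s.1, a = act x w & c = act y w].
  move=> /sg_attach[|[w wO [[e [-> ->]]|[e _]]]]; first by left.
    by right; exists w => //; rewrite -e.
  by have := congr1 snd e; rewrite /sinv /=; case: (s.2).
exists (attach p s x y); split.
- by apply: attach_good => // z h; apply: xN; exists z.
- split=> [l a c h|l a c /info[|[w _ [_ _ ->]]]]; [by left|by left|right].
  by have := yF w; rewrite !inE !negb_or => /andP[/andP[]].
- by exists y; apply/sg_attach; right; exists 1; rewrite ?group1 // !act1; left.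
- move=> l a c /info[|[w wO [-> -> ->]]]; [by left|right; split=> //; first by exists w].
    by have := yF w; rewrite !inE !negb_or => /andP[/andP[]].
  move=> l' d /info[/yP//|[v _ [_ e _]]].
  by apply: (yx (w * v^-1)); rewrite actM e actVK.
Qed.

Lemma extend_set p s (r : seq U) F : good p ->
  (forall x w, x \in r -> act x w \in F) -> exists q, [/\ good q, extends s.2 F p q,
  forall x, x \in r -> exists z, sg q s x z &
  forall l a c, sg q (l, s.2) a c -> sg p (l, s.2) a c \/
    [/\ l = s.1, exists x w, [/\ x \in r, w \in OmL s.1 & a = act x w], c \notin F
      & forall l' d, ~ sg q (l', s.2) c d]].
Proof.
move=> gp; elim: r => [_|x r IHr rF].
  by exists p; split=> //; [exact: extends_refl|left].
have [|q1 [gq1 e1 h1 info1]] := IHr.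
  by move=> y w yr; apply: rF; rewrite inE yr orbT.
have [q [gq e [z xz] info]] := extend_point s x F gq1.
exists q; split=> //; first exact: extends_trans e1 e.
  move=> y; rewrite inE => /orP[/eqP->|/h1[u yu]]; first by exists z.
  by exists u; apply: sg_mono yu; case: e.
move=> l a c /info[/info1[|[-> [y [w [yr wO ->]]] cF no]]|[-> [w wO ->] cF no]].
- by left.
- right; split=> //; first by exists y, w; rewrite inE yr orbT.
  (* A dead end created earlier remains one: it lies outside [F], whereas new edges start in [F]. *)
  move=> l' d /info[/no//|[_ [v _ ec] _ _]].
  by move: cF; rewrite ec rF // inE eqxx.
- by right; split=> //; exists x, w; rewrite inE eqxx.
Qed.

(** * Moving a k-set to where the letters of one index are undefined *)

Definition inv_set i (B : {fset U}) :=
  (forall x w, x \in B -> w \in Om i -> act x w \in B) /\ {subset NF (Om i) <= B}.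

(** These are the obstructions to [B] being open in direction [b]; their number is the measure that
    decreases. *)
Definition outs p b i (B : {fset U}) : {fset U} :=
  [fset x in B | (x \notin NF (Om i)) &&
                 `[< exists (t : T i) z, sg p (ltr t, b) x z >]].

Lemma outsP p b i B x : reflect
  [/\ x \in B, x \notin NF (Om i) & exists (t : T i) z, sg p (ltr t, b) x z]
  (x \in outs p b i B).
Proof.
rewrite !inE; apply: (iffP andP) => [[xB /andP[xN /asboolP]]|[xB xN /asboolP h]] //.
by split=> //; apply/andP.
Qed.

(** The letter [t] is made total on [B] by fresh orbits and [B] is replaced by its image. Fresh
    points are dead ends, so every obstruction of the image comes from an obstruction of [B] at
    which [t] was already defined. *)
Lemma step_open p i b (t : T i) B F : good p -> inv_set i B ->
  exists q g, [/\ good q, extends b F p q,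
    forall x, x \in B -> sg q (ltr t, b) x (g x),
    [/\ {subset outs q b i [fset g x | x in B] <= [fset g x | x in outs p b i B]},
        forall x, x \in outs p b i B -> (forall z, ~ sg p (ltr t, b) x z) ->
          g x \notin outs q b i [fset g x | x in B],
        inv_set i [fset g x | x in B], {in B &, injective g}
      & reach q B [fset g x | x in B]]
    & forall l a c, sg q (l, b) a c -> sg p (l, b) a c \/ (l = ltr t /\ a \in B)].
Proof.
move=> gp [Binv Bnf].
have [|q [gq eq qB info]] := @extend_set p (ltr t, b) B (F `|` satF act B) gp.
  by move=> x w xB; rewrite inE (satF_act act1 actM) satF_sub ?orbT.
have [g gP] : {g : U -> U & forall x, x \in B -> sg q (ltr t, b) x (g x)}.
  apply: (@choice _ _ (fun x y => x \in B -> sg q (ltr t, b) x y)) => x.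
  by have [/qB[z xz]|_] := boolP (x \in B); [exists z|exists x].
have g_inj : {in B &, injective g}.
  by move=> x y /gP gx /gP gy e; rewrite e in gx; exact: (sg_inj gq gx gy).
have gN x : x \in NF (Om i) -> g x = x.
  move=> xN; have := @sg_nf q (ltr t, b) x gq xN.
  exact: (sg_fun gq (gP _ (Bnf _ xN))).
have info2 l a c : sg q (l, b) a c -> sg p (l, b) a c \/
    [/\ l = ltr t, a \in B & forall l' d, ~ sg q (l', b) c d].
  move=> /info[|[/= -> [x [w [xB wO ->]]] _ no]]; [by left|right; split=> //].
  exact: Binv.
exists q, g; split=> //.
- by split=> [|l x y /(eq.2)[|]]; [exact: eq.1|left|rewrite inE negb_or => /andP[]; right].
- split=> //.
  + move=> _ /outsP[/imfsetP[x /= xB ->] gxN [t' [z gz]]]; apply/imfsetP; exists x => //=.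
    apply/outsP; split=> //; first by apply: contra gxN => xN; rewrite gN.
    exists t; have [h|[_ _ /(_ _ _ gz)]//] := info2 _ _ _ (gP x xB).
    by exists (g x).
  + move=> x /outsP[xB _ _] no; apply/negP => /outsP[_ _ [t' [z]]].
    by have [/no//|[_ _]] := info2 _ _ _ (gP x xB); apply.
  + split=> [_ w /imfsetP[x /= xB ->] wO|x xN].
      apply/imfsetP; exists (act x w); first exact: Binv.
      apply: (sg_fun gq _ (gP _ (Binv _ _ xB wO))).
      by apply: (sg_eqv gq) => //; apply: gP.
    by apply/imfsetP; exists x; rewrite ?gN //; apply: Bnf.
  + apply: (@reach_step _ (ltr t, b)); first by rewrite card_in_imfset.
    by move=> x xB; exists (g x); rewrite /= ?act1 ?in_imfset //; apply: gP.
- by move=> l a c /info2[|[-> aB _]]; [left|right].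
Qed.

Fixpoint read p b i (w : seq (T i)) x y : Prop :=
  if w is t :: w' then exists2 z, sg p (ltr t, b) x z & read p b w' z y else x = y.

Lemma read_mono p q b i (w : seq (T i)) x y : (forall l x y, p l x y -> q l x y) ->
  read p b w x y -> read q b w x y.
Proof.
move=> pq; elim: w x => [//|t w IHw x [z xz /IHw zy]].
by exists z => //; apply: sg_mono xz.
Qed.

Lemma read_rcons p b i (w : seq (T i)) t x y z :
  read p b w x y -> sg p (ltr t, b) y z -> read p b (rcons w t) x z.
Proof.
elim: w x => [x ->|t' w IHw x [u xu uy] yz]; first by exists z.
by exists u => //; apply: IHw.
Qed.

Lemma read_cat p b i (w w' : seq (T i)) x z :
  read p b (w ++ w') x z -> exists2 y, read p b w x y & read p b w' y z.
Proof.
elim: w x => [x h|t w IHw x [u xu /IHw[y uy yz]]]; first by exists x.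
by exists y => //; exists u.
Qed.

Lemma sg_NF p b i (t : T i) x y : presystem p -> sg p (ltr t, b) x y ->
  y \in NF (Om i) -> x \in NF (Om i).
Proof.
move=> pp xy yN; have := @sg_nf p (ltr t, b) y pp yN.
by move=> /(sg_inj pp xy) ->.
Qed.

Lemma read_NF p b i (w : seq (T i)) x y : presystem p -> read p b w x y ->
  y \in NF (Om i) -> x \in NF (Om i).
Proof.
move=> pp; elim: w x => [x -> //|t w IHw x [z xz /IHw zy] /zy].
exact: (sg_NF pp xz).
Qed.

(** Otherwise the finitely many points that can be read from [x] would be invariant under all
    letters of [T i], and [no_finite_orbit] would put them into [NF (Om i)]. *)
Lemma escape p b i x : good p -> x \notin NF (Om i) ->
  exists (w : seq (T i)) z (t : T i), read p b w x z /\ forall c, ~ sg p (ltr t, b) z c.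
Proof.
move=> gp xN; apply: contrapT => no; have [P hP] := ps_fin gp.
have hP' s u v : sg p s u v -> v \in P by case: s => l [] /hP[].
pose A := [fset z in x |` P | `[< exists w : seq (T i), read p b w x z >]].
move/negP: xN; apply.
apply: (@no_finite_orbit_sg p b i A gp (good_taut gp)); last first.
  by rewrite !inE eqxx /=; apply/asboolP; exists [::].
move=> t z; rewrite !inE /= => /andP[_ /asboolP[w xz]].
have [c zc] : exists c, sg p (ltr t, b) z c.
  apply: contrapT => zc; apply: no; exists w, z, t; split=> // c h.
  by apply: zc; exists c.
exists c => //; rewrite !inE (hP' _ _ _ zc) orbT /=.
by apply/asboolP; exists (rcons w t); apply: read_rcons zc.
Qed.

(** The points of the support are treated one after the other: whenever the current word can be read
    from a point and ends off [NF (Om i)], an escaping word is appended. *)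
Lemma unreadable_word p i : good p -> exists r : seq (T i),
  forall x y, read p true r x y -> x \in NF (Om i).
Proof.
move=> gp; have [P hP] := ps_fin gp; have [t0 _] := a_letter i.
suff /(_ (enum_fset P))[r hr] : forall s : seq U, exists r : seq (T i),
    forall x y, x \in s -> read p true r x y -> x \in NF (Om i).
  (* The extra first letter brings every starting point into the finite support. *)
  exists (t0 :: r) => x y [z xz zy]; have [_ zP] := hP _ _ _ xz.
  by apply: (sg_NF gp xz); apply: (hr _ _ zP zy).
elim=> [|x s [r hr]]; first by exists [::].
have [[y xy]|no] := pselect (exists y, read p true r x y); last first.
  exists r => u v; rewrite inE => /orP[/eqP-> h|]; last exact: hr.
  by case: no; exists v.
have [yN|yN] := boolP (y \in NF (Om i)).
  exists r => u v; rewrite inE => /orP[/eqP-> h|]; last exact: hr.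
  exact: (read_NF gp xy yN).
have [w [z [t [yz zt]]]] := escape true gp yN.
have rdf w' u v v' : read p true w' u v -> @read p true i w' u v' -> v = v'.
  elim: w' u => [u -> //|t' w' IHw u [a ua av] [a' ua' av']].
  by rewrite (sg_fun gp ua ua') in av; apply: IHw av av'.
exists (r ++ rcons w t) => u v us /read_cat[y' uy' y'v].
move: us; rewrite inE => /orP[/eqP eu|us]; last exact: (hr _ _ us uy').
move: uy' y'v; rewrite eu => /(rdf _ _ _ _ xy) <-; rewrite -cats1.
by move=> /read_cat[z' /(rdf _ _ _ _ yz) <-] [c /zt].
Qed.

(** Opening the letters of an escaping word one by one never increases the number of obstructions,
    and decreases it as soon as the letter opened was undefined at one of them or the image of [x]
    is no longer one. *)
Lemma open_decrease i b F (w : seq (T i)) p B x z (t0 : T i) : good p -> inv_set i B ->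
  x \in outs p b i B -> read p b w x z -> (forall c, ~ sg p (ltr t0, b) z c) ->
  exists q B', [/\ good q, extends b F p q, reach q B B', inv_set i B'
                 & (#|` outs q b i B'| < #|` outs p b i B|)%N].
Proof.
have lt_outs g q p' B' C : {in B' &, injective g} ->
    {subset outs q b i C <= [fset g x | x in outs p' b i B']} ->
    forall y, y \in outs p' b i B' -> g y \notin outs q b i C ->
    (#|` outs q b i C| < #|` outs p' b i B'|)%N.
  move=> gI sub y yo gyo.
  have <- : #|` [fset g x | x in outs p' b i B']| = #|` outs p' b i B'|.
    by rewrite card_in_imfset // => u v /outsP[uB _ _] /outsP[vB _ _]; apply: gI.
  apply: fproper_ltn_card; rewrite fproperE; apply/andP; split; first exact/fsubsetP.
  by apply/negP => /fsubsetP/(_ (g y)); rewrite in_imfset // (negPf gyo) => /(_ isT).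
have single p' B' y (t : T i) : good p' -> inv_set i B' -> y \in outs p' b i B' ->
    (forall c, ~ sg p' (ltr t, b) y c) ->
    exists q B2, [/\ good q, extends b F p' q, reach q B' B2, inv_set i B2
                 & (#|` outs q b i B2| < #|` outs p' b i B'|)%N].
  move=> gp iB yo yt; have [q [g [gq eq _ [sub h iB1 gI rB] _]]] := step_open b t F gp iB.
  by exists q, [fset g x | x in B']; split=> //; apply: (lt_outs g) (h _ yo yt).
elim: w p B x z t0 => [|t w IHw] p B x z t0 gp iB xo /=.
  by move=> <-; apply: single.
move=> [x1 xx1 x1z] zt0.
have [zo|zo] := boolP (z \in outs p b i B); first exact: single zo zt0.
have [q [g [gq eq gP [sub h iB1 gI rB] info]]] := step_open b t F gp iB.
have [xB xN _] := outsP _ _ _ _ _ xo.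
have gx : g x = x1 by apply: (sg_fun gq (gP _ xB)); apply: sg_mono xx1; case: eq.
have [x1o|x1o] := boolP (x1 \in outs q b i [fset g x | x in B]); last first.
  exists q, [fset g x | x in B]; split=> //.
  by apply: (lt_outs g _ _ _ _ gI sub x xo); rewrite gx.
have x1z' : read q b w x1 z by apply: read_mono x1z; case: eq.
have le_o : (#|` outs q b i [fset g x | x in B]| <= #|` outs p b i B|)%N.
  have <- : #|` [fset g x | x in outs p b i B]| = #|` outs p b i B|.
    by rewrite card_in_imfset // => u v /outsP[uB _ _] /outsP[vB _ _]; apply: gI.
  by apply: fsubset_leq_card; apply/fsubsetP.
suff [t1 zt1] : exists t1 : T i, forall c, ~ sg q (ltr t1, b) z c.
  have [q' [B' [gq' eq' rB' iB' lt']]] := IHw _ _ _ _ t1 gq iB1 x1o x1z' zt1.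
  exists q', B'; split=> //; first exact: extends_trans eq eq'.
    by apply: reach_trans rB'; apply: reach_mono rB; case: eq'.
  exact: leq_trans lt' le_o.
(* The step just made may have defined [t0] at [z], but only if [t0] is the letter opened and [z]
   lies in [B]. Then a second letter of [T i] is still undefined at [z], because [z] is not an
   obstruction. *)
have [zt0'|] := pselect (forall c, ~ sg q (ltr t0, b) z c); first by exists t0.
move=> /existsNP[c /contrapT /info[/zt0//|[e zB]]].
have [t2 t2t] := other_letter t; exists t2 => d /info[zd|[e' _]]; last first.
  move/eqP: t2t; apply.
  exact: (@eq_from_Tagged _ (fun j => T j) _ _ _ e').
have zN : z \notin NF (Om i).
  by apply/negP => zN; apply: (zt0 z); exact: (@sg_nf p (ltr t0, b) z gp zN).
by move/negP: zo; apply; apply/outsP; split=> //; exists t2, d.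
Qed.

Lemma open_set p i b F B : good p -> inv_set i B ->
  exists q B', [/\ good q, extends b F p q, reach q B B', inv_set i B'
    & forall (t : T i) x z, x \in B' -> x \notin NF (Om i) -> ~ sg q (ltr t, b) x z].
Proof.
have [n] := ubnP #|` outs p b i B|; elim: n p B => // n IHn p B le_n gp iB.
have [e|/fset0Pn[x xo]] := eqVneq (outs p b i B) fset0.
  exists p, B; split=> //; [exact: extends_refl|exact: reach_refl|].
  move=> t x z xB xN xz; suff : x \in fset0 by [].
  by rewrite -e; apply/outsP; split=> //; exists t, z.
have [_ xN _] := outsP _ _ _ _ _ xo.
have [w [z [t [xz zt]]]] := escape b gp xN.
have [q [B' [gq eq rB iB' lt]]] := open_decrease F gp iB xo xz zt.
have [q' [B2 [gq' eq' rB' iB2 op]]] := IHn q B' (leq_trans lt le_n) gq iB'.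
exists q', B2; split=> //; first exact: extends_trans eq eq'.
by apply: reach_trans rB'; apply: reach_mono rB; case: eq'.
Qed.

(** * Joining two k-sets *)

Section Join.
Variables (p : system) (i : I) (A1 B1 F : {fset U}) (n : nat) (u : nat -> T i).
(** The point [C j a] is the vertex number [j] of the path that starts at [a], spells [u 0], ...,
    [u (n - 1)] and ends in [B1]; the vertices strictly between are fresh. *)
Variable C : nat -> U -> U.
Local Notation X := (A1 `\` NF (Om i)).
Hypotheses (gp : good p) (cA1 : #|` A1| = k) (cB1 : #|` B1| = k).
Hypotheses (iA1 : inv_set i A1) (iB1 : inv_set i B1).
Hypothesis openA : forall (t : T i) x z,
  x \in A1 -> x \notin NF (Om i) -> ~ sg p (ltr t, true) x z.
Hypothesis openB : forall (t : T i) x z,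
  x \in B1 -> x \notin NF (Om i) -> ~ sg p (ltr t, false) x z.
Hypothesis unreach : ~ reach p A1 B1.
Hypothesis stabA1 : stabF A1 \subset Om i.
Hypothesis closedA1 : forall w g,
  sorted reduced2 w -> run p w A1 (actF A1 g) -> w = [::].
Hypothesis n_gt1 : (1 < n)%N.
Hypothesis borderless : forall c, (0 < c < n)%N ->
  exists2 s, (c + s < n)%N & u (c + s)%N <> u s.
Hypothesis unreadable : forall be : nat -> U,
  (forall j, (j < n)%N -> p (ltr (u j)) (be j) (be j.+1)) -> be 0%N \in NF (Om i).
Hypothesis F_act : forall x w, (act x w \in F) = (x \in F).
Hypothesis F_supp : forall l x y, p l x y -> x \in F /\ y \in F.
Hypotheses (A1F : {subset A1 <= F}) (B1F : {subset B1 <= F}).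
Hypothesis C0 : forall a, a \in X -> C 0%N a = a.
Hypothesis Cn_in : forall a, a \in X -> C n a \in B1 `\` NF (Om i).
Hypothesis Cn_inj : {in X &, injective (C n)}.
Hypothesis Cn_surj : forall y, y \in B1 `\` NF (Om i) -> exists2 a, a \in X & C n a = y.
Hypothesis C_eqv : forall j a w, (j <= n)%N -> a \in X -> w \in Om i ->
  C j (act a w) = act (C j a) w.
Hypothesis C_F : forall j a, (0 < j < n)%N -> a \in X -> C j a \notin F.
Hypothesis C_inj : forall j j' a a' w, (0 < j < n)%N -> (0 < j' < n)%N ->
  a \in X -> a' \in X -> act (C j a) w = C j' a' ->
  [/\ j = j', w \in Om i & act a w = a'].

(* The path can be followed in both directions: [D true], [D false] are its
   vertices and [v true], [v false] its letters in the two orders. *)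
Let D b j a := C (if b then j else n - j)%N a.
Let v b j : L * bool := (ltr (u (if b then j else n - j.+1)%N), b).
Let E b := if b then A1 else B1.

Definition join : system := fun l x y => p l x y \/
  exists j a, [/\ (j < n)%N, a \in X, l = ltr (u j), x = C j a & y = C j.+1 a].

Let q := join.

Let n_gt0 : (0 < n)%N. Proof. exact: ltnW. Qed.

Let X_act a w : a \in X -> w \in Om i -> act a w \in X.
Proof. by case: (free_inv_NF (proj1 iA1)) => h _; apply: h. Qed.

Let v_sinv b c : (c < n)%N -> sinv (v b c) = v (~~ b) (n - c.+1)%N.
Proof.
move=> cn; case: b; rewrite /sinv /v /= ?subnSK //; congr (ltr (u _), _); lia.
Qed.

Let D_flip b j a : (j <= n)%N -> D (~~ b) (n - j)%N a = D b j a.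
Proof. by move=> jn; rewrite /D; case: b => /=; rewrite ?subKn. Qed.

Let D_eqv b j a w : (j <= n)%N -> a \in X -> w \in Om i ->
  D b j (act a w) = act (D b j a) w.
Proof. by move=> jn aX wO; apply: C_eqv => //; case: b; rewrite ?leq_subr. Qed.

Let D_F b j a : (0 < j < n)%N -> a \in X -> D b j a \notin F.
Proof. move=> jn aX; apply: C_F => //; case: b => //; lia. Qed.

Let D_0 b a : a \in X -> D b 0%N a \in E b `\` NF (Om i).
Proof. by move=> aX; case: b; rewrite /D /E ?C0 // subn0 Cn_in. Qed.

Let D_n b a : a \in X -> D b n a \in E (~~ b) `\` NF (Om i).
Proof. by move=> aX; rewrite -D_flip // subnn D_0. Qed.

Let E_F b : {subset E b <= F}. Proof. by case: b. Qed.

Let iE b : inv_set i (E b). Proof. by case: b. Qed.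

Let cE b : #|` E b| = k. Proof. by case: b. Qed.

Let D_0F b a : a \in X -> D b 0%N a \in F.
Proof. by move=> /(D_0 b); rewrite in_fsetD => /andP[_ /E_F]. Qed.

Let D_mid b j a : (j <= n)%N -> a \in X -> D b j a \notin F -> (0 < j < n)%N.
Proof.
move=> jn aX; rewrite !lt0n ltn_neqAle jn andbT => nF; apply/andP.
split; apply: contraNneq nF => ->; first exact: D_0F.
by have := D_n b aX; rewrite in_fsetD => /andP[_ /E_F].
Qed.

Let D_midinj b j b' j' a a' w : (0 < j < n)%N -> (0 < j' < n)%N -> a \in X ->
  a' \in X -> act (D b j a) w = D b' j' a' ->
  [/\ j' = if b == b' then j else (n - j)%N, w \in Om i & act a w = a'].
Proof.
move=> jn jn' aX a'X /C_inj[]//; try by case: (b) (b') => [] []; lia.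
by move=> e wO ea; split=> //; move: e; case: (b) (b') => [] [] /=; lia.
Qed.

Let D_inj b j a a' : (j <= n)%N -> a \in X -> a' \in X -> D b j a = D b j a' -> a = a'.
Proof.
move=> jn aX a'X e; have [jm|] := boolP (0 < j < n)%N.
  have e' : act (D b j a) 1 = D b j a' by rewrite act1.
  by have [_ _] := D_midinj jm jm aX a'X e'; rewrite act1.
rewrite negb_and -leqNgt -leqNgt leqn0 => /orP[/eqP j0|nj].
  move: e; rewrite j0 /D; case: (b); first by rewrite !C0.
  by rewrite subn0; apply: Cn_inj.
have {}nj : j = n by lia.
move: e; rewrite nj /D; case: (b); first exact: Cn_inj.
by rewrite subnn !C0.
Qed.

Let sgq s x y : sg q s x y <-> sg p s x y \/
  exists b j a, [/\ (j < n)%N, a \in X, s = v b j, x = D b j a & y = D b j.+1 a].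
Proof.
case: s => l []; rewrite /sg /q /join /=; split=> -[h|]; try by left.
- by move=> [j [a [jn aX -> -> ->]]]; right; exists true, j, a.
- by move=> [[] [j [a [jn aX es -> ->]]]]; case: es => // ->; right; exists j, a.
- move=> [j [a [jn aX -> -> ->]]]; right; exists false, (n - j.+1)%N, a.
  split=> //; first by rewrite -subSn ?subSS ?leq_subr //; lia.
  + by rewrite /v /=; congr (ltr (u _), _); lia.
  + by rewrite /D; congr C; lia.
  + by rewrite /D; congr C; lia.
- move=> [[] [j [a [jn aX es -> ->]]]]; case: es => // ->; right; exists (n - j.+1)%N, a.
  by split=> //; rewrite /D; try congr C; lia.
Qed.

Let new_edge b j a : (j < n)%N -> a \in X -> sg q (v b j) (D b j a) (D b j.+1 a).
Proof. by move=> jn aX; apply/sgq; right; exists b, j, a. Qed.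

Let sgp_F s x y : sg p s x y -> x \in F /\ y \in F.
Proof. by case: s => l []; rewrite /sg /= => /F_supp[]. Qed.

(** An interior vertex is fresh, so the only edges there are the two path edges; the group element
    has to lie in [Om i] because its orbit meets the paths only in that way. *)
Let interior_step s b c a w y : (0 < c < n)%N -> a \in X ->
  sg q s (act (D b c a) w) y -> w \in Om i /\
  (s = v b c /\ y = D b c.+1 (act a w) \/
   s = sinv (v b c.-1) /\ y = D b c.-1 (act a w)).
Proof.
move=> cn aX /sgq[/sgp_F[]|[b' [j [a' [jn a'X es e ->]]]]].
  by rewrite F_act (negPf (D_F b cn aX)).
have jm : (0 < j < n)%N.
  by apply: (@D_mid b' j a') => //; [exact: ltnW|rewrite -e F_act D_F].
have [ej wO ea] := D_midinj cn jm aX a'X e.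
split=> //; rewrite es ej ea; case: eqP => [->|nb]; first by left.
right; have -> : b' = ~~ b by case: (b) (b') nb => [] [].
rewrite v_sinv ?prednK; try lia.
by split=> //; rewrite -(D_flip b) ?negbK; [congr (D _ _ _); lia|lia].
Qed.

Let open_start b (t : T i) x z : x \in E b -> x \notin NF (Om i) -> ~ sg p (ltr t, b) x z.
Proof. by case: b; [apply: openA|apply: openB]. Qed.

Let no_old b a z : a \in X -> ~ sg p (v b 0%N) (D b 0%N a) z.
Proof. by move=> /(D_0 b); rewrite in_fsetD => /andP[aN aE]; apply: open_start. Qed.

Let q_fun s x y z : sg q s x y -> sg q s x z -> y = z.
Proof.
have mixed b j a y' z' : (j < n)%N -> a \in X -> sg p (v b j) (D b j a) y' -> y' = z'.
  move=> jn aX h; have [hF _] := sgp_F h.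
  have j0 : j = 0%N.
    by apply/eqP; apply: contraTT hF; rewrite -lt0n => j0; rewrite D_F // j0.
  by rewrite j0 in h; case: (no_old aX h).
move=> /sgq[h|[b [j [a [jn aX -> -> ->]]]]] /sgq[h'|[b' [j' [a' [jn' a'X e e' ->]]]]].
- exact: (sg_fun gp) h h'.
- by rewrite e e' in h; apply: mixed h.
- by apply/esym; apply: mixed h'.
- have eb : b' = b by case: e.
  rewrite eb in e' *; have [jF|jF] := boolP (D b j a \in F).
    have j0 c a0 : (c < n)%N -> a0 \in X -> D b c a0 \in F -> c = 0%N.
      move=> cn a0X; apply: contraTeq; rewrite -lt0n => c0.
      by rewrite D_F // c0.
    have ej := j0 _ _ jn aX jF; rewrite e' in jF; have ej' := j0 _ _ jn' a'X jF.
    by rewrite ej ej' in e' *; rewrite (D_inj (leq0n _) aX a'X e').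
  have jm := D_mid (ltnW jn) aX jF; rewrite e' in jF.
  have jm' := D_mid (ltnW jn') a'X jF.
  have e1 : act (D b j a) 1 = D b j' a' by rewrite act1.
  by have := D_midinj jm jm' aX a'X e1; rewrite eqxx act1 => -[-> _ <-].
Qed.

Let pre_q : presystem q.
Proof.
split.
- by move=> l x y z; apply: (@q_fun (l, true)).
- by move=> l x y z; apply: (@q_fun (l, false)).
- move=> l x y w [h|[j [a [jn aX el -> ->]]]] wl; first by left; apply: (ps_eqv gp).
  rewrite el in wl *; right; exists j, (act a w).
  by rewrite X_act // !C_eqv ?(ltnW jn).
- by move=> l x xN; left; apply: (ps_nf gp).
- pose G := [fset C j a | j in iota 0 n.+1, a in X].
  have hG j a : (j <= n)%N -> a \in X -> C j a \in G.
    move=> jn aX; have jI : j \in iota 0 n.+1 by rewrite mem_iota add0n ltnS.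
    exact: in_imfset2.
  exists (F `|` G) => l x y [/F_supp[xF yF]|[j [a [jn aX _ -> ->]]]].
    by rewrite !inE xF yF.
  by split; rewrite inE hG ?orbT // ltnW.
Qed.

Let q_NF b j x y : x \in NF (Om i) -> sg q (v b j) x y -> y = x.
Proof. by move=> xN h; apply: (sg_fun pre_q h); apply: (sg_nf pre_q). Qed.

(** Move [A1] along all paths simultaneously, one letter at a time, while the points of [NF (Om i)]
    stay where they are. *)
Lemma join_reach : reach join A1 B1.
Proof.
pose g j x := if x \in NF (Om i) then x else C j x.
have gX j x : x \in A1 -> x \notin NF (Om i) -> g j x = C j x /\ x \in X.
  by move=> xA xN; rewrite /g (negPf xN) in_fsetD xN.
have C_NF j a : (j <= n)%N -> a \in X -> C j a \notin NF (Om i).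
  move=> jn aX; have [jF|jF] := boolP (D true j a \in F); last first.
    by apply: contra jF => /(proj2 iA1)/A1F.
  have [j0|j0] := posnP j; first by rewrite j0 C0 //; move: aX; rewrite in_fsetD => /andP[].
  have ej : j = n.
    by apply/eqP; apply: contraTT jF => jn'; rewrite D_F // j0 ltn_neqAle jn' jn.
  by rewrite ej; have := Cn_in aX; rewrite in_fsetD => /andP[].
have g_inj j : (j <= n)%N -> {in A1 &, injective (g j)}.
  move=> jn x y xA yA; have [xN|xN] := boolP (x \in NF (Om i));
    have [yN|yN] := boolP (y \in NF (Om i)).
  - by rewrite /g xN yN.
  - have [-> yX] := gX j y yA yN; rewrite /g xN => e.
    by move: (C_NF j y jn yX); rewrite -e xN.
  - have [-> xX] := gX j x xA xN; rewrite /g yN => e.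
    by move: (C_NF j x jn xX); rewrite e yN.
  - have [-> xX] := gX j x xA xN; have [-> yX] := gX j y yA yN.
    exact: (@D_inj true).
have card_g j : (j <= n)%N -> #|` [fset g j x | x in A1]| = k.
  by move=> jn; rewrite card_in_imfset //; apply: g_inj.
suff h j : (j <= n)%N -> reach q A1 [fset g j x | x in A1].
  have := h n (leqnn n); congr reach; apply: fset_eq_card; first by rewrite card_g.
  move=> _ /imfsetP[x /= xA ->]; have [xN|xN] := boolP (x \in NF (Om i)).
    by rewrite /g xN; apply: (proj2 iB1).
  by have [-> /Cn_in] := gX n x xA xN; rewrite in_fsetD => /andP[].
elim: j => [_|j IHj jn].
  have -> : [fset g 0%N x | x in A1] = A1; last exact: reach_refl.
  apply: fset_eq_card; first by rewrite card_g.
  move=> _ /imfsetP[x /= xA ->]; have [xN|xN] := boolP (x \in NF (Om i)).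
    by rewrite /g xN.
  by have [-> /C0->] := gX 0%N x xA xN.
apply: reach_trans (IHj (ltnW jn)) _; apply: (@reach_step _ (v true j)).
  by rewrite !card_g // ltnW.
move=> _ /imfsetP[x /= xA ->]; exists (g j.+1 x); first by rewrite in_imfset.
rewrite act1; have [xN|xN] := boolP (x \in NF (Om i)).
  by rewrite /g xN; apply: (sg_nf pre_q).
by have [-> xX] := gX j x xA xN; have [-> _] := gX j.+1 x xA xN; apply: (new_edge true).
Qed.

(** If no new edge is used, [unreadable] applies. Otherwise, from the first new edge on, the reading
    has to follow its path, since reversing direction would need an inverse letter. *)
Let reading (be : nat -> U) :
  (forall j, (j < n)%N -> q (ltr (u j)) (be j) (be j.+1)) ->
  be 0%N \in NF (Om i) /\ be n \in NF (Om i) \/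
  exists2 a, a \in X & be 0%N = a /\ be n = C n a.
Proof.
move=> hb; have [hp|] := pselect (forall j, (j < n)%N -> p (ltr (u j)) (be j) (be j.+1)).
  left; have b0 := unreadable hp; split=> //.
  suff h j : (j <= n)%N -> be j = be 0%N by rewrite h.
  elim: j => // j IHj jn; have e := IHj (ltnW jn).
  by rewrite -e; apply: (@q_NF true j); [rewrite e|exact: hb].
move=> /existsNP[j1 /not_implyP[j1n hj1]].
have ex : exists j, (j < n)%N && `[< ~ p (ltr (u j)) (be j) (be j.+1) >].
  by exists j1; rewrite j1n; apply/asboolP.
case: (ex_minnP ex) => j0 /andP[j0n /asboolP nj0] minj0.
have pre j : (j < j0)%N -> p (ltr (u j)) (be j) (be j.+1).
  move=> jj0; apply: contrapT => h; have := minj0 j.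
  rewrite (ltn_trans jj0 j0n) leqNgt jj0 => /(_ _)/negP; apply=> //.
  exact/asboolP.
have [//|[c [a [cn aX eu e0 e1]]]] := hb j0 j0n.
have follow (s : nat) : (c + s < n)%N -> (j0 + s < n)%N ->
    u (j0 + s)%N = u (c + s)%N /\ be (j0 + s).+1 = C (c + s).+1 a.
  elim: s => [|s IHs] cs js.
    by rewrite !addn0; split=> //; apply: (@eq_from_Tagged _ (fun j => T j) _ _ _ eu).
  rewrite !addnS in cs js *; have [_ eb] := IHs (ltnW cs) (ltnW js).
  have cm : (0 < (c + s).+1 < n)%N by rewrite cs.
  have := hb _ js; rewrite eb => h.
  have := @interior_step (ltr (u (j0 + s).+1), true) true (c + s).+1 a 1 _ cm aX.
  rewrite act1 => /(_ _ h)[_ [[[eu' ->]]|[]]] //.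
  by rewrite act1 (@eq_from_Tagged _ (fun j => T j) _ _ _ eu').
(* The reading meets edge [c] of the path while at position [j0] of the word. One of the two must be
   [0], since an old edge cannot end at an interior vertex; if the other were positive, the word
   would overlap itself and have a proper border. *)
have [c0|c_gt0] := posnP c.
  have [j00|j0_gt0] := posnP j0.
    right; exists a => //; rewrite -{1}j00 e0 c0 C0 //; split=> //.
    have lt_n1 : (n.-1 < n)%N by rewrite prednK.
    have := follow n.-1; rewrite c0 j00 !add0n prednK // => /(_ (leqnn _) (leqnn _))[_ ->] //.
  have [|s js us] := borderless (c := j0); first by rewrite j0_gt0.
  case: us; have cs : (c + s < n)%N by lia.
  by have [-> _] := follow s cs js; rewrite c0.
have j00 : j0 = 0%N.
  apply/eqP; rewrite -leqn0 leqNgt; apply/negP => j0_gt0.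
  have := pre j0.-1; rewrite prednK // => /(_ (leqnn _))/F_supp[_].
  by rewrite e0; apply/negP; apply: C_F => //; rewrite c_gt0.
have [|s js us] := borderless (c := c); first by rewrite c_gt0.
case: us; have js' : (j0 + s < n)%N by lia.
by have [<- _] := follow s js js'; rewrite j00.
Qed.

Let reading_start b (be : nat -> U) :
  (forall j, (j < n)%N -> sg q (v b j) (be j) (be j.+1)) -> be 0%N \in E b.
Proof.
have NFE b' : {subset NF (Om i) <= E b'} by case: (iE b').
case: b => hb.
  have [[h _]|[a aX [-> _]]] := reading hb; first exact: NFE.
  by move: aX; rewrite in_fsetD => /andP[].
have hb' j : (j < n)%N -> q (ltr (u j)) (be (n - j)%N) (be (n - j.+1)%N).
  move=> jn; have := hb (n - j.+1)%N; rewrite /sg /v /=.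
  have -> : (n - (n - j.+1).+1 = j)%N by lia.
  have -> : ((n - j.+1).+1 = n - j)%N by lia.
  by apply; lia.
have [[_]|[a aX [_]]] := reading (be := fun j => be (n - j)%N) hb'; rewrite /= subnn.
  exact: (NFE false).
by move=> ->; have := Cn_in aX; rewrite in_fsetD => /andP[].
Qed.

Let taut_q : no_finite_orbit q.
Proof.
move=> i' A; have [->|ne] := eqVneq i' i => hA; last first.
  apply: (good_taut gp) => t x xA; have [y yA xy] := hA t x xA; exists y => //.
  case: xy => // -[j [a [_ _ e _ _]]]; case/eqP: ne.
  exact: (congr1 tag e).
have [g gP] : {g : T i -> U -> U & forall t x, x \in A ->
    g t x \in A /\ q (ltr t) x (g t x)}.
  have /choice[g gP] : forall tx : T i * U, exists y, tx.2 \in A ->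
      y \in A /\ q (ltr tx.1) tx.2 y.
    move=> [t x] /=; have [xA|_] := boolP (x \in A); last by exists x.
    by have [y yA xy] := hA t x xA; exists y.
  by exists (fun t x => g (t, x)) => t x; apply: (gP (t, x)).
(* Reading [u] inside the invariant set puts each of its points off [NF (Om i)] into [X]. Applied to
   [x] and to its image under the first letter this is absurd, since that image is a fresh interior
   vertex; here [n_gt1] enters. *)
have inX x : x \in A -> x \notin NF (Om i) -> x \in X.
  move=> xA xN; pose be := fix be j := if j is m.+1 then g (u m) (be m) else x.
  have beA j : be j \in A by elim: j => //= j IHj; case: (gP (u j) _ IHj).
  have [j _|[]|[a aX [e _]]] := @reading be.
  - by case: (gP (u j) _ (beA j)).
  - by rewrite /= (negPf xN).
  - by move: e => /= ->.
move=> x xA; apply: contraT => xN; have xX := inX x xA xN.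
have [yA xy] := gP (u 0%N) x xA; set y := g _ _ in yA xy.
have /inX : y \notin NF (Om i).
  apply: contra xN => yN.
  by rewrite -(@ps_inj q pre_q _ _ _ _ (ps_nf pre_q (l := ltr (u 0%N)) yN) xy).
move=> /(_ yA); have := new_edge true n_gt0 xX; rewrite /D /= C0 // => xy'.
rewrite (ps_fun pre_q xy xy') in_fsetD => /andP[_ /A1F].
by rewrite (negPf (@C_F 1%N x n_gt1 xX)).
Qed.

(** * Infinite reduced walks in the join *)

Section Walk.
Variables (f : nat -> gT * (L * bool)) (A : nat -> {fset U}).
Hypotheses (cA : forall m, #|` A m| = k) (st : forall m, step q (f m) (A m) (A m.+1)).
Hypothesis red : forall m, reduced2 (f m) (f m.+1).

Let stb m y : y \in A m.+1 -> exists2 x, x \in A m & sg q (f m).2 (act x (f m).1) y.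
Proof. by move=> yA; have := step_back pre_q (etrans (cA _) (esym (cA _))) (@st m) yA. Qed.

Let not_cancel m s : (f m).2 = s -> (f m.+1).2 = sinv s -> (f m.+1).1 \in OmL s.1 -> False.
Proof.
by move=> e e' h; have /negP := red m; apply; rewrite e' e eqxx.
Qed.

Let new_step m : ~ step p (f m) (A m) (A m.+1) -> exists x b c a,
  [/\ x \in A m, (c < n)%N, a \in X, act x (f m).1 = D b c a & (f m).2 = v b c].
Proof.
move=> /existsNP[x /not_implyP[xA no]]; have [y yA /sgq[h|]] := st xA.
  by case: no; exists y.
by move=> [b [c [a [cn aX es ex _]]]]; exists x, b, c, a.
Qed.

(** Only one point is asked to set out on a path; [crossing] shows that the whole k-set then
    does. *)
Definition entry b m := exists x a,
  [/\ x \in A m, a \in X, act x (f m).1 = D b 0%N a & (f m).2 = v b 0%N].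

(** By reducedness, a point about to use edge [c] of a path has come along the preceding edges, so
    it entered the path [c] steps earlier. *)
Let back_to_entry c m x b a : (c < n)%N -> (c <= m)%N -> x \in A m -> a \in X ->
  act x (f m).1 = D b c a -> (f m).2 = v b c -> entry b (m - c)%N.
Proof.
elim: c m x a => [|c IHc] m x a cn cm xA aX ex es; first by rewrite subn0; exists x, a.
case: m cm xA ex es => // m cm xA ex es; rewrite subSS.
have [x' x'A h] := stb xA.
have ex' : x = act (D b c.+1 a) (f m.+1).1^-1 by rewrite -ex actVK.
have cm' : (0 < c.+1 < n)%N by [].
have := @interior_step (sinv (f m).2) b c.+1 a (f m.+1).1^-1 (act x' (f m).1) cm' aX.
rewrite -ex' => /(_ _)[|wO]; first exact/sg_sinv.
rewrite groupV in wO; case=> [[e _]|[/(can_inj sinvK) e ex2]].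
  exfalso; apply: (@not_cancel m (sinv (v b c.+1))); rewrite ?sinvK //.
  by rewrite -e sinvK.
by apply: (IHc m x' _ (ltnW cn)) ex2 e => //; apply: X_act; rewrite ?groupV.
Qed.

(** A point that has entered a path cannot turn back without a cancellation, so it dictates the next
    letters, and the group elements between them lie in [Om i]. *)
Let cross_follow b m c : entry b m -> (c < n)%N ->
  (exists x a, [/\ x \in A (m + c.+1), a \in X & x = D b c.+1 a]) /\
  (f (m + c)%N).2 = v b c /\ ((0 < c)%N -> (f (m + c)%N).1 \in Om i).
Proof.
move=> [x [a [xA aX ex es]]]; elim: c => [_|c IHc cn].
  rewrite addn0 addn1; split=> //; have [y yA h] := st xA.
  exists y, a; split=> //; rewrite ex es in h.
  exact: (sg_fun pre_q) h (new_edge b n_gt0 aX).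
have [[x' [a' [x'A a'X ex']]] [es' _]] := IHc (ltnW cn).
have [y yA] := st x'A; rewrite ex'.
have cm : (0 < c.+1 < n)%N by [].
move=> /(interior_step cm a'X)[wO [[e ey]|[e _]]].
  split; last by split.
  exists y, (act a' (f (m + c.+1)%N).1); rewrite addnS; split=> //; exact: X_act.
exfalso; apply: (@not_cancel (m + c)%N (v b c)); rewrite -?addnS //.
Qed.

(** One entering point dictates the letters for all. Every other point of [A m] then reads the same
    word, so [reading_start] puts it into [E b]; equal cardinalities give equality, and the whole
    set is carried to the other end. *)
Let crossing b m : entry b m -> [/\ actF (A m) (f m).1 = E b,
  A (m + n)%N = E (~~ b) & (f (m + n.-1)%N).2 = v b n.-1].
Proof.
move=> en; have fol c := @cross_follow b m c en.
have lets c : (c < n)%N -> (f (m + c)%N).2 = v b c by move=> /fol[_ []].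
have ths c : (0 < c)%N -> (c < n)%N -> (f (m + c)%N).1 \in Om i.
  by move=> c0 /fol[_ [_]]; apply.
have start : actF (A m) (f m).1 = E b.
  apply: fset_eq_card; first by rewrite card_actF // cA cE.
  move=> _ /imfsetP[x /= xA ->].
  (* The sequence [be] is the trajectory of [x] with the intermediate group elements removed. They
     lie in [Om i] and commute with the letters, so they can be collected in the single element
     [w]. *)
  suff path c : (c < n)%N -> exists be : nat -> U, [/\ be 0%N = act x (f m).1,
      forall j, (j <= c)%N -> sg q (v b j) (be j) (be j.+1) &
      exists2 w, w \in Om i & act (be c.+1) w \in A (m + c.+1)].
    have [|be [<- hb _]] := path n.-1; first by rewrite prednK.
    by apply: reading_start => j jn; apply: hb; rewrite -ltnS prednK.
  elim: c => [n0|c IHc cn].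
    have [y yA h] := st xA; exists (fun j => if j is 0%N then act x (f m).1 else y).
    rewrite addn1; split=> //; last by exists 1; rewrite ?group1 ?act1.
    by case=> // _; rewrite -(lets 0%N) // addn0.
  have [be [be0 hb [w wO bA]]] := IHc (ltnW cn).
  have [y yA h] := st bA; pose w' := w * (f (m + c.+1)%N).1.
  have w'O : w' \in Om i by rewrite groupM // ths.
  exists (fun j => if (j <= c.+1)%N then be j else act y w'^-1); split=> //.
  - move=> j jc1; have [->|jc] : j = c.+1 \/ (j <= c)%N by lia.
    2: by rewrite /= (leqW jc) ltnS jc; apply: hb.
    rewrite /= leqnn ltnn -(actVK act1 actM (be c.+1) w') -(lets _ cn).
    apply: (sg_eqv pre_q); first by rewrite groupV lets.
    by rewrite /w' actM.
  - by exists w' => //; rewrite ltnn actKV // addnS.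
have later c : (c < n)%N -> forall y, y \in A (m + c.+1)%N ->
    y \in NF (Om i) \/ exists2 a, a \in X & y = D b c.+1 a.
  elim: c => [_|c IHc cn] y; rewrite ?addn1 ?[in A _]addnS => /stb[x xA].
    rewrite -[m in (f m).2]addn0 lets // => h.
    have : act x (f m).1 \in E b by rewrite -start mem_actF.
    have [xN _|xN xE] := boolP (act x (f m).1 \in NF (Om i)).
      by left; rewrite (q_NF xN h).
    right; suff [a aX ea] : exists2 a, a \in X & act x (f m).1 = D b 0%N a.
      by exists a => //; rewrite ea in h; apply: (sg_fun pre_q h); apply: new_edge.
    case: (b) xE => xE; first by exists (act x (f m).1); rewrite /D ?C0 // in_fsetD xN.
    by rewrite /D subn0; have [|a aX <-] := @Cn_surj (act x (f m).1); [rewrite in_fsetD xN|exists a].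
  rewrite -addnS in xA *; rewrite lets // => h; have wO := ths _ (ltn0Sn c) cn.
  have [xN|[a aX ex]] := IHc (ltnW cn) x xA.
    by left; rewrite (q_NF _ h) NF_act.
  right; exists (act a (f (m + c.+1)%N).1); first exact: X_act.
  rewrite ex -D_eqv // in h; last exact: ltnW.
  by apply: (sg_fun pre_q h); apply: new_edge => //; apply: X_act.
have pn : (n.-1 < n)%N by rewrite prednK.
split=> //; last exact: lets.
apply: fset_eq_card; first by rewrite cA cE.
move=> y; have := later _ pn y; rewrite prednK // => h /h[/(proj2 (iE _))//|[a aX ->]].
by have := D_n b aX; rewrite in_fsetD => /andP[].
Qed.

(** Old edges alone carry no infinite reduced walk. As long as only they are used the walk stays in
    [F], so the first new edge starts at an end of a path. *)
Let next_entry m : {subset A m <= F} -> exists m' b, [/\ (m <= m')%N, entry b m'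
  & forall j, (m <= j < m')%N -> step p (f j) (A j) (A j.+1)].
Proof.
move=> mF; have ex : exists j, (m <= j)%N && `[< ~ step p (f j) (A j) (A j.+1) >].
  apply: contrapT => no.
  apply: (good_noinf gp (f := fun j => f (m + j)%N) (A := fun j => A (m + j)%N)) => // j.
    rewrite addnS; apply: contrapT => h; apply: no; exists (m + j)%N.
    by rewrite leq_addr; apply/asboolP.
  by rewrite addnS.
case: (ex_minnP ex) => m' /andP[mm' /asboolP nst] minm.
have sp j : (m <= j < m')%N -> step p (f j) (A j) (A j.+1).
  move=> /andP[mj jm']; apply: contrapT => h; have := minm j.
  by rewrite mj leqNgt jm' => /(_ _)/negP; apply=> //; apply/asboolP.
have AF j : (m <= j <= m')%N -> {subset A j <= F}.
  elim: j => [|j IHj] /andP[mj jm'].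
    by move: mj; rewrite leqn0 => /eqP <-.
  move: mj; rewrite leq_eqVlt => /orP[/eqP<- //|]; rewrite ltnS => mj.
  have sj := sp j; rewrite mj jm' in sj.
  by move=> y /(step_back gp (etrans (cA _) (esym (cA _))) (sj isT))[x _ /sgp_F[]].
have [x [b [c [a [xA cn aX ex' es]]]]] := new_step nst.
have c0 : c = 0%N.
  have := AF m' _ x xA; rewrite mm' leqnn => /(_ isT); rewrite -(F_act x (f m').1) ex'.
  by apply: contraTeq; rewrite -lt0n => c_gt0; rewrite D_F // c_gt0.
by exists m', b; split=> //; exists x, a; rewrite ex' es c0.
Qed.

Let walk_run a d : (forall j, (a <= j < a + d)%N -> step p (f j) (A j) (A j.+1)) ->
  run p [seq f j | j <- iota a d] (A a) (A (a + d)%N).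
Proof.
elim: d a => [|d IHd] a h; first by rewrite addn0.
exists (A a.+1); rewrite !cA; split=> //; first by apply: h; rewrite leqnn addnS ltnS leq_addr.
rewrite addnS -addSn; apply: IHd => j /andP[aj jd]; apply: h.
by rewrite (ltnW aj) -addSnnS.
Qed.

Let walk_reduced a d : sorted reduced2 [seq f j | j <- iota a d].
Proof.
case: d => //= d; elim: d a => //= d IHd a; rewrite red; exact: IHd.
Qed.

(* [B1] is not connected to [A1] by old edges, so the walk can only come back
   from [A1] to [A1], and such a closed old walk is empty. *)
Let no_backward m : ~ entry false m.
Proof.
move=> en; have [_ eA es] := crossing en; rewrite /= in eA.
have [|m' [b [le_m en' old]]] := next_entry (m := (m + n)%N); first by rewrite eA.
have [eA' _ _] := crossing en'.
have := @walk_run (m + n) (m' - (m + n)); rewrite subnKC // => /(_ old).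
rewrite eA -(actFK act1 actM (A m') (f m').1) eA' => rw.
case: b en' eA' rw => en' eA' rw; last first.
  by apply: unreach; apply: reach_trans (run_reach rw) (reach_sym (reach_act _ _ _)).
have := closedA1 (walk_reduced _ _) rw.
move=> /(congr1 size); rewrite size_map size_iota /= => e0.
(* With no old step in between, the walk turns round at [A1] by an element stabilising [A1], hence
   in [Om i], and the letters before and after it cancel. *)
have em : m' = (m + n)%N by lia.
have [x [a [_ _ _ es']]] := en'.
have th : (f m').1 \in Om i.
  by apply: (fintype.subsetP stabA1); apply/stabFP; rewrite -{1}eA -em eA'.
have mn : (m + n)%N = (m + n.-1).+1 by rewrite -addnS prednK.
apply: (not_cancel es); rewrite -?mn -?em // es' v_sinv ?prednK //.
by rewrite subnn.
Qed.

(** A forward crossing ends at [B1]. The next one is not backward, and if it were forward, old edges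
    would connect [B1] with a translate of [A1]. *)
Lemma join_no_walk : False.
Proof.
have [m [b en]] : exists m b, entry b m.
  (* A new edge is sought from time [n] on, which leaves room for going back to the entry. *)
  have [m /new_step[x [b [c [a [xA cn aX ex es]]]]]] :
      exists m, ~ step p (f (n + m)%N) (A (n + m)%N) (A (n + m).+1).
    apply: contrapT => no.
    apply: (good_noinf gp (f := fun j => f (n + j)%N) (A := fun j => A (n + j)%N)) => // j.
      by rewrite addnS; apply: contrapT => h; apply: no; exists j.
    by rewrite addnS.
  exists (n + m - c)%N, b; apply: back_to_entry xA aX ex es => //.
  by rewrite (leq_trans (ltnW cn)) // leq_addr.
case: b en => [en|]; last exact: no_backward.
have [_ eA _] := crossing en; rewrite /= in eA.
have [|m' [b [le_m en' old]]] := next_entry (m := (m + n)%N); first by rewrite eA.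
case: b en' => [en'|]; last exact: no_backward.
have [eA' _ _] := crossing en'.
have := @walk_run (m + n) (m' - (m + n)); rewrite subnKC // => /(_ old).
rewrite eA -(actFK act1 actM (A m') (f m').1) eA' => rw.
apply: unreach; apply: reach_trans (reach_act _ _ (f m').1^-1) _.
exact: reach_sym (run_reach rw).
Qed.

End Walk.

Lemma join_good : good join.
Proof.
split; [exact: pre_q| |exact: taut_q].
move=> f A cA st red; exact: (join_no_walk cA st red).
Qed.

End Join.

(** * The word and the fresh paths of a join *)

Lemma fresh_sequence (F : {fset U}) : exists e : nat -> U,
  (forall m w, act (e m) w \notin F) /\
  (forall m m' w, act (e m) w = e m' -> m = m' /\ w = 1).
Proof.
have /choice[fr frP] : forall G : {fset U}, exists y, y \notin V /\ forall w, act y w \notin G.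
  by move=> G; have [y yV yG] := fresh_point G; exists y.
pose S := fix S m := if m is m'.+1 then fr (S m') |` S m' else F.
pose e m := fr (S m).
have SF m x : x \in F -> x \in S m by elim: m => //= m IHm /IHm; rewrite !inE orbC => ->.
have Se m m' : (m < m')%N -> e m \in S m'.
  elim: m' => // m' IHm'; rewrite ltnS leq_eqVlt => /orP[/eqP->|/IHm' h].
    by rewrite /= !inE eqxx.
  by rewrite /= inE h orbT.
exists e; split=> [m w|m m' w ew].
  by apply: contra (proj2 (frP (S m)) w) => /(SF m).
case: (ltngtP m m') => [lt|lt|eqm].
- have := proj2 (frP (S m')) w^-1; rewrite -/(e m') -ew (actVK act1 actM).
  by rewrite Se.
- by have := proj2 (frP (S m)) w; rewrite -/(e m) ew Se.
- by split=> //; rewrite -eqm in ew; apply: V_free (proj1 (frP (S m))) ew.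
Qed.

Hypothesis U_count : exists h : U -> nat, injective h.

(* The word [t0 ... t0 r t1] has no proper border, since a border would force
   all its letters to be [t0]. *)
Lemma borderless_unreadable_word p i : good p -> exists n (u : nat -> T i), [/\ (1 < n)%N,
  forall c, (0 < c < n)%N -> exists2 s, (c + s < n)%N & u (c + s)%N <> u s
  & forall be : nat -> U, (forall j, (j < n)%N -> p (ltr (u j)) (be j) (be j.+1)) ->
      be 0%N \in NF (Om i)].
Proof.
move=> gp; have [r hr] := unreadable_word i gp.
have [t0 _] := a_letter i; have [t1 t10] := other_letter t0.
(* There are [rho + 1] initial letters [t0], one more than the length of [r]. A shift by more than
   [rho] would match the final [t1] with one of them; a shorter shift propagates [t0] through the
   word. *)
pose rho := size r; pose n := (rho + rho).+2.
pose u j := if (j <= rho)%N then t0 else if (j < n.-1)%N then nth t0 r (j - rho.+1) else t1.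
exists n, u; split=> // [c /andP[c0 cn]|be hb].
  apply: contrapT => no; have {}no m : (c + m < n)%N -> u (c + m)%N = u m.
    by move=> cm; apply: contrapT => ne; apply: no; exists m.
  have un : u n.-1 = t1 by rewrite /u ltnn /n /=; case: ifP => //; lia.
  have t01 : t1 <> t0 by apply/eqP.
  have cr : (c <= rho)%N.
    rewrite leqNgt; apply/negP => cr; have := no (n.-1 - c)%N.
    rewrite subnKC; last by rewrite /n /= in cn *; lia.
    rewrite un /u; case: ifP => [_ h|]; last by rewrite /n /= in cn *; lia.
    by apply: t01; apply: h.
  have allt j : (j < n)%N -> u j = t0.
    elim/ltn_ind: j => j IHj jn; have [jc|cj] := ltnP j c.
      by rewrite /u (leq_trans (ltnW jc) cr).
    by rewrite -(subnKC cj) no ?subnKC //; apply: IHj; lia.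
  by apply: t01; rewrite -un allt.
have rd (w : seq (T i)) a : (forall j, (j < size w)%N ->
    p (ltr (nth t0 w j)) (be (a + j)%N) (be (a + j).+1)) -> read p true w (be a) (be (a + size w)%N).
  elim: w a => [|t w IHw] a h; first by rewrite addn0.
  exists (be a.+1); first by have := h 0%N isT; rewrite addn0.
  by rewrite addnS -addSn; apply: IHw => j jw; rewrite addSn -addnS; apply: (h j.+1).
have bN : be rho.+1 \in NF (Om i).
  apply: (hr _ _ (rd r rho.+1 _)) => j jr; have := hb (rho.+1 + j)%N.
  have -> : u (rho.+1 + j)%N = nth t0 r j.
    rewrite /u ifN; last by lia.
    by rewrite ifT; [rewrite addnC addnK|rewrite /n /=; rewrite -/rho in jr; lia].
  by apply; rewrite -/rho in jr; rewrite /n; lia.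
suff h j : (j <= rho.+1)%N -> be (rho.+1 - j)%N \in NF (Om i) by have := h _ (leqnn _); rewrite subnn.
elim: j => [_|j IHj jr]; first by rewrite subn0.
have e : (rho.+1 - j)%N = (rho.+1 - j.+1).+1 by lia.
apply: (@sg_NF p true i (u (rho.+1 - j.+1)%N) _ (be (rho.+1 - j)%N) gp); last exact: IHj (ltnW jr).
by rewrite e; apply: hb; rewrite /n; lia.
Qed.

(** Off [NF (Om i)] the sets have equal size and free actions of [Om i], so an equivariant bijection
    supplies the ends of the paths. *)
Lemma chain_exists i (A1 B1 F : {fset U}) n : #|` A1| = k -> #|` B1| = k ->
  inv_set i A1 -> inv_set i B1 -> (0 < n)%N -> exists C : nat -> U -> U,
  let X := A1 `\` NF (Om i) in
  [/\ forall a, a \in X -> C 0%N a = a,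
      [/\ forall a, a \in X -> C n a \in B1 `\` NF (Om i), {in X &, injective (C n)}
        & forall y, y \in B1 `\` NF (Om i) -> exists2 a, a \in X & C n a = y],
      forall j a w, (j <= n)%N -> a \in X -> w \in Om i -> C j (act a w) = act (C j a) w,
      forall j a, (0 < j < n)%N -> a \in X -> C j a \notin F
    & forall j j' a a' w, (0 < j < n)%N -> (0 < j' < n)%N -> a \in X -> a' \in X ->
      act (C j a) w = C j' a' -> [/\ j = j', w \in Om i & act a w = a']].
Proof.
move=> cA cB [iA nA] [iB nB] n0; have [e [eF e_inj]] := fresh_sequence F.
have [h h_inj] := U_count.
have fA := free_inv_NF iA; have fB := free_inv_NF iB.
have [|f [f_in f_eqv f_inj f_surj]] := equivariant_bijection act1 actM fA fB.
  by rewrite !cardfsDS ?cA ?cB //; apply/fsubsetP.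
pose orep := orbit_rep act (Om i); pose oco := orbit_coord act (Om i).
(* Each pair of a position and an [Om i]-orbit receives its own fresh orbit, in which the coordinate
   of [a] selects the point; this makes the paths equivariant and disjoint. *)
pose N (j : nat) a := choice.pickle (j, h (orep a)).
exists (fun j a => if j == 0%N then a else if j == n then f a else act (e (N j a)) (oco a)).
have n0' : (n == 0)%N = false by case: (n) n0.
rewrite /= n0' eqxx; split=> //.
- move=> j a w jn aX wO; case: eqP => // _; case: eqP => [_|_]; first exact: f_eqv.
  by rewrite /N /orep /oco orbit_rep_act // (orbit_coord_act act1 actM fA) // actM.
- move=> j a /andP[j0 jn] aX; rewrite gtn_eqF // ltn_eqF //.
- move=> j j' a a' w /andP[j0 jn] /andP[j'0 jn'] aX a'X.
  rewrite (gtn_eqF j0) (gtn_eqF j'0) (ltn_eqF jn) (ltn_eqF jn') => ew.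
  have {ew} : act (e (N j a)) (oco a * w * (oco a')^-1) = e (N j' a').
    by rewrite !actM ew actVK.
  move=> /e_inj[/(pcan_inj choice.pickleK)[-> /h_inj er] /eqP ec].
  rewrite -eq_mulgV1 in ec; move/eqP: ec => ec.
  have [cW ea] := orbit_coordP act1 actM (Om i) a.
  have [cW' ea'] := orbit_coordP act1 actM (Om i) a'.
  split=> //; first by rewrite -(mulKg (oco a) w) ec groupM ?groupV.
  rewrite -{1}ea -actM -/(oco a) ec -{2}ea' -/(orep a) er //.
Qed.

(** * Connecting every k-set to [V] *)

Hypothesis robustF : forall (W : {group gT}) (Y : {fset U}), Y != fset0 ->
  (forall x w, x \in Y -> w \in W -> act x w \in Y) -> {subset Y <= NF W} ->
  ~~ (#|W| %| #|` Y|)%N.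
Hypothesis docile_conj : forall W : {group gT}, (exists2 v, v \in V & v \notin NF W) ->
  exists i h, (W :^ h)%G = Om i.

(** With [W] the stabiliser of [B], the sets [B] and [V] have the same size, so the size of [NF W]
    minus [B] is the difference of the sizes of [B] and [V] off [NF W]. There [W] acts freely, so
    its order divides this difference and robustness makes it zero. *)
Lemma robust_stab B : #|` B| = k -> B <> V ->
  {subset NF (stabF B) <= B} /\ exists2 v, v \in V & v \notin NF (stabF B).
Proof.
move=> cB BV; pose W := stabF_group act1 actM B.
have Binv x w : x \in B -> w \in W -> act x w \in B.
  by move=> xB wW; rewrite (stabF_act act1 actM _ wW).
have fB := free_inv_NF Binv.
have fV := free_inv_NF (fun x w (xV : x \in V) (_ : w \in W) => V_inv w xV).
have NFV : NF W `<=` V by apply/fsubsetP => x /NF_V.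
have cI : (#|` NF W `&` B| <= #|` NF W|)%N by rewrite fsubset_leq_card // fsubsetIl.
have NFB : {subset NF W <= B}.
  have [/eqP|Y0] := eqVneq (NF W `\` B) fset0.
    by rewrite fsetD_eq0 => /fsubsetP.
  have /negP[] : ~~ (#|W| %| #|` NF W `\` B|)%N.
    apply: robustF => //; last by move=> x; rewrite in_fsetD => /andP[].
    move=> x w; rewrite !in_fsetD => /andP[xB xN] wW.
    by rewrite NF_act // xN andbT (stabF_act act1 actM _ wW).
  have -> : #|` NF W `\` B| = (#|` B `\` NF W| - #|` V `\` NF W|)%N.
    rewrite !cardfsD (fsetIidPr NFV) cB V_card fsetIC.
    have : (#|` NF W| <= k)%N by rewrite -V_card fsubset_leq_card.
    rewrite fsetIC in cI; rewrite fsetIC; lia.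
  rewrite (card_free_inv act1 actM fB) (card_free_inv act1 actM fV).
  by apply: dvdn_sub; apply: dvdn_mull.
split=> //; apply: contrapT => no; apply: BV; apply/esym.
apply: fset_eq_card; first by rewrite cB.
move=> v vV; apply: NFB; apply: contrapT => /negP vN; apply: no; by exists v.
Qed.

Lemma inv_set_V i : inv_set i V.
Proof. by split=> [x w xV _|x /NF_V //]; apply: V_inv. Qed.

Lemma connect p A : good p -> #|` A| = k ->
  exists q, [/\ good q, forall l x y, p l x y -> q l x y & reach q A V].
Proof.
move=> gp cA; apply: contrapT => no.
pose P m := `[< exists q B, [/\ good q, forall l x y, p l x y -> q l x y, reach q A B
                              & #|stabF B| = m] >].
have exP : exists m, P m by exists #|stabF A|; apply/asboolP; exists p, A; split=> //; apply: reach_refl.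
have ubP m : P m -> (m <= #|gT|)%N by move=> /asboolP[q [B [_ _ _ <-]]]; apply: max_card.
(* A set with stabiliser of maximal order is chosen over all good extensions at once, so that
   maximality persists in further extensions of [q0]. *)
case: (ex_maxnP exP ubP) => m /asboolP[q0 [B0 [gq0 pq0 r0 cm]]] maxm.
have maxst q B : good q -> (forall l x y, q0 l x y -> q l x y) -> reach q A B ->
    (#|stabF B| <= m)%N.
  move=> gq qq r; apply: maxm; apply/asboolP; exists q, B; split=> // l x y /pq0; exact: qq.
have notV q : good q -> (forall l x y, q0 l x y -> q l x y) -> ~ reach q A V.
  by move=> gq qq r; apply: no; exists q; split=> // l x y /pq0; apply: qq.
have V_actF w : actF V w = V.
  by apply: fset_eq_card; [rewrite card_actF|move=> x; rewrite actFP // => /(V_inv w); rewrite actKV].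
have cB0 : #|` B0| = k by rewrite -(reach_card r0).
have B0V : B0 <> V by move=> e; apply: (notV q0) => //; rewrite -e.
have [_ [v vV vN]] := robust_stab cB0 B0V.
have [i [h eW]] := docile_conj (ex_intro2 _ _ v vV vN : exists2 v, v \in V & v \notin NF (stabF_group act1 actM B0)).
pose B := actF B0 h.
have cB : #|` B| = k by rewrite card_actF.
have BV : B <> V by move=> e; apply: B0V; rewrite -(actFK act1 actM B0 h) -/B e V_actF.
have stB : stabF B = Om i.
  rewrite -eW /=; apply/setP => w; rewrite (stabF_actF act1 actM) mem_conjg.
  by rewrite conjgE invgK mulgA.
have [nB _] := robust_stab cB BV; rewrite stB in nB.
have iB : inv_set i B.
  by split=> // x w xB wO; rewrite (@stabF_act _ _ _ act1 actM) // stB.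
have rB : reach q0 A B by apply: reach_trans r0 (reach_act _ _ _).
have cOm : #|Om i| = m by rewrite -stB card_stabF_actF.
(* First the letters are cleared from a set [A1] connected to [B], then the inverse letters from a
   set [B1] connected to [V]; the parameter [A1] of the second call protects the first property. *)
have [q1 [A1 [gq1 [q01 _] rA1 iA1 opA]]] := open_set true fset0 gq0 iB.
have [q2 [B1 [gq2 [q12 newq2] rB1 iB1 opB]]] := open_set false A1 gq1 (inv_set_V i).
have q02 l x y : q0 l x y -> q2 l x y by move=> /q01/q12.
have rA1' : reach q2 A A1.
  by apply: reach_trans (reach_mono q02 rB) (reach_mono q12 rA1).
have cA1 : #|` A1| = k by rewrite -(reach_card rA1).
have cB1 : #|` B1| = k by rewrite -(reach_card rB1).
have subst : Om i \subset stabF A1 by apply: (invariant_stabF act1 actM); case: iA1.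
(* Moving [B] to [A1] could only have enlarged the stabiliser, which maximality forbids. *)
have eqst : stabF A1 = Om i.
  by apply/eqP; rewrite eq_sym eqEcard subst cOm; apply: maxst rA1'.
have opA2 (t : T i) x z : x \in A1 -> x \notin NF (Om i) -> ~ sg q2 (ltr t, true) x z.
  move=> xA xN xz; have [h1|] := newq2 (ltr t) z x xz; last by rewrite xA.
  exact: (opA t x z xA xN h1).
have unr : ~ reach q2 A1 B1.
  move=> r; apply: (notV q2) => //; apply: reach_trans rA1' (reach_trans r _).
  exact: reach_sym rB1.
have closed w g : sorted reduced2 w -> run q2 w A1 (actF A1 g) -> w = [::].
  move=> sw; apply: (closed_run_nil gq2 (good_noinf gq2) sw cA1).
  move=> B' r; rewrite eqst cOm; exact: (maxst q2 B' gq2 q02 (reach_trans rA1' r)).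
have [n [u [n1 bl ur]]] := borderless_unreadable_word i gq2.
have [S hS] := ps_fin gq2; pose F := satF act (S `|` A1 `|` B1).
have [C /= [C0 [Cn1 Cn2 Cn3] C_eqv C_F C_inj]] := chain_exists F cA1 cB1 iA1 iB1 (ltnW n1).
have FF x : x \in S `|` A1 `|` B1 -> x \in F by apply: satF_sub.
have F_act x w : (act x w \in F) = (x \in F) by rewrite (satF_act act1 actM).
have F_supp l x y : q2 l x y -> x \in F /\ y \in F.
  by move=> /hS[xS yS]; split; apply: FF; rewrite !inE ?xS ?yS.
have A1F : {subset A1 <= F} by move=> x xA; apply: FF; rewrite !inE xA orbT.
have B1F : {subset B1 <= F} by move=> x xA; apply: FF; rewrite !inE xA !orbT.
have stA : stabF A1 \subset Om i by rewrite eqst.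
pose q := join q2 A1 n u C.
have gq : good q.
  exact: (join_good gq2 cA1 cB1 iA1 iB1 opA2 opB unr stA closed n1 bl ur
    F_act F_supp A1F B1F C0 Cn1 Cn2 Cn3 C_eqv C_F C_inj).
have qq l x y : q2 l x y -> q l x y by left.
apply: (notV q gq) => [l x y /q02/qq//|].
apply: reach_trans (reach_mono qq rA1') _.
apply: reach_trans (reach_sym (reach_mono qq rB1)).
exact: (join_reach u gq2 cA1 cB1 iA1 iB1 opA2 opB stA n1 F_supp A1F B1F C0 Cn1 Cn2
  C_eqv C_F C_inj).
Qed.

(** * Total letter maps as limits of approximations *)

Definition eval (si : L * bool -> U -> U) (w : seq (gT * (L * bool))) x :=
  foldl (fun y a => si a.2 (act y a.1)) x w.

Definition graph (si : L * bool -> U -> U) : system := fun l x y => si (l, true) x = y.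

(** These are the conditions for a taut action, stated for letters. Sharpness is asked for
    cyclically reduced words only; every other element of the completion is conjugate to one of
    these or to a base element. *)
Record full (si : L * bool -> U -> U) : Prop := Full {
  full_inv : forall s x, si (sinv s) (si s x) = x;
  full_eqv : forall s x w, w \in OmL s.1 -> si s (act x w) = act (si s x) w;
  full_nf : forall s x, x \in NF (OmL s.1) -> si s x = x;
  full_sharp : forall w (X : {fset U}), w != [::] -> path.cycle reduced2 w ->
    #|` X| = k -> ~ (forall x, x \in X -> eval si w x = x);
  full_taut : forall i (A : {fset U}),
    (forall (t : T i) x, x \in A -> si (ltr t, true) x \in A) -> {subset A <= NF (Om i)} }.

Section Limit.
Variable P : nat -> system.
Hypotheses (gP : forall n, good (P n)) (P_le : forall n l x y, P n l x y -> P n.+1 l x y).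
Hypothesis P_total : forall s x, exists n z, sg (P n) s x z.

Let P_mono m n l x y : (m <= n)%N -> P m l x y -> P n l x y.
Proof.
by elim: n => [|n IHn]; [case: m|rewrite leq_eqVlt => /orP[/eqP->//|/IHn h /h/P_le]].
Qed.

Let sgP_mono m n s x y : (m <= n)%N -> sg (P m) s x y -> sg (P n) s x y.
Proof. by move=> mn; apply: sg_mono => l u v; apply: P_mono. Qed.

Let stage (S : eqType) (Q : nat -> S -> Prop) (r : seq S) :
  (forall m n x, (m <= n)%N -> Q m x -> Q n x) ->
  (forall x, x \in r -> exists n, Q n x) -> exists n, forall x, x \in r -> Q n x.
Proof.
move=> Qm; elim: r => [|x r IHr] h; first by exists 0%N.
have [|n hn] := IHr; first by move=> y yr; apply: h; rewrite inE yr orbT.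
have [m hm] := h x (mem_head x r); exists (maxn m n) => y.
rewrite inE => /orP[/eqP->|/hn hy]; last exact: Qm (leq_maxr m n) hy.
exact: Qm (leq_maxl m n) hm.
Qed.

(** Each failure of sharpness or tautness involves finitely many points and letters, so [stage]
    would exhibit it in one of the good systems [P n]. *)
Lemma limit_full : exists si, full si /\ forall n s x y, sg (P n) s x y -> si s x = y.
Proof.
have /choice[si0 si0P] : forall sx : (L * bool) * U, exists z, exists n, sg (P n) sx.1 sx.2 z.
  by move=> [s x]; have [n [z h]] := P_total s x; exists z, n.
pose si s x := si0 (s, x).
have siP s x : exists n, sg (P n) s x (si s x) := si0P (s, x).
have siE n s x y : sg (P n) s x y -> si s x = y.
  move=> h; have [m h'] := siP s x; apply: (sg_fun (gP (maxn m n))).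
    by apply: sgP_mono h'; apply: leq_maxl.
  by apply: sgP_mono h; apply: leq_maxr.
have stageA s (X : {fset U}) : exists n, forall x, x \in X -> sg (P n) s x (si s x).
  apply: (@stage _ (fun n x => sg (P n) s x (si s x)) (enum_fset X)) => [m n x mn|x _].
    exact: sgP_mono.
  exact: siP.
have si_inv s x : si (sinv s) (si s x) = x.
  by have [n h] := siP s x; apply: (siE n); apply/sg_sinv.
have si_inj s : injective (si s) := can_inj (si_inv s).
have evP w (X : {fset U}) : exists n, run (P n) w X [fset eval si w x | x in X].
  elim: w X => [|a w IHw] X.
    by exists 0%N; apply/fsetP => x; rewrite imfset_id.
  have [n hn] := IHw [fset si a.2 (act x a.1) | x in X].
  have [m hm] := stageA a.2 (actF X a.1).
  exists (maxn m n), [fset si a.2 (act x a.1) | x in X]; split.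
  - by rewrite card_imfset // => x y /si_inj/(act_inj act1 actM).
  - move=> x xX; exists (si a.2 (act x a.1)); first by apply/imfsetP; exists x.
    by apply: sgP_mono (hm _ _); [apply: leq_maxl|rewrite mem_actF].
  - have rm w' A B : run (P n) w' A B -> run (P (maxn m n)) w' A B.
      elim: w' A => //= b w' IHw' A [C [eC st /IHw' r]]; exists C; split=> //.
      by apply: step_mono st => l x y; apply: P_mono; apply: leq_maxr.
    apply: rm; move: hn; congr run; apply/fsetP => z; apply/imfsetP/imfsetP.
      by move=> [_ /imfsetP[x /= xX ->] ->]; exists x.
    by move=> [x /= xX ->]; exists (si a.2 (act x a.1)) => //=; apply/imfsetP; exists x.
exists si; split; last by [].
split=> //.
- move=> s x w wO; have [n h] := siP s x; apply: (siE n).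
  exact: (sg_eqv (gP n)).
- by move=> s x xN; apply: (siE 0%N); apply: (sg_nf (gP 0%N)).
- move=> w X w0 cw cX h; have [n] := evP w X.
  suff -> : [fset eval si w x | x in X] = X by apply: (no_closed_run (good_noinf (gP n))).
  apply: fset_eq_card; last by move=> _ /imfsetP[x /= xX ->]; rewrite h.
  rewrite card_imfset //; elim: (w) => [|a w' IHw] x y //= /IHw.
  by move=> /si_inj/(act_inj act1 actM).
- move=> i A hA; have [n hn] : exists n, forall tx, tx \in [seq (t, x) | t <- enum (T i), x <- A] ->
      sg (P n) (ltr tx.1, true) tx.2 (si (ltr tx.1, true) tx.2).
    apply: (@stage _ (fun n tx => sg (P n) (ltr tx.1, true) tx.2 (si (ltr tx.1, true) tx.2))).
      by move=> m n x mn; apply: sgP_mono.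
    by move=> tx _; apply: siP.
  apply: (good_taut (gP n)) => t x xA; exists (si (ltr t, true) x); first exact: hA.
  by apply: (hn (t, x)); apply/allpairsP; exists (t, x); rewrite mem_enum.
Qed.

End Limit.

(** * A binary tree of generic actions *)

Hypothesis k_gt0 : (0 < k)%N.

(** The trivial subgroup is docile, so there is at least one representative and hence a letter. *)
Lemma group_index : I.
Proof.
suff : exists i : I, true by move=> /cid[].
have [v vV] : exists v, v \in V.
  by apply/fset0Pn; rewrite -cardfs_gt0 V_card.
have [|i [h _]] := @docile_conj 1%G; last by exists i.
exists v => //; apply/negP => /NFP[w [+ w1 _]].
by rewrite inE => /eqP.
Qed.

(** A letter undefined at [x] can be given two different fresh values there; the second is chosen to
    avoid the first. *)
Lemma split_good p : good p -> exists q : bool -> system, [/\ forall b, good (q b),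
  forall b l x y, p l x y -> q b l x y &
  exists l x y z, [/\ y <> z, q true l x y & q false l x z]].
Proof.
move=> gp; have [S hS] := ps_fin gp; have [x xS] := U_inf S.
have [t _] := a_letter group_index.
have [q0 [gq0 [e0 _] [y xy] _]] := extend_point (ltr t, true) x fset0 gp.
have [q1 [gq1 [e1 n1] [z xz] _]] := extend_point (ltr t, true) x [fset y] gp.
exists (fun b => if b then q0 else q1); split; try by case.
exists (ltr t), x, y, z; split=> // eyz; have [/hS[xS' _]|] := n1 _ _ _ xz.
  by rewrite xS' in xS.
by rewrite -eyz inE eqxx.
Qed.

(** The countably many tasks are to define a signed letter at a point or to connect a k-set to [V].
    Two branches agree up to the first difference of [c] and [c'] and then assign different values
    to one letter at one point. *)
Lemma generic_actions p : good p -> exists si : (nat -> bool) -> L * bool -> U -> U,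
  [/\ forall c, full (si c),
      forall c l x y, p l x y -> si c (l, true) x = y,
      forall c (A : {fset U}), #|` A| = k -> reach (graph (si c)) A V
    & forall c c', c <> c' -> exists l x, si c (l, true) x <> si c' (l, true) x].
Proof.
move=> gp; have [h h_inj] := U_count.
pose task : Type := ((U * (L * bool)) + {fset U})%type.
pose enc (x : task) : nat := match x with
  | inl xs => choice.pickle (inl (h xs.1, xs.2) : (nat * (L * bool) + seq nat)%type)
  | inr A => choice.pickle (inr [seq h x | x <- enum_fset A] : (nat * (L * bool) + seq nat)%type)
  end.
have enc_inj : injective enc.
  move=> [[x s]|A] [[y s']|B] /(pcan_inj choice.pickleK) //= [].
    by move=> /h_inj -> ->.
  by move=> /(inj_map h_inj) e; congr inr; apply/fsetP => x; rewrite -[x \in A]/(x \in enum_fset A) e.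
pose done_task n q := forall x, enc x = n -> match x with
  | inl xs => exists z, sg q xs.2 xs.1 z
  | inr A => #|` A| = k -> reach q A V
  end.
pose G := {q : system | good q}.
have /choice[tk tkP] : forall nq : nat * G, exists q : G,
    (forall l x y, sval nq.2 l x y -> sval q l x y) /\ done_task nq.1 (sval q).
  move=> [n [q gq]] /=.
  have [[x ex]|no] := pselect (exists x, enc x = n); last first.
    by exists (exist _ q gq); split=> // x ex; case: no; exists x.
  suff [q' [gq' le h']] : exists q', [/\ good q', forall l x y, q l x y -> q' l x y & match x with
      | inl xs => exists z, sg q' xs.2 xs.1 z
      | inr A => #|` A| = k -> reach q' A V end].
    by exists (exist _ q' gq'); split=> // x'; rewrite -ex => /enc_inj ->.
  case: x {ex} => [[x s]|A].
    by have [q' [gq' [le _] h' _]] := extend_point s x fset0 gq; exists q'.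
  have [cA|cA] := pselect (#|` A| = k); last by exists q.
  by have [q' [gq' le r]] := connect gq cA; exists q'.
have /choice[sp spP] : forall q : G, exists q' : bool -> G,
    (forall b l x y, sval q l x y -> sval (q' b) l x y) /\
    exists l x y z, [/\ y <> z, sval (q' true) l x y & sval (q' false) l x z].
  move=> [q gq] /=; have [q' [gq' le cf]] := split_good gq.
  by exists (fun b => exist _ (q' b) (gq' b)).
(* Stage [m] first takes the branch [c m] of a splitting and then carries out task [m]. *)
pose P := fix P (c : nat -> bool) n : G :=
  if n is m.+1 then tk (m, sp (P c m) (c m)) else exist _ p gp.
have gP c n : good (sval (P c n)) by case: (P c n).
have P_le c n l x y : sval (P c n) l x y -> sval (P c n.+1) l x y.
  by move=> /(proj1 (spP _) (c n))/(proj1 (tkP (n, _))).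
have P_task c x : match x with
  | inl xs => exists z, sg (sval (P c (enc x).+1)) xs.2 xs.1 z
  | inr A => #|` A| = k -> reach (sval (P c (enc x).+1)) A V end.
  have [_ h1] := tkP (enc x, sp (P c (enc x)) (c (enc x))).
  by have := h1 x erefl; case: (x).
have /choice[si siP] : forall c, exists si, full si /\
    forall n s x y, sg (sval (P c n)) s x y -> si s x = y.
  move=> c; apply: limit_full => [n|n l x y|s x]; [exact: gP|exact: P_le|].
  by have [z] := P_task c (inl (x, s)); exists (enc (inl (x, s))).+1, z.
exists si; split.
- by move=> c; case: (siP c).
- by move=> c l x y; apply: (proj2 (siP c) 0%N (l, true)).
- move=> c A cA; have r := P_task c (inr A) cA.
  by apply: reach_mono r => l x y; apply: (proj2 (siP c) _ (l, true)).
- move=> c c' cc'.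
  have ex : exists n, c n != c' n.
    by apply: contrapT => no; apply: cc'; apply/funext => n; apply/eqP; apply: contra_notT no => ne; exists n.
  case: (ex_minnP ex) => n ne minn.
  have eqP : P c n = P c' n.
    have ltn_eq m : (m < n)%N -> c m = c' m.
      by move=> mn; apply/eqP; apply: contraTT mn => /minn; rewrite -leqNgt.
    have : (n <= n)%N by [].
    elim: {1 3 4}n => // m IHm mn; rewrite /= (ltn_eq m mn) IHm //; exact: ltnW.
  have [l [x [y [z [yz ty tz]]]]] := proj2 (spP (P c n)).
  have in_c d w : P d n = P c n -> sval (sp (P c n) (d n)) l x w -> si d (l, true) x = w.
    move=> eP hw; apply: (proj2 (siP d) n.+1 (l, true)); rewrite /sg /=.
    by apply: (proj1 (tkP (n, _))); rewrite /= eP.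
  exists l, x; case: (boolP (c n)) (ne) => cn; [rewrite (in_c c y)|rewrite (in_c c z)] => //;
    rewrite ?cn ?(negPf cn) //; case: (boolP (c' n)) => // cn' _.
    by rewrite (in_c c' z) ?(negPf cn') //; apply: nesym; exact: nesym.
  by rewrite (in_c c' y) ?cn' //; apply: nesym.
Qed.

(** * Restrictions of total letter maps to finite sets *)

Definition restriction (si : L * bool -> U -> U) (F : {fset U}) : system :=
  fun l x y => x \in F /\ si (l, true) x = y.

Lemma full_inj si s : full si -> injective (si s).
Proof. by move=> fs; apply: (can_inj (full_inv fs s)). Qed.

Lemma eval_inj si w : full si -> injective (eval si w).
Proof.
by move=> fs; elim: w => [|a w IHw] x y //= /IHw/(full_inj fs)/(act_inj act1 actM).
Qed.

Lemma eval_cat si w w' x : eval si (w ++ w') x = eval si w' (eval si w x).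
Proof. exact: foldl_cat. Qed.

Lemma sg_restriction si F s x y : full si ->
  sg (restriction si F) s x y -> si s x = y.
Proof.
move=> fs; case: s => l [] [_ //= e].
by rewrite -e; apply: (full_inv fs (l, true)).
Qed.

(** In a finite support an infinite walk must repeat its state, and the word read between two equal
    states is cyclically reduced and fixes k points, against [full_sharp]. *)
Lemma restriction_good si F : full si -> (forall x w, x \in F -> act x w \in F) ->
  {subset V <= F} -> good (restriction si F).
Proof.
move=> fs Finv VF; set p := restriction si F.
pose G := satF act (F `|` [fset si (l, true) x | l in enum {: L}, x in F]).
have siG l x : x \in F -> si (l, true) x \in G.
  move=> xF; apply: (satF_sub act1); rewrite inE; apply/orP; right.
  by apply/imfset2P; exists l; rewrite ?mem_enum //; exists x.
have pG l x y : p l x y -> x \in G /\ y \in G.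
  move=> [xF <-]; split; last exact: siG.
  by apply: (satF_sub act1); rewrite inE xF.
split.
- split.
  + by move=> l x y z [_ <-] [_ <-].
  + by move=> l x y z [_ <-] [_ /(full_inj fs)].
  + move=> l x y w [xF <-] wl; split; first exact: Finv.
    exact: (full_eqv fs (s := (l, true))).
  + move=> l x xN; split; first exact: VF (NF_V xN).
    exact: (full_nf fs (s := (l, true))).
  + by exists G.
- move=> f A cA st red.
  pose g n := eval si [seq f j | j <- iota 0 n].
  have gS n x : g n.+1 x = si (f n).2 (act (g n x) (f n).1).
    by rewrite /g -addn1 iotaD map_cat eval_cat.
  have gA n x : x \in A 0%N -> g n x \in A n.
    move=> xA; elim: n => // n IHn; have [y yA /(sg_restriction fs) e] := st n _ IHn.
    by rewrite gS e.
  have AG n x : x \in A n -> x \in G.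
    move=> xA; have [y _] := st n x xA; rewrite -(satF_act act1 actM _ x (f n).1).
    by case: (f n).2 => l [] /pG[].
  have gA_surj n y : y \in A n -> exists2 x, x \in A 0%N & g n x = y.
    move=> yA; apply: (@injective_rel_surj _ (fun x y => g n x = y) (A 0%N) (A n)) => //.
    + by move=> u v z <- /(eval_inj fs).
    + by rewrite !cA.
    + by move=> x xA; exists (g n x) => //; apply: gA.
  (* A state consists of the next step and the positions of all points of [A 0]. Equal positions
     make the word fix the points; equal steps make it cyclically reduced. *)
  pose state n : (gT * ({: L} * bool)) * {ffun A 0%N -> option G} :=
    (f n, [ffun x : A 0%N => insub (g n (val x))]).
  have [n [m [nm e]]] : exists n m, (n < m)%N /\ state n = state m.
    apply: contrapT => no.
    pose N := #|{: (gT * ({: L} * bool)) * {ffun A 0%N -> option G}}|.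
    have state_inj : injective (fun i : 'I_N.+1 => state i).
      move=> i j eij; apply/val_inj; case: (ltngtP i j) => // ij; case: no.
        by exists i, j.
      by exists j, i.
    by have := leq_card _ state_inj; rewrite card_ord ltnn.
  have ef : f n = f m := congr1 fst e.
  have eg x : x \in A 0%N -> g n x = g m x.
    move=> xA; have /ffunP/(_ [` xA]) := congr1 snd e; rewrite !ffunE /=.
    have [Gn Gm] := (AG _ _ (gA n x xA), AG _ _ (gA m x xA)).
    by rewrite (insubT (mem G) Gn) (insubT (mem G) Gm) => /Some_inj/(congr1 val); rewrite !SubK.
  pose w := [seq f j | j <- iota n (m - n)].
  have wE : w = f n :: [seq f j | j <- iota n.+1 (m - n).-1].
    by rewrite /w; case: (m - n)%N (subn_gt0 n m) => [|d _] //=; rewrite nm.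
  apply: (full_sharp fs (w := w) (X := A n)) => //; first by rewrite wE.
    have sorted_f a d : sorted reduced2 [seq f j | j <- iota a d].
      by case: d => //= d; elim: d a => //= d IHd a; rewrite red; exact: IHd.
    have := sorted_f n (m - n).+1; rewrite -addn1 iotaD map_cat -/w subnKC ?(ltnW nm) //.
    by rewrite wE /= cats1 ef.
  move=> y /gA_surj[x xA <-]; rewrite -eval_cat -map_cat -iotaD subnKC ?(ltnW nm) //.
  by rewrite -/(g m x) -eg.
- by move=> i A hA; apply: (full_taut fs) => t x /(hA t)[y yA [_ ->]].
Qed.

Lemma run_restriction si w (X : {fset U}) : full si -> exists F0 : {fset U}, forall F,
  {subset F0 <= F} -> run (restriction si F) w X [fset eval si w x | x in X].
Proof.
move=> fs; elim: w X => [|a w IHw] X.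
  by exists fset0 => F _; apply/fsetP => x; rewrite imfset_id.
have [F0 hF0] := IHw [fset si a.2 (act x a.1) | x in X].
exists (F0 `|` actF X a.1 `|` [fset si a.2 (act x a.1) | x in X]) => F sub.
exists [fset si a.2 (act x a.1) | x in X]; split.
- by rewrite card_imfset // => x y /(full_inj fs)/(act_inj act1 actM).
- move=> x xX; have yX : si a.2 (act x a.1) \in [fset si a.2 (act x a.1) | x in X].
    by apply/imfsetP; exists x.
  exists (si a.2 (act x a.1)) => //.
  have [F1 F2] : act x a.1 \in F /\ si a.2 (act x a.1) \in F.
    by split; apply: sub; rewrite !inE ?mem_actF // ?xX ?yX ?orbT.
  case: a.2 F1 F2 => l [] F1 F2; split=> //=.
  exact: (full_inv fs (l, false)).
- have := hF0 F; have sub0 : {subset F0 <= F} by move=> x xF; apply: sub; rewrite !inE xF.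
  move=> /(_ sub0); congr run; apply/fsetP => z; apply/imfsetP/imfsetP.
    by move=> [_ /imfsetP[x /= xX ->] ->]; exists x.
  by move=> [x /= xX ->]; exists (si a.2 (act x a.1)) => //=; apply/imfsetP; exists x.
Qed.

(** The whole of [gT] stabilises [V], so no stabiliser has larger order, and [closed_run_nil]
    applies to the walk of the word in a finite restriction. *)
Lemma full_stab_V si w : full si -> sorted reduced2 w ->
  (forall x, x \in V -> eval si w x \in V) -> w = [::].
Proof.
move=> fs sw hw; have [F0 hF0] := run_restriction w V fs.
pose F := satF act (V `|` F0).
have FF x : x \in V `|` F0 -> x \in F by apply: satF_sub.
have gF : good (restriction si F).
  apply: restriction_good => // [x u|x xV]; first by rewrite (satF_act act1 actM).
  by apply: FF; rewrite inE xV.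
apply: (closed_run_nil (B := V) (g := 1) gF (good_noinf gF) sw V_card).
  move=> B' _; have -> : stabF V = [set: gT] :> {set gT}.
    apply/setP => u; rewrite finset.in_setT; apply/stabFP; apply: fset_eq_card; first by rewrite card_actF.
    by move=> x; rewrite actFP // => /(V_inv u); rewrite actKV.
  by rewrite cardsT max_card.
rewrite actF1 //; have := hF0 F; set V' := imfset _ _ _.
have -> : V' = V.
  apply: fset_eq_card; last by move=> _ /imfsetP[x /= /hw xV ->].
  by rewrite card_imfset //; apply: eval_inj.
by apply=> x xF; apply: FF; rewrite inE xF orbT.
Qed.

Lemma eval_local si w x : full si -> exists F0 : {fset U}, forall ta, full ta ->
  (forall l y, y \in F0 -> ta (l, true) y = si (l, true) y) -> eval ta w x = eval si w x.
Proof.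
move=> fs; elim: w x => [|a w IHw] x; first by exists fset0.
have [F0 hF0] := IHw (si a.2 (act x a.1)).
(* The value of an inverse letter is controlled by the value of the letter at the image point, so
   both ends of the step are included. *)
exists (F0 `|` [fset act x a.1; si a.2 (act x a.1)]) => ta ft agree /=.
have -> : ta a.2 (act x a.1) = si a.2 (act x a.1).
  case: a.2 agree => l [] agree; first by apply: agree; rewrite !inE eqxx orbT.
  apply: (full_inj (s := (l, true)) ft); rewrite [LHS](full_inv ft (l, false)) agree.
    by rewrite [RHS](full_inv fs (l, false)).
  by rewrite !inE eqxx !orbT.
by apply: hF0 => // l y yF; apply: agree; rewrite inE yF.
Qed.

End Systems.

(** * Words in the completion *)

Section PresentedLift.
Variables (X : choiceType) (inv : X -> X) (R : seq X -> seq X -> Prop).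
Variables (H : groupType) (f : X -> H).

Definition word_value (u : seq X) : H := foldr (fun x h => f x * h) 1 u.

Lemma word_value_cat u v : word_value (u ++ v) = word_value u * word_value v.
Proof. by elim: u => [|x u IHu] /=; rewrite ?mul1g // IHu mulgA. Qed.

Hypothesis f_inv : forall x, f (inv x) = (f x)^-1.
Hypothesis f_rel : forall u v, R u v -> word_value u = word_value v.

Lemma word_value_cong u v : word_cong inv R u v -> word_value u = word_value v.
Proof.
elim=> {u v} [u v /f_rel//|x|x|//|u v _ ->//|v u w _ -> _ ->//|u u' v v' _ IHu _ IHv].
- by rewrite /= f_inv mulg1 mulgV.
- by rewrite /= f_inv mulg1 mulVg.
- by rewrite !word_value_cat IHu IHv.
Qed.

Definition presented_lift (a : presented inv R) : H := word_value (generic_quotient.repr a).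

Lemma presented_liftE u : presented_lift (word_class inv R u) = word_value u.
Proof. by apply: word_value_cong; apply: repr_word. Qed.

Lemma presented_liftM a b : presented_lift (a * b) = presented_lift a * presented_lift b.
Proof. by rewrite [LHS]presented_liftE word_value_cat. Qed.

End PresentedLift.

Lemma hom1 (G H : groupType) (h : G -> H) :
  (forall a b, h (a * b) = h a * h b) -> h 1 = 1.
Proof. by move=> hM; apply: (mulgI (h 1)); rewrite -hM !mulg1. Qed.

Lemma homV (G H : groupType) (h : G -> H) :
  (forall a b, h (a * b) = h a * h b) -> forall a, h a^-1 = (h a)^-1.
Proof. by move=> hM a; apply: (mulgI (h a)); rewrite -hM !mulgV hom1. Qed.

Section CompletionLift.
Variables (k : nat) (Theta : {group 'S_k}) (D : {set {group [subg Theta]}}).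
Variable T : rep_index D -> finType.
Local Notation G := (completion T).
Local Notation base := (completion_base T).

Definition letter_elt (l : letters T) : G :=
  nproj _ (free_prod_inr (subg_of Theta) (free_gen l)).

Lemma nprojM (H : groupType) (S : set H) x y : nproj S (x * y) = nproj S x * nproj S y.
Proof. by rewrite -nproj_mul. Qed.

Lemma completion_baseM v w : base (v * w) = base v * base w.
Proof.
rewrite -nprojM; congr nproj; rewrite [RHS]word_classM; apply/word_classP.
apply: cong_sym; apply: cong_rel; exact: free_prod_Ml.
Qed.

Lemma completion_base1 : base 1 = 1.
Proof. exact: (hom1 completion_baseM). Qed.

Lemma letter_elt_comm (l : letters T) w : w \in val (tag l) ->
  base w * letter_elt l = letter_elt l * base w.
Proof.
move=> wl; apply/commgP; apply/eqP.
have V x : nproj (completion_relators (T := T)) x^-1 = (nproj _ x)^-1 := homV (@nprojM _ _) x.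
have <- : nproj (completion_relators (T := T)) [~ free_prod_inl _ w, free_prod_inr _ (free_gen l)] =
    [~ base w, letter_elt l].
  by rewrite /commg /conjg !nprojM !V.
have -> : (1 : G) = nproj _ 1 by rewrite (hom1 (@nprojM _ _)).
apply/nprojP; rewrite invg1 mulg1 => N [_ SN]; apply: SN.
by case: l wl => W t wl; rewrite /completion_relators /mkset; exists W, w, t.
Qed.

Definition signed_elt (s : letters T * bool) : G :=
  if s.2 then letter_elt s.1 else (letter_elt s.1)^-1.

Lemma signed_elt_comm (s : letters T * bool) w : w \in val (tag s.1) ->
  base w * signed_elt s = signed_elt s * base w.
Proof.
rewrite /signed_elt => wl; case: s.2; first exact: letter_elt_comm.
apply: (mulgI (letter_elt s.1)); apply: (mulIg (letter_elt s.1)).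
by rewrite !mulgA mulgV mul1g mulgKV letter_elt_comm //.
Qed.

Lemma signed_elt_sinv (s : letters T * bool) : signed_elt (sinv s) = (signed_elt s)^-1.
Proof. by rewrite /signed_elt /sinv /=; case: s.2; rewrite ?invgK. Qed.

(** The universal property of the completion, obtained by extending successively to the free group,
    the free product and the quotient: the kernel of [h2] is normal and contains the relators. *)
Lemma completion_lift (H : groupType) (phi : [subg Theta] -> H) (psi : letters T -> H) :
  (forall v w, phi (v * w) = phi v * phi w) ->
  (forall (l : letters T) w, w \in val (tag l) -> phi w * psi l = psi l * phi w) ->
  exists h : G -> H, [/\ forall a b, h (a * b) = h a * h b,
    forall w, h (base w) = phi w & forall l, h (letter_elt l) = psi l].
Proof.
move=> phiM comm.
pose f1 (x : letters T * bool) := if x.2 then psi x.1 else (psi x.1)^-1.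
have f1V x : f1 (x.1, ~~ x.2) = (f1 x)^-1 by rewrite /f1 /=; case: x.2; rewrite ?invgK.
pose h1 : free_group (letters T) -> H := presented_lift f1.
have h1M : forall a b, h1 (a * b) = h1 a * h1 b by move=> a b; exact: presented_liftM.
pose f2 x := match x with inl a => phi a | inr b => h1 b end.
have f2V x : f2 (free_prod_inv x) = (f2 x)^-1.
  by case: x => [a|b]; [exact: homV|exact: homV].
have f2R u v : free_prod_rel u v -> word_value f2 u = word_value f2 v.
  case=> [||a a'|b b'] /=; rewrite ?mulg1.
  - exact: (hom1 phiM).
  - exact: (hom1 h1M).
  - by rewrite phiM.
  - by rewrite h1M.
pose h2 : free_prod (subg_of Theta) (free_group (letters T)) -> H := presented_lift f2.
have h2M : forall a b, h2 (a * b) = h2 a * h2 b by move=> a b; exact: presented_liftM.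
have h2l w : h2 (free_prod_inl _ w) = phi w.
  by rewrite [LHS](presented_liftE f2V f2R) /= mulg1.
have h2r l : h2 (free_prod_inr _ (free_gen l)) = psi l.
  rewrite [LHS](presented_liftE f2V f2R) /= mulg1 [LHS](presented_liftE f1V) //=.
  by rewrite mulg1.
pose h (a : G) := h2 (generic_quotient.repr a).
have hE x : h (nproj _ x) = h2 x.
  have /nprojP : nproj (completion_relators (T := T)) (generic_quotient.repr (nproj (completion_relators (T := T)) x)) =
      nproj (completion_relators (T := T)) x by rewrite /nproj generic_quotient.reprK.
  move=> /(_ (fun y => h2 y = 1)) hN.
  apply/eqP; rewrite -divg_eq1; apply/eqP; rewrite -homV // -h2M; apply: hN; split.
    split=> /= [|a b ha hb|a ha|a b ha]; rewrite ?h2M ?homV //.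
    - exact: hom1.
    - by rewrite ha hb mulg1.
    - by rewrite ha invg1.
    - by rewrite ha mul1g mulVg.
  move=> _ [W [w [t [wW ->]]]] /=.
  rewrite /commg /conjg !h2M !homV // h2l h2r.
  by rewrite (comm (letter t)) // mulKg mulVg.
exists h; split=> [a b|w|l]; last 2 first.
- exact: etrans (hE _) (h2l w).
- exact: etrans (hE _) (h2r l).
have [[x ->] [y ->]] := (nproj_surj a, nproj_surj b).
by rewrite -[X in h X](nprojM (completion_relators (T := T))) !hE h2M.
Qed.

Lemma completion_ind (P : G -> Prop) : P 1 -> (forall a w, P a -> P (a * base w)) ->
  (forall a s, P a -> P (a * signed_elt s)) -> forall g, P g.
Proof.
move=> P1 Pb Ps; suff h g a : P a -> P (a * g) by move=> g; rewrite -[g]mul1g; apply: h.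
have [x ->] := nproj_surj g; have [u ->] := word_class_surj x.
elim: u a => [|y u IHu] a Pa.
  by rewrite (_ : nproj _ _ = 1) ?mulg1 // -[RHS](hom1 (@nprojM _ _)).
have -> : word_class _ _ (y :: u) = word_class _ _ [:: y] * word_class _ _ u :> free_prod _ _.
  by rewrite [RHS]word_classM.
rewrite nprojM mulgA; apply: IHu; case: y => [w|b]; first exact: Pb.
have [v ->] := word_class_surj b.
have inrM (b1 b2 : free_group (letters T)) :
    free_prod_inr (subg_of Theta) (b1 * b2) = free_prod_inr _ b1 * free_prod_inr _ b2.
  rewrite [RHS]word_classM; apply/word_classP; apply: cong_sym; apply: cong_rel.
  exact: free_prod_Mr.
rewrite -/(free_prod_inr _ _); elim: v a Pa => [|z v IHv] a Pa.
  have -> : nproj (completion_relators (T := T)) (free_prod_inr (subg_of Theta) (word_class _ _ [::])) = 1.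
    by rewrite (hom1 inrM) (hom1 (@nprojM _ _)).
  by rewrite mulg1.
have -> : word_class _ _ (z :: v) = word_class _ _ [:: z] * word_class _ _ v :> free_group _.
  by rewrite [RHS]word_classM.
rewrite inrM nprojM mulgA; apply: IHv.
have := Ps a z Pa; congr (P (a * _)); rewrite /signed_elt.
case: z => l [] //=; rewrite /letter_elt -(homV (@nprojM _ _)) -(homV inrM).
congr (nproj _ (free_prod_inr _ _)); apply: (mulgI (free_gen l)); rewrite mulgV.
rewrite [RHS]word_classM; apply/word_classP; apply: cong_sym.
exact: (cong_mulV _ _ (l, true)).
Qed.

Local Notation Om := (fun W : rep_index D => val W).

Definition wval (w : seq ([subg Theta] * (letters T * bool))) : G :=
  foldr (fun a g => base a.1 * signed_elt a.2 * g) 1 w.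

Lemma wval_cat w w' : wval (w ++ w') = wval w * wval w'.
Proof. by elim: w => [|a w IHw] /=; rewrite ?mul1g // IHw !mulgA. Qed.

Lemma wval_rcons w a : wval (rcons w a) = wval w * (base a.1 * signed_elt a.2).
Proof. by rewrite -cats1 wval_cat /= mulg1. Qed.

(** A base element is absorbed into [th]. A new letter is either appended or cancels the last one,
    in which case the base element between them commutes with the letter and is kept. *)
Lemma reduced_word g : exists w th, sorted (@reduced2 _ _ Om T) w /\ g = wval w * base th.
Proof.
elim/completion_ind: g => [|_ v [w [th [sw ->]]]|_ s [w [th [sw ->]]]].
- by exists [::], 1; rewrite completion_base1 mulg1.
- by exists w, (th * v); rewrite completion_baseM mulgA.
- case/lastP: w sw => [|w a] sw.
    by exists [:: (th, s)], 1; rewrite /= completion_base1 !mulg1 mul1g.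
  have [ra|] := boolP (@reduced2 _ _ Om T a (th, s)).
    exists (rcons (rcons w a) (th, s)), 1.
    split; last by rewrite [in RHS]wval_rcons completion_base1 mulg1 !mulgA.
    case: w sw => [|b w] /=; first by rewrite ra.
    by rewrite !rcons_path last_rcons ra => ->.
  move=> /negbNE/andP[/eqP /= es thO]; exists w, (a.1 * th); split.
    by case: w sw => [//|b w] /=; rewrite rcons_path => /andP[].
  rewrite wval_rcons es signed_elt_sinv completion_baseM -!mulgA; congr (_ * (_ * _)).
  by rewrite mulgA -signed_elt_comm // mulgK.
Qed.

(** Conjugation brings the final base element to the front. If the first and last letters still
    cancel, conjugating by the last step removes both, and the length decreases. *)
Lemma cyclically_reduced_word g : exists h, (exists th, g ^ h = base th) \/
  exists w, [/\ w != [::], path.cycle (@reduced2 _ _ Om T) w & g ^ h = wval w].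
Proof.
have [w [th [sw ->]]] := reduced_word g.
have [n] := ubnP (size w); elim: n w th sw => // n IHn [|a w] th sw le_n.
  by exists 1; left; exists th; rewrite conjg1 mul1g.
pose a' := (th * a.1, a.2).
have e1 : (wval (a :: w) * base th) ^ (base th)^-1 = wval (a' :: w).
  by rewrite conjgE invgK /= completion_baseM !mulgA mulgK.
have ra b : @reduced2 _ _ Om T a' b = @reduced2 _ _ Om T a b by apply: reduced2_l.
have [rl|] := boolP (@reduced2 _ _ Om T (last a' w) a').
  exists (base th)^-1; right; exists (a' :: w); split=> //.
  rewrite /= rcons_path rl andbT; move: sw; rewrite /sorted.
  by case: (w) => //= b s; rewrite ra.
case/lastP: w sw le_n e1 => [|w z] sw le_n e1.
  by move=> /negbNE/andP[/eqP/sinv_neq].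
rewrite last_rcons => /negbNE/andP[/eqP /= ez zO].
have sw1 : sorted (@reduced2 _ _ Om T) w.
  by move: sw; rewrite /= rcons_path => /andP[/path_sorted].
have [|h hP] := IHn w (z.1 * (th * a.1)) sw1.
  by move: le_n; rewrite /= size_rcons ltnS => /ltnW.
pose x := (base z.1 * signed_elt z.2)^-1; pose y := base (z.1 * (th * a.1)).
exists ((base th)^-1 * x * y * h).
suff -> : (wval (a :: rcons w z) * base th) ^ ((base th)^-1 * x * y * h) =
    (wval w * y) ^ h by [].
rewrite !conjgM e1 /= wval_rcons; congr (_ ^ _).
rewrite -/x -[X in _ * (_ * X)]invgK -/x ez signed_elt_sinv.
have -> : (base (th * a.1) * (signed_elt z.2)^-1 * (wval w * x^-1)) ^ x =
    base (z.1 * (th * a.1)) * wval w.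
  rewrite conjgE !mulgA mulgKV /x invgK -[base z.1 * _ * base _]mulgA.
  by rewrite -signed_elt_comm // !completion_baseM !mulgA mulgK.
by rewrite -/y conjgE mulgA mulKg.
Qed.

End CompletionLift.

(** * The group of permutations of [U] *)

Section Permutations.
Variable U : choiceType.

(** Inverses are stored explicitly so that permutations form a group type to which [completion_lift]
    applies. *)
Record permU := PermU {
  perm_fun : U -> U; perm_inv : U -> U;
  perm_funK : cancel perm_fun perm_inv; perm_invK : cancel perm_inv perm_fun }.

HB.instance Definition _ := gen_eqMixin permU.
HB.instance Definition _ := gen_choiceMixin permU.

Lemma permU_eq (f g : permU) : (forall x, perm_fun f x = perm_fun g x) -> f = g.
Proof.
case: f g => [f f' fK f'K] [g g' gK g'K] /= /funext e.
case: _ / e gK g'K => gK g'K.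
have e' : f' = g' by apply/funext => x; rewrite -{1}(g'K x) fK.
by case: _ / e' gK g'K => gK g'K; congr PermU; exact: Prop_irrelevance.
Qed.

Definition permU_one := PermU (fun x => erefl : id (id x) = x) (fun x => erefl).
Definition permU_mul (f g : permU) := PermU (can_comp (perm_funK g) (perm_funK f))
  (can_comp (perm_invK f) (perm_invK g)).
Definition permU_inv (f : permU) := PermU (perm_invK f) (perm_funK f).

Lemma permU_mulA : associative permU_mul. Proof. by move=> f g h; apply: permU_eq. Qed.
Lemma permU_mul1 : left_id permU_one permU_mul. Proof. by move=> f; apply: permU_eq. Qed.
Lemma permU_1mul : right_id permU_one permU_mul. Proof. by move=> f; apply: permU_eq. Qed.
Lemma permU_mulV : left_inverse permU_one permU_inv permU_mul.
Proof. by move=> f; apply: permU_eq => x /=; rewrite perm_invK. Qed.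
Lemma permU_Vmul : right_inverse permU_one permU_inv permU_mul.
Proof. by move=> f; apply: permU_eq => x /=; rewrite perm_funK. Qed.

HB.instance Definition _ := isGroup.Build permU
  permU_mulA permU_mul1 permU_1mul permU_mulV permU_Vmul.

Lemma perm_bij (f : permU) : bijective (perm_fun f).
Proof. exact: Bijective (perm_funK f) (perm_invK f). Qed.

End Permutations.

(** * Non-free orbits and point stabilisers *)

Section TotalActions.
Variables (gT : finGroupType) (U : Type) (to : {action gT &-> U}).

Lemma total_actM x v w : to x (v * w) = to (to x v) w.
Proof. by case: to => f [inj M] /=; apply: M; rewrite finset.in_setT. Qed.

Lemma total_act1 x : to x 1 = x.
Proof.
have := total_actM x 1 1; rewrite mulg1; case: to => f [inj M] /=.
by move=> e; apply: (inj 1); rewrite /= -e.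
Qed.

(** Stabilisers along an orbit are conjugate, so one point with nontrivial stabiliser makes all its
    orbit mates have one. *)
Lemma NFr_P (W : {group gT}) x :
  NFr to W x <-> exists w, [/\ w \in W, w <> 1 & to x w = x].
Proof.
split=> [[orb [[x0 ->] nfree] [u uW <-]]|[w [wW w1 e]]]; last first.
  exists (orbit_at to W x); last by exists 1; [exact: group1|exact: total_act1].
  split; first by exists x.
  move=> fO; apply: w1; apply: (fO x) => //.
  by exists 1; [exact: group1|exact: total_act1].
apply: contrapT => no; apply: nfree => _ w [v vW <-] wW e.
apply: contrapT => w1; apply: no; exists ((w ^ v^-1) ^ u); split.
- by rewrite !groupJ // groupV.
- by move=> /eqP; rewrite !conjg_eq1 => /eqP.
- rewrite !conjgE invgK -!total_actM mulKVg !mulgA !total_actM e.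
  by rewrite -(total_actM _ v) mulgV total_act1.
Qed.

End TotalActions.

(** * Ultrametrics on spaces of sequences *)

Section SubspaceFilters.
Local Open Scope classical_set_scope.

Lemma initial_nbhs_filter (S : choiceType) (Y : topologicalType) (f : S -> Y)
    (F : set_system S) (s : S) : Filter F ->
  (forall O, nbhs (f s) O -> F (f @^-1` O)) ->
  forall A, nbhs (s : initial_topology f) A -> F A.
Proof.
move=> FF hf A; rewrite nbhsE => -[_ [[B oB <-] Bs] BA].
by apply: filterS BA _; apply: hf; apply: open_nbhs_nbhs.
Qed.

Lemma product_nbhs_filter (I : Type) (Y : I -> topologicalType)
    (F : set_system (prod_topology Y)) (s : prod_topology Y) : Filter F ->
  (forall i O, nbhs (s i) O -> F ((fun f => f i) @^-1` O)) ->
  forall A, nbhs s A -> F A.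
Proof.
move=> FF hf; have h : F --> (s : sup_topology (fun i => Topological.class
    (initial_topology (fun f : (forall i, Y i) => f i)))).
  apply/cvg_sup => i A.
  by apply: (initial_nbhs_filter (f := fun f : (forall i, Y i) => f i)) => O; apply: hf.
exact: h.
Qed.

End SubspaceFilters.

Section SequenceMetric.
Import Order.TTheory GRing.Theory Num.Theory.
Local Open Scope classical_set_scope.
Local Open Scope ring_scope.
Variables (R : realType) (X : topologicalType) (W : Type) (ev : nat -> X -> W).

Definition agree n x y := forall m, (m < n)%N -> ev m x = ev m y.

Hypothesis nbhs_agree : forall x O, nbhs x O <->
  exists n, forall y, agree n x y -> O y.
Hypothesis ev_sep : forall x y, (forall n, ev n x = ev n y) -> x = y.
Hypothesis ev_complete : forall s : nat -> X, (forall n, agree n (s n) (s n.+1)) ->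
  exists x, forall n, agree n (s n) x.

Let agree_sym n x y : agree n x y -> agree n y x.
Proof. by move=> h m mn; rewrite h. Qed.

Let agree_trans n x y z : agree n x y -> agree n y z -> agree n x z.
Proof. by move=> h h' m mn; rewrite h // h'. Qed.

Let agree_le m n x y : (m <= n)%N -> agree n x y -> agree m x y.
Proof. by move=> mn h j jm; apply: h; apply: leq_trans mn. Qed.

Let first_diff x y : {n | ev n x <> ev n y /\ agree n x y} + {x = y}.
Proof.
have [e|ne] := pselect (x = y); first by right.
left; apply: cid.
have ex : exists n, `[< ev n x <> ev n y >].
  apply: contrapT => no; apply: ne; apply: ev_sep => n; apply: contrapT => h.
  by apply: no; exists n; apply/asboolP.
case: (ex_minnP ex) => n /asboolP hn minn; exists n; split=> // m mn.
apply: contrapT => h; have := minn m; rewrite leqNgt mn => /(_ _)/negP; apply=> //.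
exact/asboolP.
Qed.

Let half : R := 2^-1.

Definition seq_dist x y : R :=
  match first_diff x y with inleft (exist n _) => half ^+ n | inright _ => 0 end.

Let half_gt0 n : 0 < half ^+ n. Proof. by rewrite exprn_gt0 // invr_gt0. Qed.

Let half_lt m n : (half ^+ m < half ^+ n) = (n < m)%N.
Proof. by rewrite ltr_iXn2l // ?invr_gt0 // invf_lt1 // ltr1n. Qed.

Let dist_lt n x y : seq_dist x y < half ^+ n <-> agree n.+1 x y.
Proof.
rewrite /seq_dist; case: first_diff => [[m [hm am]]|->]; last by split.
rewrite half_lt; split=> [nm|h]; first exact: agree_le am.
by rewrite ltnNge; apply/negP => mn; apply: hm; apply: h; rewrite ltnS.
Qed.

Let dist_ge n x y : ev n x <> ev n y -> half ^+ n <= seq_dist x y.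
Proof.
move=> h; rewrite leNgt; apply/negP => /dist_lt/(_ n (leqnn _)); exact: h.
Qed.

Let dist_ge0 x y : 0 <= seq_dist x y.
Proof. by rewrite /seq_dist; case: first_diff => [[m _]|_] //; apply: ltW. Qed.

Let dist_xx x : seq_dist x x = 0.
Proof. by rewrite /seq_dist; case: first_diff => [[m [hm _]]|_]. Qed.

Let dist_eq0 x y : seq_dist x y = 0 -> x = y.
Proof.
by rewrite /seq_dist; case: first_diff => [[m _] e|//]; have := half_gt0 m; rewrite e ltxx.
Qed.

Let dist_sym_le x y : seq_dist y x <= seq_dist x y.
Proof.
rewrite {1}/seq_dist; case: first_diff => [[m [hm _]]|_] //.
by apply: dist_ge => e; apply: hm.
Qed.

Let dist_sym x y : seq_dist x y = seq_dist y x.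
Proof. by apply/eqP; rewrite eq_le !dist_sym_le. Qed.

Let dist_triangle y x z : seq_dist x z <= seq_dist x y + seq_dist y z.
Proof.
rewrite {1}/seq_dist; case: first_diff => [[m [hm _]]|_]; last exact: addr_ge0.
have [e|ne] := pselect (ev m x = ev m y).
  by rewrite ler_wpDl //; apply: dist_ge; rewrite -e.
by rewrite ler_wpDr //; apply: dist_ge.
Qed.

Let small (e : R) : 0 < e -> exists n, half ^+ n < e.
Proof.
move=> e0; have [n _ hn] := near_infty_natSinv_expn_lt (PosNum e0).
by exists n; have := hn n (leqnn n); rewrite /= div1r exprVn.
Qed.

Definition metric_carrier (Y : Type) : Type := Y.
HB.instance Definition _ (Y : choiceType) := Choice.copy (metric_carrier Y) Y.

(** The ball of radius 2^-n consists of the points agreeing in the first n + 1 coordinates, so both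
    topologies coincide. A Cauchy filter yields points with ever longer agreement, to which
    [ev_complete] applies. *)
Lemma sequence_completely_metrizable : completely_metrizable R X.
Proof.
pose mixin := @isMetric.Build R (metric_carrier X) seq_dist dist_xx dist_eq0 dist_sym dist_triangle.
pose M : metricType R := HB.pack (metric_carrier X) mixin.
have ballM (x : M) e : ball x e = [set y | seq_dist x y < e] by rewrite ballEmdist.
have nbhsM (x : M) A : nbhs x A <-> exists n, forall y, agree n x y -> A y.
  split=> [/nbhs_ballP[e /= e0 eA]|[n hn]].
    have [n ne] := small e0; exists n.+1 => y /dist_lt xy; apply: eA.
    by rewrite ballM /=; apply: lt_trans ne.
  apply/nbhs_ballP; exists (half ^+ n) => //= y; rewrite ballM /= => /dist_lt xy.
  by apply: hn; apply: agree_le xy.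
exists M, (fun x => x), (fun x => x); split=> //.
- by move=> x A /nbhsM h; apply/nbhs_agree.
- by move=> x A /nbhs_agree h; apply/nbhsM.
- move=> F PF /cauchyP cF.
  have /choice[s sP] : forall n, exists x : M, F (ball x (half ^+ n)).
    by move=> n; apply: cF.
  have sF n : F [set y | agree n.+1 (s n) y].
    apply: filterS (sP n) => y; rewrite ballM; exact: (dist_lt n (s n) y).1.
  have [n|l hl] := ev_complete (s := s).
    have [y [h1 h2]] := filter_ex (filterI (sF n) (sF n.+1)).
    apply: (@agree_trans _ _ y); first exact: agree_le (leqnSn n) h1.
    by apply/agree_sym; apply: (agree_le (leqW (leqnSn n)) h2).
  exists l => A /nbhsM[n hn]; apply: filterS (sF n) => y sy; apply: hn.
  apply: (@agree_trans _ _ (s n)); first exact: agree_sym.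
  exact: agree_le (leqnSn n) sy.
Qed.

(** One point is chosen for every finite list of coordinate codes that is realised, and [x0] for the
    others; the lists are countably many. *)
Lemma sequence_separable : (exists h : W -> nat, injective h) -> separable X.
Proof.
move=> [h h_inj].
have [[x0 _]|no] := pselect ([set: X] !=set0); last first.
  exists set0; first exact: countable0.
  by move=> O [x _] _; case: no; exists x.
have /choice[a aP] : forall t : seq nat, exists x, forall y,
    (forall m, (m < size t)%N -> h (ev m y) = nth 0%N t m) ->
    forall m, (m < size t)%N -> h (ev m x) = nth 0%N t m.
  move=> t; have [[x hx]|no] := pselect (exists x, forall m, (m < size t)%N ->
    h (ev m x) = nth 0%N t m); first by exists x.
  by exists x0 => y hy; case: no; exists y.
exists (range a).
  by apply: card_le_trans (card_image_le _ _) (countableP _).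
move=> O [x Ox] oO; have [n hn] : exists n, forall y, agree n x y -> O y.
  by apply/nbhs_agree; apply: open_nbhs_nbhs.
pose t := [seq h (ev m x) | m <- iota 0 n].
have st : size t = n by rewrite size_map size_iota.
have nt m : (m < n)%N -> nth 0%N t m = h (ev m x).
  by move=> mn; rewrite (nth_map 0%N) ?size_iota // nth_iota.
exists (a t); split; last by exists t.
apply: hn => m mn; apply: h_inj.
by rewrite (aP t x) ?st //= => [|j jn]; rewrite nt.
Qed.

(** A point is encoded by the set of pairs of an index and the code of its coordinate there. *)
Lemma sequence_card_le : (exists h : W -> nat, injective h) ->
  ([set: X] #<= [set: nat -> bool])%card.
Proof.
move=> [h h_inj].
pose f x : nat -> bool := fun j => if choice.unpickle j is Some nv then h (ev nv.1 x) == nv.2 else false.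
have f_inj : injective f.
  move=> x y e; apply: ev_sep => n; apply: h_inj; apply/eqP.
  have := congr1 (fun g => g (choice.pickle (n, h (ev n x)))) e.
  by rewrite /f choice.pickleK /= eqxx eq_sym => <-.
have /card_esym/card_eqPle[le _] : (f @` [set: X] #= [set: X])%card.
  by apply: inj_card_eq => x y _ _; apply: f_inj.
by apply: card_le_trans le _; apply: subset_card_le.
Qed.

End SequenceMetric.

(** * The finite support of a seed action *)

Lemma fset_range (k : nat) (U : choiceType) (g : 'I_k -> U) : injective g ->
  exists2 Y : {fset U}, #|` Y| = k & forall x, x \in Y <-> exists i, x = g i.
Proof.
move=> g_inj; have us : uniq [seq g i | i <- enum 'I_k] by rewrite map_inj_uniq ?enum_uniq.
exists (seq_fset tt [seq g i | i <- enum 'I_k]).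
  by rewrite size_seq_fset undup_id // size_map size_enum_ord.
move=> x; rewrite seq_fsetE; split=> [/mapP[i _ ->]|[i ->]]; first by exists i.
by apply: map_f; rewrite mem_enum.
Qed.

Lemma seed_support (k : nat) (Theta : {group 'S_k}) (U : choiceType)
    (lambda : {action [subg Theta] &-> U}) : seed_action lambda ->
  exists (V : {fset U}) (f : U -> 'I_k),
    [/\ #|` V| = k, forall x w, x \in V -> lambda x w \in V,
        forall x w, x \notin V -> lambda x w = x -> w = 1 &
        [/\ {in V &, injective f}, forall i, exists2 x, x \in V & f x = i &
          forall x w, x \in V -> f (lambda x w) = natural_action Theta (f x) w]].
Proof.
move=> [_ [V [V_inv [f [_ f_inj f_surj] f_eqv] V_free]]].
have /choice[g gP] : forall i : 'I_k, exists x, V x /\ f x = i.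
  by move=> i; have [x Vx e] := f_surj i Logic.I; exists x.
have fg i : f (g i) = i by case: (gP i).
have g_inj : injective g := can_inj fg.
have [V' cV' V'P] := fset_range g_inj.
have VV' x : x \in V' <-> V x.
  split=> [/V'P[i ->]|Vx]; first by case: (gP i).
  apply/V'P; exists (f x).
  by apply: f_inj; rewrite ?inE ?fg //; case: (gP (f x)).
exists V', f; split.
- exact: cV'.
- by move=> x w /VV' Vx; apply/VV'; apply: V_inv.
- move=> x w /negP nV e; apply: (V_free x) e => //.
  by move=> Vx; apply: nV; apply/VV'.
- split=> [x y /VV' Vx /VV' Vy|i|x w /VV' Vx]; first by apply: f_inj; rewrite inE.
    by exists (g i); [apply/VV'; case: (gP i)|].
  exact: f_eqv.
Qed.

(** * The space of taut actions *)

Section Link.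
Variables (k : nat) (k_ge1 : (1 <= k)%N) (Theta : {group 'S_k}).
Hypothesis Theta_robust : robust Theta.
Variables (U : choiceType) (lambda : {action [subg Theta] &-> U}).
Hypothesis U_count : exists h : U -> nat, injective h.
Hypothesis U_inf : forall F : {fset U}, exists x, x \notin F.
Variables (D : {set {group [subg Theta]}}).
Hypothesis D_reps : docile_representatives D.
Variable T : rep_index D -> finType.
Hypothesis T_ge2 : forall W, (2 <= #|T W|)%N.
Variables (V : {fset U}) (vf : U -> 'I_k).
Hypothesis V_card : #|` V| = k.
Hypothesis V_inv : forall x w, x \in V -> lambda x w \in V.
Hypothesis V_free : forall x w, x \notin V -> lambda x w = x -> w = 1.
Hypothesis vf_inj : {in V &, injective vf}.
Hypothesis vf_surj : forall i, exists2 x, x \in V & vf x = i.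
Hypothesis vf_eqv : forall x w, x \in V -> vf (lambda x w) = natural_action Theta (vf x) w.

Local Notation gT := (subg_of Theta).
Local Notation act := (fun x w => lambda x w).
Local Notation Om := (fun W : rep_index D => val W).
Local Notation L := {W : rep_index D & T W}.
Local Notation G := (completion T).
Local Notation NF := (NF act V).
Local Notation good := (good act V k (I := rep_index D) Om (T := T)).
Local Notation full := (full act V k (I := rep_index D) Om (T := T)).
Local Notation red := (reduced2 (I := rep_index D) Om (T := T)).

Let act1 x : act x 1 = x. Proof. exact: total_act1. Qed.
Let actM x v w : act x (v * w) = act (act x v) w. Proof. exact: total_actM. Qed.

Lemma NFr_NF (W : {group gT}) x : NFr lambda W x <-> x \in NF W.
Proof. by split=> [/NFr_P h|/(NFP V_free) h]; [apply/(NFP V_free)|apply/NFr_P]. Qed.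

Lemma vf_NF (W : {group gT}) x : x \in V -> NFr (natural_action Theta) W (vf x) <-> x \in NF W.
Proof.
move=> xV; split=> [/NFr_P[w [wW w1 e]]|/(NFP V_free)[w [wW w1 e]]].
  by apply/(NFP V_free); exists w; split=> //; apply: vf_inj => //; [exact: V_inv|rewrite vf_eqv].
by apply/NFr_P; exists w; split=> //; rewrite -vf_eqv // e.
Qed.

Lemma V_faithful w : (forall x, x \in V -> act x w = x) -> w = 1.
Proof.
move=> h; apply: val_inj; apply/permP => i; rewrite perm1.
have [x xV <-] := vf_surj i.
by rewrite -[LHS]/(natural_action Theta (vf x) w) -vf_eqv // h.
Qed.

Lemma docile_NF (W : {group gT}) : docile (natural_action Theta) W <->
  exists2 v, v \in V & v \notin NF W.
Proof.
split=> [[orb [[i ->] fr]]|[v vV vN]].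
  have [v vV e] := vf_surj i; exists v => //; apply/negP => /(vf_NF _ vV)/NFr_P[w [wW w1]].
  rewrite e => ew; apply: w1; apply: (fr i) ew => //.
  by exists 1; [exact: group1|exact: total_act1].
exists (orbit_at (natural_action Theta) W (vf v)); split; first by exists (vf v).
move=> _ w [u uW <-] wW e; apply: contrapT => w1; case/negP: vN.
apply/(vf_NF _ vV)/NFr_P; exists (w ^ u^-1); split.
- by rewrite groupJ // groupV.
- by move=> /eqP; rewrite conjg_eq1 => /eqP.
- by rewrite conjgE invgK !total_actM e -total_actM mulgV total_act1.
Qed.

Lemma index_docile (i : rep_index D) : exists2 v, v \in V & v \notin NF (Om i).
Proof. by apply/docile_NF; apply: (proj1 D_reps); apply: valP. Qed.

Lemma robust_NF (W : {group gT}) (Y : {fset U}) : Y != fset0 ->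
  (forall x w, x \in Y -> w \in W -> act x w \in Y) -> {subset Y <= NF W} ->
  ~~ (#|W| %| #|` Y|)%N.
Proof.
move=> Y0 Yinv YN; have YV x : x \in Y -> x \in V by move=> /YN/NF_V.
pose Y' : {set 'I_k} := finset.finset (fun i => [exists x : Y, vf (val x) == i]).
have inY' x : x \in Y -> vf x \in Y'.
  by move=> xY; rewrite finset.inE; apply/fintype.existsP; exists [` xY]; rewrite /= eqxx.
have Y'P i : i \in Y' -> exists2 x, x \in Y & vf x = i.
  by rewrite finset.inE => /fintype.existsP[x /eqP <-]; exists (val x) => //; apply: valP.
have -> : #|` Y| = #|Y'|.
  rewrite cardE -(size_map vf); apply: perm_size; apply: uniq_perm.
  - rewrite map_inj_in_uniq ?fset_uniq // => x y xY yY; apply: vf_inj; exact: YV.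
  - exact: enum_uniq.
  - move=> i; rewrite mem_enum; apply/mapP/idP => [[x xY ->]|/Y'P[x xY <-]]; first exact: inY'.
    by exists x.
apply: Theta_robust.
- by have /fset0Pn[x /inY' xY] := Y0; apply/finset.set0Pn; exists (vf x).
- by move=> i w /Y'P[x xY <-] wW; rewrite -vf_eqv ?YV // inY' // Yinv.
- by move=> i /= /Y'P[x xY <-]; apply/vf_NF; [exact: YV|exact: YN].
Qed.

Lemma docile_index (W : {group gT}) : (exists2 v, v \in V & v \notin NF W) ->
  exists (i : rep_index D) h, (W :^ h)%G = Om i.
Proof.
move=> /docile_NF/(proj2 D_reps)[W' [[W'D [h e]] _]].
by exists (exist _ W' W'D), h.
Qed.

(** * Passing between taut actions and total letter maps *)

Definition sym_of (f : U -> U) (fb : bijective f) : Defs.Sym U := exist _ f (mem_set fb).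

Local Notation families := (sym_families G U).
Local Notation taut_actions := (@Defs.taut_actions k Theta D T U lambda).

Definition letter_act (mu : families) : L * bool -> U -> U :=
  fun s x => act_by mu x (signed_elt s).

Lemma right_action_morph (mu : families) : right_action mu ->
  (forall x, act_by mu x 1 = x) /\ forall x g, act_by mu (act_by mu x g) g^-1 = x.
Proof.
move=> rm; suff h x : act_by mu x 1 = x by split=> // x g; rewrite -rm mulgV h.
have inj : injective (fun y => act_by mu y 1).
  by apply: bij_inj; exact: (set_mem (valP (mu 1))).
by apply: inj; rewrite /= -rm mulg1.
Qed.

Lemma act_wval (mu : families) w x : right_action mu ->
  (forall x w, act_by mu x (completion_base T w) = lambda x w) ->
  act_by mu x (wval w) = eval act (letter_act mu) w x.
Proof.
move=> rm bm; have [m1 _] := right_action_morph rm.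
by elim: w x => [|a w IHw] x; rewrite /= ?m1 // !rm bm IHw.
Qed.

Lemma translate_fset (mu : families) (A B : {fset U}) g : right_action mu ->
  #|` A| = #|` B| -> (forall x, x \in A -> act_by mu x g \in B) ->
  translate mu [set` A]%classic g = [set` B]%classic.
Proof.
move=> rm eAB AB; have [m1 mV] := right_action_morph rm.
apply/seteqP; split=> [_ [x /= xA <-]|y /= yB]; first exact: AB.
have [||x xA e] := @injective_rel_surj _ (fun x y => act_by mu x g = y) A B _ eAB _ y yB.
- by move=> u u' v <- e; rewrite -(mV u g) -e mV.
- by move=> u uA; exists (act_by mu u g) => //; apply: AB.
by exists x.
Qed.

Lemma action_of_full si : full si -> exists mu : families, [/\ right_action mu,
  forall x w, act_by mu x (completion_base T w) = lambda x w
  & forall x s, letter_act mu s x = si s x].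
Proof.
move=> fs.
pose phi (w : gT) : permU U := @PermU U (fun x => act x w) (fun x => act x w^-1)
  (fun x => actVK act1 actM x w) (fun x => actKV act1 actM x w).
have siV s x : si s (si (sinv s) x) = x by rewrite -{1}(sinvK s) (full_inv fs).
pose psi (l : letters T) : permU U := PermU (full_inv fs (l, true)) (siV (l, true)).
have [||h [hM hb hl]] := @completion_lift _ _ _ T (permU U) phi psi.
- by move=> v w; apply: permU_eq => x /=; rewrite actM.
- move=> l w wl; apply: permU_eq => x /=.
  by rewrite (full_eqv fs (s := (l, true))).
pose mu : families := fun g => sym_of (perm_bij (h g)).
have muE x g : act_by mu x g = perm_fun (h g) x by [].
exists mu; split.
- by move=> x g g'; rewrite !muE hM.
- by move=> x w; rewrite muE hb.
- move=> x [l []]; rewrite /letter_act muE /signed_elt /=; first by rewrite hl.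
  by rewrite (homV hM) hl.
Qed.

Lemma taut_of_full (mu : families) : right_action mu ->
  (forall x w, act_by mu x (completion_base T w) = lambda x w) ->
  full (letter_act mu) -> taut_actions mu.
Proof.
move=> rm bm fm; have [m1 mV] := right_action_morph rm.
split=> //; split.
- move=> g g1 [x [x_inj xg]]; have [h gh] := cyclically_reduced_word g.
  pose y i := act_by mu (x i) h.
  have y_inj : injective y by move=> i j /(congr1 ((act_by mu)^~ h^-1)); rewrite /y !mV => /x_inj.
  have yg i : act_by mu (y i) (g ^ h) = y i.
    by rewrite /y -rm conjgE !mulgA mulgV mul1g rm xg.
  have [Y cY YP] := fset_range y_inj.
  case: gh => [[th e]|[w [w0 cw e]]].
    (* A nontrivial base element fixes points of [V] only, so its k fixed points fill [V], where the
       group is faithful. *)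
    have fixY z : z \in Y -> act z th = z.
      by move=> /YP[i ->]; rewrite -[LHS]bm -e.
    suff th1 : th = 1.
      apply: g1; move: e; rewrite th1 completion_base1 => e.
      by rewrite -(conjgK h g) e conj1g.
    apply: contrapT => th1; apply: (th1); apply: V_faithful.
    suff -> : V = Y by [].
    apply/esym/fset_eq_card; first by rewrite cY.
    by move=> z zY; apply: contrapT => /negP zV; apply: th1; apply: V_free zV (fixY z zY).
  apply: (full_sharp fm w0 cw cY) => z /YP[i ->].
  by rewrite -act_wval // -e.
- move=> W t x /NFr_NF xN; exact: (full_nf fm (s := (letter t, true))).
- move=> W A /finite_fsetP[B eA] hA; rewrite eA => x xB; apply/NFr_NF.
  apply: (full_taut fm (i := W) (A := B)) xB => t z zB.
  have := hA t; rewrite eA => /seteqP[+ _] => /(_ (act_by mu z (completion_gen t))).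
  by apply; exists z.
Qed.

Lemma translateM (mu : families) (A : set U) g h : right_action mu ->
  translate mu A (g * h) = translate mu (translate mu A g) h.
Proof.
move=> rm; apply/seteqP; split=> [_ [x Ax <-]|_ [_ [x Ax <-] <-]].
  by exists (act_by mu x g); [exists x|rewrite rm].
by exists x; rewrite // rm.
Qed.

Lemma translate1 (mu : families) (A : set U) : right_action mu -> translate mu A 1 = A.
Proof.
move=> /right_action_morph[m1 _]; apply/seteqP; split=> [_ [x Ax <-]|x Ax].
  by rewrite m1.
by exists x; rewrite ?m1.
Qed.

Lemma translate_reach (mu : families) (A B : {fset U}) : right_action mu ->
  (forall x w, act_by mu x (completion_base T w) = lambda x w) ->
  full (letter_act mu) -> reach act (graph (letter_act mu)) A B ->
  exists g, translate mu [set` A]%classic g = [set` B]%classic.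
Proof.
move=> rm bm fm; elim=> {A B} [A|A w|s A B eAB st|A B _ [g e]|A B C _ [g e] _ [h e']].
- by exists 1; apply: translate1.
- exists (completion_base T w); apply: translate_fset => //.
    by rewrite (card_actF act1 actM).
  by move=> x xA; rewrite bm (mem_actF act1 actM).
- exists (signed_elt s); apply: translate_fset => // x /st[y yB].
  rewrite act1 => xy; suff -> : act_by mu x (signed_elt s) = y by [].
  case: s xy {st} => l [] //= e; rewrite -{1}e.
  exact: (full_inv fm (l, true)).
- by exists g^-1; rewrite -e -translateM // mulgV translate1.
- by exists (g * h); rewrite translateM // e.
Qed.

Lemma exists_taut_actions p : good p -> exists mu : (nat -> bool) -> families,
  [/\ forall c, taut_actions (mu c),
      forall c l x y, p l x y -> letter_act (mu c) (l, true) x = y,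
      forall c (A : {fset U}), #|` A| = k ->
        exists g, translate (mu c) [set` A]%classic g = [set` V]%classic
    & injective mu].
Proof.
move=> gp; have [si [fsi ext tr dist]] := generic_actions act1 actM V_card V_inv V_free
  T_ge2 U_inf U_count robust_NF docile_index k_ge1 gp.
have /choice[mu muP] : forall c, exists mu : families, [/\ right_action mu,
    forall x w, act_by mu x (completion_base T w) = lambda x w
    & letter_act mu = si c].
  move=> c; have [mu [rm bm sm]] := action_of_full (fsi c); exists mu; split=> //.
  by apply/funext => s; apply/funext => x.
exists mu; split=> [c|c l x y|c A cA|c c' e].
- by have [rm bm sm] := muP c; apply: taut_of_full; rewrite ?sm.
- by have [_ _ ->] := muP c; apply: ext.
- have [rm bm sm] := muP c; apply: translate_reach; rewrite ?sm //; exact: tr.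
- apply: contrapT => /dist[l [x]]; apply.
  by have [_ _ <-] := muP c; have [_ _ <-] := muP c'; rewrite e.
Qed.

(** Grown from the trivial approximation, a generic action exists; there a word equal to [1] would
    fix all of [V], against [full_sharp]. *)
Lemma cyclic_word_neq1 w : w != [::] -> path.cycle red w -> wval w <> 1 :> G.
Proof.
move=> w0 cw w1.
have [si [fsi _ _ _]] := generic_actions act1 actM V_card V_inv V_free T_ge2 U_inf
  U_count robust_NF docile_index k_ge1 (good_trivial act1 actM V_card V_free index_docile T_ge2).
have [mu [rm bm sm]] := action_of_full (fsi xpred0).
apply: (full_sharp (fsi xpred0) w0 cw V_card) => x _.
have <- : letter_act mu = si xpred0 by apply/funext => s; apply/funext => y.
by rewrite -act_wval // w1; case: (right_action_morph rm).
Qed.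

(** Sharpness of [mu] speaks of nontrivial group elements, and [cyclic_word_neq1] says that
    cyclically reduced words are such. *)
Lemma full_of_taut (mu : families) : taut_actions mu -> full (letter_act mu).
Proof.
move=> [rm bm [sh nf tt]]; have [m1 mV] := right_action_morph rm.
split.
- by move=> s x; rewrite /letter_act signed_elt_sinv mV.
- move=> s x w wO; rewrite /letter_act -!bm -!rm; congr (act_by mu x _).
  exact: signed_elt_comm.
- have h (l : L) x : x \in NF (val (tag l)) -> act_by mu x (letter_elt l) = x.
    by case: l => W t /NFr_NF xN; apply: (nf W t).
  move=> [l b] x /= xN; rewrite /letter_act /signed_elt /=; case: b; first exact: h.
  by rewrite -[in LHS](h l x xN) mV.
- move=> w X w0 cw cX hX; apply: (sh (wval w)); first exact: cyclic_word_neq1.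
  have [x0 _] : exists x, x \in X by apply/fset0Pn; rewrite -cardfs_gt0 cX.
  exists (fun i => nth x0 X i); split=> [i j /eqP|i].
    by rewrite nth_uniq ?fset_uniq ?cX // => /eqP/val_inj.
  by rewrite act_wval // hX // mem_nth // cX.
- move=> i A hA x xA; apply/NFr_NF; apply: (tt i [set` A]%classic) => //.
  by move=> t; apply: translate_fset => // y yA; apply: (hA t).
Qed.

Lemma stabiliser_V (mu : families) g : taut_actions mu ->
  translate mu [set` V]%classic g = [set` V]%classic -> exists th, g = completion_base T th.
Proof.
move=> tm eV; have fm := full_of_taut tm; have [rm bm _] := tm.
have [w [th [sw eg]]] := reduced_word g; exists th.
suff e : w = [::] by rewrite eg e mul1g.
apply: (full_stab_V act1 actM V_card V_inv fm sw) => x xV.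
rewrite -act_wval //.
have : act_by mu x g \in V.
  have : translate mu [set` V]%classic g (act_by mu x g) by exists x.
  by rewrite eV.
by rewrite eg rm bm => /(V_inv th^-1); rewrite (actVK act1 actM).
Qed.

(** Each value depends on the letters at finitely many points along a word for the group element;
    restricting [mu] to a finite invariant set containing these points and [V] gives [p]. *)
Lemma agreement (mu : families) (r : seq (G * U)) : taut_actions mu ->
  exists p, [/\ good p, forall l x y, p l x y -> letter_act mu (l, true) x = y &
    forall nu : families, taut_actions nu ->
      (forall l x y, p l x y -> letter_act nu (l, true) x = y) ->
      forall gx, gx \in r -> act_by nu gx.2 gx.1 = act_by mu gx.2 gx.1].
Proof.
move=> tm; have fm := full_of_taut tm; have [rm bm _] := tm.
have [F0 hF0] : exists F0 : {fset U}, forall nu : families, taut_actions nu ->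
    (forall (l : L) y, y \in F0 -> letter_act nu (l, true) y = letter_act mu (l, true) y) ->
    forall gx, gx \in r -> act_by nu gx.2 gx.1 = act_by mu gx.2 gx.1.
  elim: r => [|[g x] r [F1 hF1]]; first by exists fset0.
  have [w [th [_ eg]]] := reduced_word g.
  have [F2 hF2] := eval_local w x fm.
  exists (F1 `|` F2) => nu tn agree gx; rewrite inE => /orP[/eqP->|] /=; last first.
    by apply: hF1 => // l y yF; apply: agree; rewrite inE yF.
  have [rn bn _] := tn; rewrite eg rm rn bm bn !act_wval // hF2 //.
    exact: full_of_taut.
  by move=> l y yF; apply: agree; rewrite inE yF orbT.
pose F := satF act (V `|` F0).
have FF x : x \in V `|` F0 -> x \in F by apply: satF_sub.
exists (restriction (letter_act mu) F); split.
- apply: (restriction_good act1 actM fm) => [x w|x xV].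
    by rewrite (satF_act act1 actM).
  by apply: FF; rewrite inE xV.
- by move=> l x y [].
- move=> nu tn ext; apply: hF0 => // l y yF; apply: ext.
  by split=> //; apply: FF; rewrite inE yF orbT.
Qed.

Lemma card_eq_fset (A : set U) : (A #= `I_k)%card -> exists2 B : {fset U}, #|` B| = k & A = [set` B]%classic.
Proof.
move=> cA; have fA : finite_set A by apply/finite_setP; exists k.
by exists (fset_set A); [exact: card_fset_set|rewrite fset_setK].
Qed.

(** If [g] carries [A] to [V], conjugation by [g] carries the stabiliser of [A] to that of [V],
    which is [Theta] by [stabiliser_V]. *)
Lemma taut_sharply_transitive (mu : families) : taut_actions mu ->
  (forall A B : {fset U}, #|` A| = k -> #|` B| = k ->
    exists g, translate mu [set` A]%classic g = [set` B]%classic) ->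
  sharply_transitive Theta mu.
Proof.
move=> tm tr; have [rm bm _] := tm; have [m1 mV] := right_action_morph rm.
split=> [_ _ /card_eq_fset[A cA ->] /card_eq_fset[B cB ->]|_ /card_eq_fset[A cA ->]].
  exact: tr.
have [g eg] := tr A V cA V_card.
have AV x : x \in A -> act_by mu x g \in V.
  move=> xA; have : translate mu [set` A]%classic g (act_by mu x g) by exists x.
  by rewrite eg.
have tV th : translate mu [set` V]%classic (completion_base T th) = [set` V]%classic.
  by apply: translate_fset => // x xV; rewrite bm V_inv.
have stab h : set_stabiliser mu [set` A]%classic h -> exists th, h ^ g = completion_base T th.
  move=> hA; apply: (stabiliser_V tm).
  rewrite conjgE translateM // -eg -[translate mu (translate mu _ g) g^-1]translateM //.
  rewrite mulgV translate1 // translateM //.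
  by rewrite (hA : translate _ _ _ = _).
have /choice[phi phiP] : forall h, exists th, set_stabiliser mu [set` A]%classic h ->
    h ^ g = completion_base T th.
  move=> h; have [/stab[th e]|no] := pselect (set_stabiliser mu [set` A]%classic h).
    by exists th.
  by exists 1 => /no.
have base_inj := @completion_base_inj k Theta D T.
exists (fun x => vf (act_by mu x g)), phi; split.
- split=> [x _|x y|i _] //.
    rewrite !inE => xA yA /vf_inj e.
    by rewrite -(mV x g) -(mV y g) e // AV.
  have [v vV <-] := vf_surj i.
  have : translate mu [set` A]%classic g v by rewrite eg.
  by move=> [x xA <-]; exists x.
- split=> [h _|h h'|th _] //.
    rewrite !inE => hA h'A e; apply: (can_inj (conjgK g)).
    by rewrite phiP // phiP // e.
  have hA : set_stabiliser mu [set` A]%classic (completion_base T th ^ g^-1).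
    rewrite /set_stabiliser /= conjgE invgK translateM // eg translateM // tV.
    by rewrite -eg -translateM // mulgV translate1.
  by exists (completion_base T th ^ g^-1) => //; apply: base_inj; rewrite -phiP // conjgKV.
- move=> h h' hA h'A; apply: base_inj; rewrite completion_baseM -!phiP // ?conjMg //.
  by rewrite /set_stabiliser /= translateM // hA h'A.
- move=> x h xA hA; rewrite -vf_eqv ?AV //; congr vf.
  by rewrite -bm -phiP // -!rm conjgE mulKVg.
Qed.

(** * Topology of the space of taut actions *)

Local Open Scope classical_set_scope.
Local Notation X := (@taut_space k Theta D T U lambda).

Definition family_of (mu : X) : families := val mu.

Local Notation ev nu g x := (act_by (family_of nu) x g).

Lemma taut_spaceP (mu : X) : taut_actions (family_of mu).
Proof. exact: (set_mem (valP mu)). Qed.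

Definition to_taut_space (mu : families) (tm : taut_actions mu) : X := exist _ mu (mem_set tm).

Lemma ev_continuous g x : continuous (fun nu : X => ev nu g x : discrete_topology U).
Proof.
move=> nu.
have c1 : {for nu, continuous (set_val : X -> families)} by apply: initial_continuous.
have c2 := @proj_continuous G (fun=> Defs.Sym U) g (val nu).
have c3 : {for val nu g, continuous (set_val : Defs.Sym U -> {ptws U -> discrete_topology U})}.
  exact: initial_continuous.
have c4 := @proj_continuous U (fun=> discrete_topology U) x (val (val nu g)).
have c12 := cvg_comp _ _ c1 c2.
have c123 := cvg_comp _ _ c12 c3.
exact: (cvg_comp _ _ c123 c4).
Qed.

(** Sets determined by finitely many values form a filter; peeling off the two subspace and two
    product topologies reduces the claim to a single value in a discrete space. *)
Lemma taut_nbhs (mu : X) (V0 : set X) : nbhs mu V0 <->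
  exists r : seq (G * U), forall nu : X,
    (forall gx, gx \in r -> ev nu gx.1 gx.2 = ev mu gx.1 gx.2) -> V0 nu.
Proof.
split; last first.
  move=> [r hr]; suff : nbhs mu [set nu : X | forall gx, gx \in r ->
      ev nu gx.1 gx.2 = ev mu gx.1 gx.2] by apply: filterS.
  elim: r {hr} => [|[g x] r IHr]; first by apply: filterS filterT.
  have h : nbhs mu [set nu : X | ev nu g x = ev mu g x].
    apply: (@ev_continuous g x mu [set y | y = ev mu g x]).
    by rewrite nbhs_principalE; apply/principal_filterP.
  apply: filterS (filterI h IHr) => nu [e1 e2] gx.
  by rewrite inE => /orP[/eqP->|/e2].
pose F : set_system X := [set V1 | exists r : seq (G * U), forall nu : X,
  (forall gx, gx \in r -> ev nu gx.1 gx.2 = ev mu gx.1 gx.2) -> V1 nu].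
have FF : Filter F.
  split.
  - by exists [::].
  - move=> P Q [r hr] [r' hr']; exists (r ++ r') => nu h.
    by split; [apply: hr|apply: hr'] => gx gxr; apply: h; rewrite mem_cat gxr ?orbT.
  - by move=> P Q PQ [r hr]; exists r => nu /hr/PQ.
move: V0; apply: (initial_nbhs_filter (f := set_val)) => O1.
apply: (@product_nbhs_filter G (fun=> Defs.Sym U) (set_val @ F)) => g O2.
apply: (@initial_nbhs_filter _ _ set_val ((fun f : families => f g) @ (set_val @ F))) => O3.
apply: (@product_nbhs_filter U (fun=> discrete_topology U)
  (set_val @ ((fun f : families => f g) @ (set_val @ F)))) => x O4.
rewrite nbhs_principalE => /principal_filterP O4x.
exists [:: (g, x)] => nu /(_ (g, x) (mem_head _ _)) /= e.
suff : O4 (ev nu g x) by [].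
by rewrite e.
Qed.

Lemma completion_countable : exists h : G -> nat, injective h.
Proof.
have /choice[rep repP] : forall g : G, exists wt : seq (gT * (L * bool)) * gT,
    g = wval wt.1 * completion_base T wt.2.
  by move=> g; have [w [th [_ e]]] := reduced_word g; exists (w, th).
exists (fun g => choice.pickle (rep g)) => g g' /(pcan_inj choice.pickleK) e.
by rewrite (repP g) (repP g') e.
Qed.

Lemma decoding (Y : Type) (e : Y -> nat) : injective e ->
  exists d : nat -> option Y, forall y, d (e y) = Some y.
Proof.
move=> e_inj; have /choice[d dP] : forall n, exists o : option Y, forall y, e y = n -> o = Some y.
  move=> n; have [[y ey]|no] := pselect (exists y, e y = n).
    by exists (Some y) => y'; rewrite -ey => /e_inj ->.
  by exists None => y ey; case: no; exists y.
by exists d => y; apply: dP.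
Qed.

Lemma pair_code : exists c : G * U -> nat, injective c.
Proof.
have [[hG hG_inj] [hU hU_inj]] := (completion_countable, U_count).
exists (fun gx => choice.pickle (hG gx.1, hU gx.2)).
by move=> [g x] [g' x'] /(pcan_inj choice.pickleK)[/hG_inj-> /hU_inj->].
Qed.

Lemma option_code : exists h : option U -> nat, injective h.
Proof.
have [h h_inj] := U_count; exists (fun o => choice.pickle (omap h o)).
by move=> [x|] [y|] /(pcan_inj choice.pickleK) // [/h_inj->].
Qed.

Section Coded.
Variables (code : G * U -> nat) (dec : nat -> option (G * U)).
Hypothesis dec_code : forall gx, dec (code gx) = Some gx.

(** Numbering the pairs [(g, x)] turns an action into a sequence; numbers that decode to no pair
    contribute [None]. *)
Definition coded_ev (n : nat) (nu : X) : option U :=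
  omap (fun gx => ev nu gx.1 gx.2) (dec n).

Let agreeX := agree (coded_ev : nat -> X -> option U).

Let agree_ev n (mu nu : X) gx : (code gx < n)%N -> agreeX n mu nu ->
  ev mu gx.1 gx.2 = ev nu gx.1 gx.2.
Proof. by move=> lt /(_ _ lt); rewrite /coded_ev dec_code => -[]. Qed.

Let code_bound (r : seq (G * U)) : exists n, forall gx, gx \in r -> (code gx < n)%N.
Proof.
elim: r => [|gx r [n hn]]; first by exists 0%N.
exists (maxn (code gx).+1 n) => gx'; rewrite inE => /orP[/eqP->|/hn h].
  by rewrite leq_maxl.
by apply: leq_trans h _; rewrite leq_maxr.
Qed.

Lemma coded_nbhs (mu : X) V0 : nbhs mu V0 <->
  exists n, forall nu, agreeX n mu nu -> V0 nu.
Proof.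
split=> [/taut_nbhs[r hr]|[n hn]].
  have [n hn] := code_bound r; exists n => nu a; apply: hr => gx gxr.
  exact/esym/(agree_ev (hn gx gxr)).
apply/taut_nbhs; exists (pmap dec (iota 0 n)) => nu h; apply: hn => m mn.
rewrite /coded_ev; case dm : (dec m) => [gx|] //=; rewrite h //.
by rewrite mem_pmap; apply/mapP; exists m; rewrite ?mem_iota.
Qed.

Lemma coded_sep (mu nu : X) : (forall n, coded_ev n mu = coded_ev n nu) -> mu = nu.
Proof.
move=> h; apply: val_inj; apply/functional_extensionality_dep => g; apply: val_inj.
apply/funext => x; have := h (code (g, x)).
by rewrite /coded_ev dec_code => -[].
Qed.

(** Every instance of the defining conditions involves finitely many pairs, on which the limit
    agrees with some [s n]; so the limit is again a taut action. *)
Lemma coded_complete (s : nat -> X) : (forall n, agreeX n (s n) (s n.+1)) ->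
  exists mu, forall n, agreeX n (s n) mu.
Proof.
move=> hs.
have mono m n : (m <= n)%N -> agreeX m (s m) (s n).
  elim: n => [|n IHn]; first by rewrite leqn0 => /eqP-> j.
  rewrite leq_eqVlt => /orP[/eqP->|]; first by move=> j.
  rewrite ltnS => mn j jm; rewrite (IHn mn j jm); apply: hs.
  exact: leq_trans jm mn.
pose lim x g := ev (s (code (g, x)).+1) g x.
have limE n g x : (code (g, x) < n)%N -> lim x g = ev (s n) g x.
  by move=> lt; apply: (@agree_ev (code (g, x)).+1 _ _ (g, x)) => //; apply: mono.
have stable (r : seq (G * U)) : exists n, forall gx, gx \in r -> lim gx.2 gx.1 = ev (s n) gx.1 gx.2.
  by have [n hn] := code_bound r; exists n => -[g x] /hn; apply: limE.
have limM x g h : lim x (g * h) = lim (lim x g) h.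
  have [n hn] := stable [:: (g * h, x); (g, x); (h, lim x g)].
  have [rm _ _] := taut_spaceP (s n).
  rewrite (hn (g * h, x)) ?inE ?eqxx // (hn (h, lim x g)) ?inE ?eqxx ?orbT //=.
  by rewrite (hn (g, x)) ?inE ?eqxx ?orbT //= rm.
have lim1 x : lim x 1 = x.
  have [n hn] := stable [:: (1, x)]; rewrite (hn (1, x)) ?inE ?eqxx //=.
  by have [rm _ _] := taut_spaceP (s n); case: (right_action_morph rm).
have lim_bij g : bijective (fun x => lim x g).
  by exists (fun x => lim x g^-1) => x; rewrite -limM ?mulgV ?mulVg lim1.
pose mu : families := fun g => sym_of (lim_bij g).
have muE x g : act_by mu x g = lim x g by [].
have tm : taut_actions mu.
  split.
  - by move=> x g h; rewrite !muE limM.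
  - move=> x w; have [n hn] := stable [:: (completion_base T w, x)].
    rewrite muE (hn (completion_base T w, x)) ?inE ?eqxx //=.
    by have [_ -> _] := taut_spaceP (s n).
  - split.
    + move=> g g1 [x [x_inj hx]].
      have [n hn] := stable [seq (g, x i) | i <- enum 'I_k].
      have [_ _ [sh _ _]] := taut_spaceP (s n); apply: (sh g g1); exists x; split=> // i.
      rewrite -(hn (g, x i)) ?map_f ?mem_enum //; exact: hx.
    + move=> W t x xN; have [n hn] := stable [:: (completion_gen t, x)].
      rewrite muE (hn (completion_gen t, x)) ?inE ?eqxx //=.
      by have [_ _ [_ nf _]] := taut_spaceP (s n); apply: nf.
    + move=> W A /finite_fsetP[B eA]; rewrite eA => hA.
      have [n hn] := stable [seq (completion_gen t, x) | t <- enum (T W), x <- enum_fset B].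
      have [rm _ [_ _ tt]] := taut_spaceP (s n).
      apply: (tt W [set` B]) => // t; apply: (translate_fset rm) => // x xB.
      rewrite -(hn (completion_gen t, x)) /=; last first.
        by apply/allpairsP; exists (t, x); rewrite mem_enum.
      have := hA t => /seteqP[+ _] => /(_ (act_by mu x (completion_gen t))).
      by apply; exists x.
exists (to_taut_space tm) => n m mn; rewrite /coded_ev.
case dm : (dec m) => [[g x]|] //=; congr Some.
(* Several numbers may decode to the same pair, so its code can be at least [n] although [m] is
   smaller; then [mono] is used at coordinate [m]. *)
have [lt|le] := ltnP (code (g, x)) n; first by rewrite -limE.
rewrite [RHS](_ : _ = lim x g) //; rewrite (limE (code (g, x)).+1) //.
have := mono n (code (g, x)).+1 (leqW le) m mn.
by rewrite /coded_ev dm => -[].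
Qed.

End Coded.

(** The binary tree is grown from a restriction of [mu] that already fixes the prescribed values;
    density and perfectness both follow. *)
Lemma agreement_space (mu : X) (r : seq (G * U)) : exists nu : (nat -> bool) -> X,
  [/\ injective nu, forall c gx, gx \in r -> ev (nu c) gx.1 gx.2 = ev mu gx.1 gx.2
    & forall c, STT T lambda (nu c)].
Proof.
have [p [gp pmu hp]] := agreement r (taut_spaceP mu).
have [nu [tn ext tr nu_inj]] := exists_taut_actions gp.
exists (fun c => to_taut_space (tn c)); split.
- by move=> c c' /(congr1 val)/nu_inj.
- by move=> c; apply: (hp _ (tn c) (ext c)).
- move=> c; apply: (taut_sharply_transitive (tn c)) => A B cA cB.
  have [g eA] := tr c A cA; have [h eB] := tr c B cB.
  have [rm _ _] := tn c; exists (g * h^-1).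
  by rewrite translateM // eA -eB -translateM // mulgV translate1.
Qed.

Lemma taut_space_nonempty : [set: X] !=set0.
Proof.
have [nu [tn _ _ _]] := exists_taut_actions (good_trivial act1 actM V_card V_free index_docile T_ge2).
by exists (to_taut_space (tn xpred0)).
Qed.

Lemma taut_space_perfect : perfect_set [set: X].
Proof.
apply/perfectTP => mu o1.
have /taut_nbhs[r hr] : nbhs mu [set mu] by apply: open_nbhs_nbhs.
have [nu [nu_inj ag _]] := agreement_space mu r.
have e c : nu c = mu by apply: hr; apply: ag.
have := nu_inj xpred0 xpredT; rewrite !e => /(_ erefl) /(congr1 (fun c => c 0%N)).
by [].
Qed.

Lemma taut_space_polish (R : realType) : polish R X.
Proof.
have [code code_inj] := pair_code; have [dec dc] := decoding code_inj; split.
  exact: (sequence_separable (coded_nbhs dc) option_code).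
exact: (sequence_completely_metrizable R (coded_nbhs dc) (coded_sep dc) (coded_complete dc)).
Qed.

Lemma taut_space_card : ([set: X] #= [set: nat -> bool])%card.
Proof.
have [code code_inj] := pair_code; have [dec dc] := decoding code_inj.
rewrite card_eq_le (sequence_card_le (coded_sep dc) option_code) /=.
have [nu [tn _ _ nu_inj]] := exists_taut_actions (good_trivial act1 actM V_card V_free index_docile T_ge2).
pose f c := to_taut_space (tn c).
have /card_esym/card_eqPle[le _] : (f @` [set: nat -> bool] #= [set: nat -> bool])%card.
  by apply: inj_card_eq => c c' _ _ /(congr1 val)/nu_inj.
by apply: card_le_trans le _; apply: subset_card_le.
Qed.

Lemma STT_dense : dense (STT T lambda).
Proof.
move=> V0 [mu Vmu] oV; have /taut_nbhs[r hr] : nbhs mu V0 by apply: open_nbhs_nbhs.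
have [nu [_ ag tr]] := agreement_space mu r.
by exists (nu xpred0); split; [apply: hr; apply: ag|apply: tr].
Qed.

(** By [taut_sharply_transitive] only transitivity has to be ensured. For each of the countably many
    pairs of k-sets, having some [g] that carries one to the other is an open condition. *)
Lemma STT_Gdelta : Gdelta (STT T lambda).
Proof.
have [h h_inj] := U_count.
pose fcode (AB : {fset U} * {fset U}) : nat :=
  choice.pickle ([seq h x | x <- enum_fset AB.1], [seq h x | x <- enum_fset AB.2]).
have fset_eq (A B : {fset U}) : [seq h x | x <- enum_fset A] = [seq h x | x <- enum_fset B] -> A = B.
  by move=> /(inj_map h_inj) e; apply/fsetP => x; rewrite -[x \in A]/(x \in enum_fset A) e.
have fcode_inj : injective fcode.
  by move=> [A B] [A' B'] /(pcan_inj choice.pickleK)[/fset_eq /= -> /fset_eq /= ->].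
have [dec dc] := decoding fcode_inj.
exists (fun n => [set nu : X | forall A B : {fset U}, dec n = Some (A, B) ->
    #|` A| = k -> #|` B| = k -> exists g, translate (family_of nu) [set` A] g = [set` B]]).
  move=> n; rewrite openE => mu hmu; apply/taut_nbhs.
  case dn : (dec n) hmu => [[A B]|] hmu; last by exists [::] => nu _ A B.
  have [[cA cB]|no] := pselect (#|` A| = k /\ #|` B| = k); last first.
    by exists [::] => nu _ A' B' [<- <-] cA cB; case: no.
  have [g eg] := hmu A B erefl cA cB.
  exists [seq (g, x) | x <- enum_fset A] => nu ag A' B' [<- <-] _ _; exists g.
  have [rm _ _] := taut_spaceP nu; apply: (translate_fset rm); first by rewrite cA.
  move=> x xA; rewrite (ag (g, x)) ?map_f //=.
  have : translate (family_of mu) [set` A] g (ev mu g x) by exists x.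
  by rewrite eg.
apply/seteqP; split=> [nu [tr _] n _ A B _ cA cB|nu hnu].
  by apply: tr; apply/card_eq_fsetP.
apply: (taut_sharply_transitive (taut_spaceP nu)) => A B cA cB.
by apply: (hnu (fcode (A, B)) Logic.I A B) => //; apply: dc.
Qed.

End Link.

Local Open Scope classical_set_scope.
Local Open Scope card_scope.

Theorem proposition6p2 (R : realType) (k : nat) (k_ge1 : (1 <= k)%N)
    (Theta : {group 'S_k}) (Theta_robust : robust Theta)
    (U : choiceType) (U_countably_infinite : [set: U] #= [set: nat])
    (lambda : {action [subg Theta] &-> U}) (lambda_seed : seed_action lambda)
    (D : {set {group [subg Theta]}}) (D_reps : docile_representatives D)
    (T : rep_index D -> finType) (T_ge2 : forall W, (2 <= #|T W|)%N) :
  [/\ [set: taut_space T lambda] !=set0,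
      perfect_set [set: taut_space T lambda],
      polish R (taut_space T lambda),
      [set: taut_space T lambda] #= [set: nat -> bool]
    & dense (STT T lambda) /\ Gdelta (STT T lambda)].
Proof.
have [V [f [cV V_inv V_free [f_inj f_surj f_eqv]]]] := seed_support lambda_seed.
have U_count : exists h : U -> nat, injective h.
  have /card_set_bijP[h [_ h_inj _]] := U_countably_infinite.
  by exists h => x y; apply: h_inj; rewrite inE.
have U_inf (F : {fset U}) : exists x, x \notin F.
  apply: contrapT => nF; apply: infinite_nat.
  rewrite -(eq_finite_set U_countably_infinite).
  apply: sub_finite_set (finite_fset F) => x _ /=.
  by apply: contrapT => /negP xF; apply: nF; exists x.
split.
- exact: (taut_space_nonempty k_ge1 Theta_robust U_count U_inf D_reps T_ge2 cV
    V_inv V_free f_inj f_surj f_eqv).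
- exact: (taut_space_perfect k_ge1 Theta_robust U_count U_inf D_reps T_ge2 cV
    V_inv V_free f_inj f_surj f_eqv).
- exact: taut_space_polish.
- exact: (taut_space_card k_ge1 Theta_robust U_count U_inf D_reps T_ge2 cV
    V_inv V_free f_inj f_surj f_eqv).
split.
- exact: (STT_dense k_ge1 Theta_robust U_count U_inf D_reps T_ge2 cV
    V_inv V_free f_inj f_surj f_eqv).
exact: (STT_Gdelta k_ge1 Theta_robust U_count U_inf D_reps T_ge2 cV
    V_inv V_free f_inj f_surj f_eqv).
Qed.
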